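(* Let $(a,b) \in \mathbb{C}^2 \setminus \{(0,0)\}$ be fixed, and for each $\nu \in \mathbb{R}$ define $\mathbf{J}_\nu : (0,\infty) \to \mathbb{C}$ by $\mathbf{J}_\nu(r) := a J_\nu(r) + b Y_\nu(r)$, where $J_\nu$ and $Y_\nu$ are the Bessel functions of the first and second kinds of order $\nu$, respectively. Let $\mu \in (-1/2, 1/2)$, $\nu \in [0,\infty)$, and $r \in (0,\infty)$. Then $$ |\mathbf{J}_{\mu+\nu}(r)|^2 < |\mathbf{J}_{\nu-1/2}(r)|^2 + |\mathbf{J}_{\nu+1/2}(r)|^2 . $$
   Context: $J_\nu$ and $Y_\nu$ denote the standard Bessel functions of the first and second kinds of real order $\nu$, restricted to the positive half-line $(0,\infty)$, where they are real-valued. The coefficients $a,b$ do not depend on the order $\nu$. *)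

(* Defs.v *)
From Stdlib Require Import Reals Factorial.
From Coquelicot Require Import Coquelicot.
Open Scope R_scope.

(* 1 / Gamma(z) for every real z, by Gauss's limit formula
     1/Gamma(z) = lim_n z (z+1) ... (z+n) / (n! n^z);
   it is 0 at the poles z = 0, -1, -2, ... of Gamma.  The term n = 0, where
   Rpower is applied to 0, does not affect the limit. *)
Definition rGamma (z : R) : R :=
  real (Lim_seq (fun n : nat =>
    prod_f_R0 (fun k : nat => z + INR k) n
      / (INR (fact n) * Rpower (INR n) z))).

(* J_nu(x) = (x/2)^nu * sum_k (-1)^k (x^2/4)^k / (k! Gamma(nu+k+1)).
   Meaningful for x > 0 only, as Rpower is the real power of a positive base. *)
Definition besselJ (nu x : R) : R :=
  Rpower (x / 2) nu *
  PSeries (fun k : nat => (-1) ^ k * rGamma (nu + INR k + 1) / INR (fact k))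
    (x ^ 2 / 4).

Definition besselY_quot (nu x : R) : R :=
  (besselJ nu x * cos (nu * PI) - besselJ (- nu) x) / sin (nu * PI).

(* The quotient, or its limit in the order when nu is an integer, that is when
   sin (nu * PI) = 0.  Lim does not evaluate the quotient at nu itself. *)
Definition besselY (nu x : R) : R :=
  if Req_EM_T (sin (nu * PI)) 0
  then real (Lim (fun s : R => besselY_quot s x) nu)
  else besselY_quot nu x.

Definition bessel_comb (a b : C) (nu r : R) : C :=
  (a * RtoC (besselJ nu r) + b * RtoC (besselY nu r))%C.

(* Main.v *)
(** All Bessel functions share the recurrences of [cylinder] below, and by Schlaefli's integrals
    the order [s] only rotates their oscillation at [oo] by the angle [s * PI / 2].  With
    [d := 1/2 - mu], the same coefficients [alpha] and [beta] therefore satisfy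
      [J (mu + nu) = alpha * J (nu - 1/2) + beta * J (nu + 1/2)] and
      [Y (mu + nu) = alpha * Y (nu - 1/2) + beta * Y (nu + 1/2)].
    By Dixon and Ferrar's formula they are, up to a common constant,
      [r * int_0^oo K_d (2 r sinh t) exp (- (2 nu + 1 - d) t) dt] and
      [r * int_0^oo K_(1-d) (2 r sinh t) exp (- (2 nu - d) t) dt];
    this holds because both sides solve the same linear differential system with the same
    behaviour at [oo].  Both integrals are positive and decrease in [nu], so [alpha^2 + beta^2 < 1]
    reduces to [nu = 0], where it follows from the monotonicity of a Sturm energy. *)

(* The functions are given at [0], by a series and, for [Y] at integer orders, by a limit in the
   order, whereas the interpolation is pinned down at [oo]. Schlaefli's integrals bridge the two
   ends. Matching them with the series requires the leading coefficient at [0]; this is where Gamma,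
   the Bohr-Mollerup argument and the reflection formula come in. At [oo] the oscillation of order
   [0] is kept as a reference and never expanded: it is enough that the order rotates it up to
   [O(1/r)], because a solution that is [O(1/r)] must vanish, nonzero ones being of size [r^(-1/2)].
   The comparison leaves two constants, one along the function itself and one along its quarter
   turn. The second vanishes, since [J] stays bounded at [0] for nonnegative orders and [Y] does
   not; the first is then the hypotenuse over the limits of the two integrals, which is exactly what
   the limit of the Sturm energy produces. Since the weights are real, complex [a] and [b] cost only
   a Cauchy-Schwarz inequality for real and imaginary parts; strictness also uses that consecutive
   orders have no common zero. *)
Require Import Defs.
From Stdlib Require Import Reals Factorial Lra Lia.
From Coquelicot Require Import Coquelicot.
Open Scope R_scope.

(** * Improper integrals of exponentially decaying functions *)

(* Coquelicot hides [R] behind a structure that [ring] does not see through. *)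
Ltac real_eq := match goal with |- ?a = ?b => change (@eq R a b) end.

Ltac auto_continuous := match goal with
  | |- continuous ?f ?x => apply (ex_derive_continuous f x); auto_derive; auto
  | |- continuity_pt ?f ?x => apply continuity_pt_filterlim, (ex_derive_continuous f x); auto_derive; auto
  end.

Ltac eta_reduce := repeat match goal with
  | |- context [fun x : _ => ?f x] => change (fun x : _ => f x) with f end.

Lemma INR_S_pos (n : nat) : 0 < INR (S n).
Proof. apply lt_0_INR, Nat.lt_0_succ. Qed.

(** Two applications of the mean value theorem. The constant is twice that of Taylor's formula,
    which is harmless: the bound only serves to differentiate under an integral sign. *)
Lemma taylor_quadratic_bound (f f1 f2 : R -> R) (r h0 B : R) :
  (forall x, Rabs (x - r) < h0 -> is_derive f x (f1 x)) ->
  (forall x, Rabs (x - r) < h0 -> is_derive f1 x (f2 x)) ->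
  (forall x, Rabs (x - r) < h0 -> Rabs (f2 x) <= B) ->
  forall h, Rabs h < h0 -> Rabs (f (r + h) - f r - h * f1 r) <= B * h ^ 2.
Proof.
  intros D1 D2 HB h Hh.
  assert (near : forall x y, Rabs (y - r) <= Rabs h ->
    Rmin r y <= x <= Rmax r y -> Rabs (x - r) <= Rabs (y - r)).
  { intros x y Hy. unfold Rmin, Rmax. destruct (Rle_dec r y); intros Hx;
    unfold Rabs; repeat destruct Rcase_abs; lra. }
  assert (rh : r + h - r = h) by ring.
  destruct (MVT_gen f r (r + h) f1) as [c [Hc Ec]].
  - intros x Hx. apply D1. eapply Rle_lt_trans; [apply (near x (r + h)) | ]; try lra.
    rewrite rh; lra. rewrite rh; lra.
  - intros x Hx. apply continuity_pt_filterlim, (ex_derive_continuous f).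
    exists (f1 x). apply D1.
    eapply Rle_lt_trans; [apply (near x (r + h)) | ]; try lra; rewrite rh; lra.
  - assert (Hcr : Rabs (c - r) <= Rabs h).
    { rewrite <- rh. apply (near c (r + h)); auto. rewrite rh; lra. }
    destruct (MVT_gen f1 r c f2) as [d [Hd Ed]].
    + intros x Hx. apply D2. eapply Rle_lt_trans; [apply (near x c) | ]; lra.
    + intros x Hx. apply continuity_pt_filterlim, (ex_derive_continuous f1).
      exists (f2 x). apply D2.
      eapply Rle_lt_trans; [apply (near x c) | ]; lra.
    + assert (Hdr : Rabs (d - r) < h0).
      { eapply Rle_lt_trans; [apply (near d c) | ]; lra. }
      replace (f (r + h) - f r - h * f1 r) with (f2 d * ((c - r) * h))
        by (replace (f (r + h) - f r) with (f1 c * (r + h - r)) by lra;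
            replace (f1 c) with (f1 r + f2 d * (c - r)) by lra; ring).
      rewrite !Rabs_mult. rewrite <- (pow2_abs h).
      specialize (HB d Hdr). pose proof (Rabs_pos (f2 d)). pose proof (Rabs_pos h).
      pose proof (Rabs_pos (c - r)).
      replace (B * Rabs h ^ 2) with (B * (Rabs h * Rabs h)) by ring.
      apply Rmult_le_compat; try apply Rmult_le_pos; auto.
      apply Rmult_le_compat; lra.
Qed.

Lemma is_derive_of_quadratic_bound (F : R -> R) (r l h0 B : R) :
  0 < h0 ->
  (forall h, Rabs h < h0 -> Rabs (F (r + h) - F r - h * l) <= B * h ^ 2) ->
  is_derive F r l.
Proof.
  intros Hh0 H. apply is_derive_Reals. intros eps Heps.
  assert (HB : 0 < Rabs B + 1) by (pose proof (Rabs_pos B); lra).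
  assert (Hd : 0 < Rmin h0 (eps / (Rabs B + 1))).
  { apply Rmin_pos; auto. apply Rdiv_lt_0_compat; auto. }
  exists (mkposreal _ Hd). intros h Hh0' Hh. simpl in Hh.
  assert (Hh1 : Rabs h < h0) by (eapply Rlt_le_trans; [exact Hh | apply Rmin_l]).
  assert (Hh2 : Rabs h < eps / (Rabs B + 1)) by (eapply Rlt_le_trans; [exact Hh | apply Rmin_r]).
  replace ((F (r + h) - F r) / h - l) with ((F (r + h) - F r - h * l) / h) by (field; auto).
  unfold Rdiv. rewrite Rabs_mult, Rabs_inv.
  assert (Hp : 0 < Rabs h) by (apply Rabs_pos_lt; auto).
  apply Rmult_lt_reg_r with (Rabs h); auto.
  rewrite Rmult_assoc, Rinv_l, Rmult_1_r by lra.
  eapply Rle_lt_trans; [apply H; auto | ].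
  rewrite <- pow2_abs.
  apply Rle_lt_trans with ((Rabs B * Rabs h) * Rabs h).
  - pose proof (Rle_abs B). simpl. rewrite Rmult_1_r, <- Rmult_assoc.
    apply Rmult_le_compat_r; try lra. apply Rmult_le_compat_r; lra.
  - apply Rmult_lt_compat_r; auto.
    apply Rle_lt_trans with ((Rabs B + 1) * Rabs h); [nra | ].
    apply Rmult_lt_compat_l with (r := Rabs B + 1) in Hh2; auto.
    replace ((Rabs B + 1) * (eps / (Rabs B + 1))) with eps in Hh2 by (field; lra). lra.
Qed.

Definition exp_decay (f : R -> R) (C k : R) : Prop :=
  0 < k /\ forall u, 0 <= u -> Rabs (f u) <= C * exp (- (k * u)).

Definition dominated (f : R -> R) : Prop :=
  (forall u, continuous f u) /\ exists C k, exp_decay f C k.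

(** Meaningful for [dominated] integrands, for which the limit along integer upper bounds exists and
    is finite. *)
Definition integral_inf (f : R -> R) : R :=
  real (Lim_seq (fun n => RInt f 0 (INR n))).

Lemma ex_RInt_cont (f : R -> R) (a b : R) :
  (forall u, continuous f u) -> ex_RInt f a b.
Proof. intros H. apply (ex_RInt_continuous f). auto. Qed.

Lemma exp_decay_le (f : R -> R) (C1 C2 k1 k2 : R) :
  C1 <= C2 -> 0 < k2 <= k1 -> exp_decay f C1 k1 -> exp_decay f C2 k2.
Proof.
  intros HC Hk [H1 H]. split; [lra | ]. intros u Hu.
  assert (0 <= C1).
  { specialize (H 0 (Rle_refl 0)). rewrite Rmult_0_r, Ropp_0, exp_0 in H.
    pose proof (Rabs_pos (f 0)). lra. }
  eapply Rle_trans; [apply H; auto | ].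
  apply Rmult_le_compat; auto. left; apply exp_pos.
  destruct (Rle_lt_or_eq_dec (- (k1 * u)) (- (k2 * u))) as [H2 | H2]; [nra | | ].
  left; apply exp_increasing; auto. rewrite H2; lra.
Qed.

Lemma RInt_exp_neg (C k b : R) : 0 < k ->
  RInt (fun u => C * exp (- (k * u))) 0 b = C / k * (1 - exp (- (k * b))).
Proof.
  intros Hk. apply is_RInt_unique.
  replace (C / k * (1 - exp (- (k * b)))) with
    (minus (- (C / k) * exp (- (k * b))) (- (C / k) * exp (- (k * 0)))).
  - apply (is_RInt_derive (fun u => - (C / k) * exp (- (k * u)))).
    + intros x _. auto_derive; auto. field; lra.
    + intros x _. auto_continuous.
  - rewrite Rmult_0_r, Ropp_0, exp_0. unfold minus, plus, opp; simpl. ring.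
Qed.

Lemma is_lim_seq_exp_neg (k : R) : 0 < k ->
  is_lim_seq (fun n => exp (- (k * INR n))) 0.
Proof.
  intros Hk. apply (is_lim_seq_ext (fun n => (exp (- k)) ^ n)).
  - intros n. induction n as [ | n IHn].
    + change (INR 0) with 0. rewrite Rmult_0_r, Ropp_0, exp_0. reflexivity.
    + rewrite <- tech_pow_Rmult, IHn, <- exp_plus, S_INR. f_equal. ring.
  - apply is_lim_seq_geom. rewrite Rabs_pos_eq. rewrite <- exp_0. apply exp_increasing; lra.
    left; apply exp_pos.
Qed.

(** Adding [C * exp (- (k * u))] makes the integrand nonnegative, so that its partial integrals
    increase and stay below [2 * C / k]; the added term has an explicit integral, subtracted at the
    end. *)
Lemma integral_inf_correct (f : R -> R) : dominated f ->
  is_lim_seq (fun n => RInt f 0 (INR n)) (integral_inf f).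
Proof.
  intros [Hc [C [k [Hk H]]]].
  assert (Hce : forall u, continuous (fun u => C * exp (- (k * u))) u).
  { intros u. auto_continuous. }
  assert (HC : 0 <= C).
  { specialize (H 0 (Rle_refl 0)). rewrite Rmult_0_r, Ropp_0, exp_0 in H.
    pose proof (Rabs_pos (f 0)). lra. }
  set (g := fun u => f u + C * exp (- (k * u))).
  assert (Hg : forall u, continuous g u) by (intros; apply (continuous_plus f); auto).
  assert (Eg : forall b, RInt g 0 b = RInt f 0 b + C / k * (1 - exp (- (k * b)))).
  { intros b. rewrite <- (RInt_exp_neg C k b) by auto.
    apply (RInt_plus f); apply ex_RInt_cont; auto. }
  assert (Hgp : forall u, 0 <= u -> 0 <= g u <= 2 * C * exp (- (k * u))).
  { intros u Hu. unfold g. specialize (H u Hu). apply Rabs_le_between in H. lra. }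
  apply Lim_seq_correct'.
  destruct (ex_finite_lim_seq_incr (fun n => RInt g 0 (INR n)) (2 * C / k)) as [l Hl].
  - intros n. rewrite <- (RInt_Chasles g 0 (INR n) (INR (S n))); [ | apply ex_RInt_cont; auto ..].
    assert (0 <= RInt g (INR n) (INR (S n))).
    { apply RInt_ge_0. rewrite S_INR; lra. apply ex_RInt_cont; auto.
      intros x Hx. apply Hgp. pose proof (pos_INR n). lra. }
    change (RInt g 0 (INR n) <= RInt g 0 (INR n) + RInt g (INR n) (INR (S n))). lra.
  - intros n. apply Rle_trans with (RInt (fun u => 2 * C * exp (- (k * u))) 0 (INR n)).
    + apply RInt_le; try apply ex_RInt_cont; auto. apply pos_INR.
      intros u. auto_continuous.
      intros x Hx. apply Hgp; lra.
    + rewrite RInt_exp_neg by auto.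
      pose proof (exp_pos (- (k * INR n))).
      assert (0 <= 2 * C / k) by (apply Rdiv_le_0_compat; lra). nra.
  - exists (l - C / k * (1 - 0)).
    apply (is_lim_seq_ext (fun n => RInt g 0 (INR n) - C / k * (1 - exp (- (k * INR n))))).
    intros n. rewrite Eg. ring.
    apply is_lim_seq_minus'; auto.
    apply (is_lim_seq_scal_l _ (C / k) (1 - 0)).
    apply is_lim_seq_minus'. apply is_lim_seq_const. apply is_lim_seq_exp_neg; auto.
Qed.

Lemma integral_inf_unique (f : R -> R) (l : R) :
  is_lim_seq (fun n => RInt f 0 (INR n)) l -> integral_inf f = l.
Proof. intros H. unfold integral_inf. now rewrite (is_lim_seq_unique _ _ H). Qed.

Lemma dominated_plus (f g : R -> R) :
  dominated f -> dominated g -> dominated (fun u => f u + g u).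
Proof.
  intros [Hf [C1 [k1 H1]]] [Hg [C2 [k2 H2]]]. split.
  - intros u. apply (continuous_plus f); auto.
  - assert (Hk : 0 < Rmin k1 k2) by (apply Rmin_pos; [apply H1 | apply H2]).
    exists (C1 + C2), (Rmin k1 k2). split; auto. intros u Hu.
    eapply Rle_trans; [apply Rabs_triang | ].
    rewrite Rmult_plus_distr_r. apply Rplus_le_compat.
    + apply (exp_decay_le f C1 C1 k1 (Rmin k1 k2)); auto using Rle_refl. split; auto using Rmin_l.
    + apply (exp_decay_le g C2 C2 k2 (Rmin k1 k2)); auto using Rle_refl. split; auto using Rmin_r.
Qed.

Lemma dominated_scal (c : R) (f : R -> R) :
  dominated f -> dominated (fun u => c * f u).
Proof.
  intros [Hf [C1 [k1 [Hk H1]]]]. split.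
  - intros u. apply (continuous_mult (fun _ => c)); auto. apply continuous_const.
  - exists (Rabs c * C1), k1. split; auto. intros u Hu.
    rewrite Rabs_mult, Rmult_assoc. apply Rmult_le_compat_l; auto using Rabs_pos.
Qed.

Lemma integral_inf_ext (f g : R -> R) :
  (forall u, 0 <= u -> f u = g u) -> integral_inf f = integral_inf g.
Proof.
  intros E. unfold integral_inf. f_equal. apply Lim_seq_ext. intros n.
  apply RInt_ext. intros x. rewrite Rmin_left by apply pos_INR. intros Hx. apply E; lra.
Qed.

Lemma integral_inf_plus (f g : R -> R) : dominated f -> dominated g ->
  integral_inf (fun u => f u + g u) = integral_inf f + integral_inf g.
Proof.
  intros Hf Hg. apply integral_inf_unique.
  apply (is_lim_seq_ext (fun n => RInt f 0 (INR n) + RInt g 0 (INR n))).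
  - intros n. symmetry. apply (RInt_plus f); apply ex_RInt_cont; [apply Hf | apply Hg].
  - apply is_lim_seq_plus'; apply integral_inf_correct; auto.
Qed.

Lemma integral_inf_scal (c : R) (f : R -> R) : dominated f ->
  integral_inf (fun u => c * f u) = c * integral_inf f.
Proof.
  intros Hf. apply integral_inf_unique.
  apply (is_lim_seq_ext (fun n => c * RInt f 0 (INR n))).
  - intros n. symmetry. apply (RInt_scal f); apply ex_RInt_cont; apply Hf.
  - apply (is_lim_seq_scal_l _ c (integral_inf f)). apply integral_inf_correct; auto.
Qed.

Lemma integral_inf_lin (c d : R) (f g : R -> R) : dominated f -> dominated g ->
  integral_inf (fun u => c * f u + d * g u) = c * integral_inf f + d * integral_inf g.
Proof.
  intros Hf Hg. rewrite (integral_inf_plus (fun u => c * f u) (fun u => d * g u)).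
  now rewrite !integral_inf_scal. all: apply dominated_scal; auto.
Qed.

Lemma dominated_lin (c d : R) (f g : R -> R) : dominated f -> dominated g ->
  dominated (fun u => c * f u + d * g u).
Proof. intros. apply dominated_plus; apply dominated_scal; auto. Qed.

Lemma integral_inf_le (f g : R -> R) : dominated f -> dominated g ->
  (forall u, 0 <= u -> f u <= g u) -> integral_inf f <= integral_inf g.
Proof.
  intros Hf Hg H.
  apply (is_lim_seq_le (fun n => RInt f 0 (INR n)) (fun n => RInt g 0 (INR n))
    (integral_inf f) (integral_inf g)); try apply integral_inf_correct; auto.
  intros n. apply RInt_le; try apply ex_RInt_cont; try apply Hf; try apply Hg.
  apply pos_INR. intros; apply H; lra.
Qed.

Lemma dominated_exp (C k : R) : 0 < k -> dominated (fun u => C * exp (- (k * u))).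
Proof.
  intros Hk. split.
  - intros u. auto_continuous.
  - exists (Rabs C), k. split; auto. intros u Hu. rewrite Rabs_mult.
    rewrite (Rabs_pos_eq (exp _)). lra. left; apply exp_pos.
Qed.

Lemma integral_inf_exp (C k : R) : 0 < k ->
  integral_inf (fun u => C * exp (- (k * u))) = C / k.
Proof.
  intros Hk. apply integral_inf_unique.
  apply (is_lim_seq_ext (fun n => C / k * (1 - exp (- (k * INR n))))).
  - intros n. now rewrite RInt_exp_neg.
  - replace (Finite (C / k)) with (Rbar_mult (C / k) (1 - 0)) by (simpl; f_equal; ring).
    apply is_lim_seq_scal_l. apply is_lim_seq_minus'.
    apply is_lim_seq_const. apply is_lim_seq_exp_neg; auto.
Qed.

Lemma integral_inf_abs_le (f g : R -> R) : dominated f -> dominated g ->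
  (forall u, 0 <= u -> Rabs (f u) <= g u) -> Rabs (integral_inf f) <= integral_inf g.
Proof.
  intros Hf Hg H. apply Rabs_le. split.
  - replace (- integral_inf g) with (-1 * integral_inf g) by ring.
    rewrite <- integral_inf_scal by auto.
    apply integral_inf_le; auto. apply dominated_scal; auto.
    intros u Hu. specialize (H u Hu). apply Rabs_le_between in H. lra.
  - apply integral_inf_le; auto.
    intros u Hu. specialize (H u Hu). apply Rabs_le_between in H. lra.
Qed.

Lemma integral_inf_bound (f : R -> R) (C k : R) :
  (forall u, continuous f u) -> exp_decay f C k -> Rabs (integral_inf f) <= C / k.
Proof.
  intros Hc [Hk H]. rewrite <- integral_inf_exp by auto.
  apply integral_inf_abs_le; auto using dominated_exp.
  split; auto. exists C, k; split; auto.
Qed.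

Lemma integral_inf_RInt_le (f : R -> R) (n : nat) : dominated f ->
  (forall u, 0 <= u -> 0 <= f u) -> RInt f 0 (INR n) <= integral_inf f.
Proof.
  intros Hf H.
  apply (is_lim_seq_incr_compare (fun n => RInt f 0 (INR n)) (integral_inf f)).
  - apply integral_inf_correct; auto.
  - intros m. rewrite <- (RInt_Chasles f 0 (INR m) (INR (S m))); try (apply ex_RInt_cont; apply Hf).
    assert (0 <= RInt f (INR m) (INR (S m))).
    { apply RInt_ge_0. rewrite S_INR; lra. apply ex_RInt_cont; apply Hf.
      intros x Hx. apply H. pose proof (pos_INR m). lra. }
    change (RInt f 0 (INR m) <= RInt f 0 (INR m) + RInt f (INR m) (INR (S m))). lra.
Qed.

Lemma integral_inf_pos (f : R -> R) : dominated f ->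
  (forall u, 0 <= u -> 0 < f u) -> 0 < integral_inf f.
Proof.
  intros Hf H. apply Rlt_le_trans with (RInt f 0 (INR 1)).
  - apply RInt_gt_0. simpl; lra. intros; apply H; lra. intros; apply Hf.
  - apply integral_inf_RInt_le; auto. intros u Hu; left; auto.
Qed.

Lemma integral_inf_derive (f g : R -> R) (C k : R) :
  (forall u, is_derive f u (g u)) -> dominated g -> exp_decay f C k ->
  integral_inf g = - f 0.
Proof.
  intros D Hg [Hk H]. apply integral_inf_unique.
  apply (is_lim_seq_ext (fun n => f (INR n) - f 0)).
  - intros n. symmetry. apply is_RInt_unique. apply (is_RInt_derive f g); auto.
    intros; apply Hg.
  - replace (Finite (- f 0)) with (Finite (0 - f 0)) by (f_equal; ring).
    apply is_lim_seq_minus'; [ | apply is_lim_seq_const].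
    apply is_lim_seq_abs_0.
    apply (is_lim_seq_le_le (fun _ => 0) _ (fun n => C * exp (- (k * INR n)))).
    + intros n. split. apply Rabs_pos. apply H, pos_INR.
    + apply is_lim_seq_const.
    + replace (Finite 0) with (Rbar_mult C 0) by (simpl; f_equal; ring).
      apply is_lim_seq_scal_l, is_lim_seq_exp_neg; auto.
Qed.

(** The majorant of [f2] is uniform for parameters near [r], so the pointwise Taylor remainder
    integrates to at most [C / k * h ^ 2]. *)
Lemma is_derive_integral_inf (f f1 f2 : R -> R -> R) (r h0 C k : R) :
  0 < h0 ->
  (forall x, Rabs (x - r) < h0 -> dominated (f x)) -> dominated (f1 r) ->
  (forall x u, Rabs (x - r) < h0 -> is_derive (fun y => f y u) x (f1 x u)) ->
  (forall x u, Rabs (x - r) < h0 -> is_derive (fun y => f1 y u) x (f2 x u)) ->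
  (forall x, Rabs (x - r) < h0 -> exp_decay (f2 x) C k) ->
  is_derive (fun y => integral_inf (f y)) r (integral_inf (f1 r)).
Proof.
  intros Hh0 Df Df1 D1 D2 B.
  apply is_derive_of_quadratic_bound with (h0 := h0) (B := C / k); auto.
  intros h Hh.
  assert (Hr : Rabs (r - r) < h0) by (rewrite Rminus_diag, Rabs_R0; auto).
  assert (Hrh : Rabs (r + h - r) < h0) by (replace (r + h - r) with h by ring; auto).
  replace (integral_inf (f (r + h)) - integral_inf (f r) - h * integral_inf (f1 r)) with
    (integral_inf (fun u => 1 * (f (r + h) u) + 1 * ((-1) * f r u + (- h) * f1 r u))).
  2:{ rewrite (integral_inf_lin 1 1 (f (r + h)) (fun u => (-1) * f r u + (- h) * f1 r u)); auto.
      rewrite (integral_inf_lin (-1) (- h) (f r) (f1 r)); auto. ring.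
      apply dominated_lin; auto. }
  replace (C / k * h ^ 2) with ((C * h ^ 2) / k) by (unfold Rdiv; ring).
  apply integral_inf_bound.
  - apply (dominated_lin 1 1 (f (r + h)) (fun u => (-1) * f r u + (- h) * f1 r u)); auto.
    apply dominated_lin; auto.
  - split. apply (B r Hr). intros u Hu.
    replace (1 * f (r + h) u + 1 * (-1 * f r u + - h * f1 r u)) with
      (f (r + h) u - f r u - h * f1 r u) by ring.
    replace (C * h ^ 2 * exp (- (k * u))) with (C * exp (- (k * u)) * h ^ 2) by ring.
    apply (taylor_quadratic_bound (fun y => f y u) (fun y => f1 y u) (fun y => f2 y u) r h0); auto.
    intros x Hx. apply B; auto.
Qed.

Lemma is_derive_RInt_quadratic (f f1 f2 : R -> R -> R) (a b r h0 B : R) :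
  a <= b -> 0 < h0 ->
  (forall x u, continuous (f x) u) -> (forall u, continuous (f1 r) u) ->
  (forall x u, is_derive (fun y => f y u) x (f1 x u)) ->
  (forall x u, is_derive (fun y => f1 y u) x (f2 x u)) ->
  (forall x u, Rabs (x - r) < h0 -> a <= u <= b -> Rabs (f2 x u) <= B) ->
  is_derive (fun y => RInt (f y) a b) r (RInt (f1 r) a b).
Proof.
  intros Hab Hh0 Cf Cf1 D1 D2 HB.
  apply is_derive_of_quadratic_bound with (h0 := h0) (B := (b - a) * B); auto.
  intros h Hh.
  assert (E : RInt (f (r + h)) a b - RInt (f r) a b - h * RInt (f1 r) a b =
    RInt (fun u => f (r + h) u - f r u - h * f1 r u) a b).
  { symmetry. apply is_RInt_unique.
    apply (is_RInt_minus (fun u => f (r + h) u - f r u) (fun u => h * f1 r u)).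
    apply (is_RInt_minus (f (r + h)) (f r)).
    1,2 : apply (RInt_correct (f _)), ex_RInt_cont; auto.
    apply (is_RInt_scal (f1 r)), (RInt_correct (f1 r)), ex_RInt_cont; auto. }
  rewrite E.
  assert (Ct : forall u, continuous (fun u => f (r + h) u - f r u - h * f1 r u) u).
  { intros u. apply (continuous_minus (fun u => f (r + h) u - f r u) (fun u => h * f1 r u)).
    apply (continuous_minus (f (r + h)) (f r)); auto.
    apply (continuous_mult (fun _ => h)); auto. apply continuous_const. }
  replace ((b - a) * B * h ^ 2) with (B * h ^ 2 * (b - a)) by ring.
  rewrite Rmult_comm.
  apply abs_RInt_le_const; auto. apply ex_RInt_cont; auto.
  intros u Hu.
  apply (taylor_quadratic_bound (fun y => f y u) (fun y => f1 y u) (fun y => f2 y u) r h0); auto.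
Qed.

(** * The integrals of exp (- p t - c sinh t) *)

Lemma is_derive_sinh (t : R) : is_derive sinh t (cosh t).
Proof. unfold sinh, cosh. auto_derive; auto. field. Qed.

Lemma exp_ge_quadratic (t : R) : 0 <= t -> 1 + t + t ^ 2 / 2 <= exp t.
Proof.
  intros Ht.
  destruct (Req_dec t 0) as [-> | Hne]. rewrite exp_0; lra.
  destruct (MVT_gen (fun t => exp t - (1 + t + t ^ 2 / 2)) 0 t (fun t => exp t - (1 + t)))
    as [c [Hc E]].
  - intros x _. auto_derive; auto. field.
  - intros x _. auto_continuous.
  - rewrite exp_0 in E. rewrite Rmin_left, Rmax_right in Hc by lra.
    pose proof (exp_ineq1_le c). nra.
Qed.

Lemma exp_neg_le_1 (t : R) : 0 <= t -> exp (- t) <= 1.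
Proof.
  intros [H | <-]. rewrite <- exp_0. left; apply exp_increasing; lra. rewrite Ropp_0, exp_0; lra.
Qed.

Lemma exp_le (x y : R) : x <= y -> exp x <= exp y.
Proof. intros [H | ->]. left; apply exp_increasing; auto. lra. Qed.

Lemma sinh_ge_quadratic (t : R) : 0 <= t -> t ^ 2 / 4 <= sinh t.
Proof.
  intros Ht. pose proof (exp_ge_quadratic t Ht). pose proof (exp_neg_le_1 t Ht).
  unfold sinh. lra.
Qed.

Lemma cosh_ge_1 (t : R) : 1 <= cosh t.
Proof.
  unfold cosh. pose proof (exp_pos (- t)) as H.
  assert (E : exp t * exp (- t) = 1) by (rewrite <- exp_plus, Rplus_opp_r, exp_0; auto).
  pose proof (Rmult_le_pos _ _ (Rlt_le _ _ H) (pow2_ge_0 (exp t - 1))) as H1.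
  replace (exp (- t) * (exp t - 1) ^ 2) with
    (exp t * exp (- t) * exp t - 2 * (exp t * exp (- t)) + exp (- t)) in H1 by ring.
  rewrite E in H1. lra.
Qed.

Lemma sinh_ge (t : R) : 0 <= t -> t <= sinh t.
Proof.
  intros Ht.
  destruct (Req_dec t 0) as [-> | Hne]. rewrite sinh_0; lra.
  destruct (MVT_gen sinh 0 t cosh) as [c [Hc E]].
  - intros x _. apply is_derive_sinh.
  - intros x _. apply continuity_pt_filterlim.
    apply (ex_derive_continuous sinh). eexists; apply is_derive_sinh.
  - rewrite sinh_0 in E.
    pose proof (cosh_ge_1 c).
    nra.
Qed.

(** The [k]-th power of [y <= exp y] at [y = x / (k + 1)]; dividing by [k + 1] instead of [k] covers
    [k = 0]. *)
Lemma pow_le_exp (k : nat) (x : R) : 0 <= x -> x ^ k <= INR (S k) ^ k * exp x.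
Proof.
  intros Hx. pose proof (INR_S_pos k) as Hk.
  set (y := x / INR (S k)).
  assert (Hy : 0 <= y) by (apply Rdiv_le_0_compat; auto).
  replace x with (INR (S k) * y) at 1 by (unfold y; field; lra).
  rewrite Rpow_mult_distr. apply Rmult_le_compat_l. apply pow_le; lra.
  apply Rle_trans with (exp y ^ k).
  - apply pow_incr. split; auto. pose proof (exp_ineq1_le y). lra.
  - rewrite <- Rpower_pow by apply exp_pos. unfold Rpower. rewrite ln_exp. apply exp_le.
    unfold y. rewrite S_INR in *. apply Rmult_le_reg_r with (INR k + 1); auto.
    unfold Rdiv. rewrite <- Rmult_assoc, Rmult_assoc, Rinv_l by lra. pose proof (pos_INR k). nra.
Qed.

(** For [k = 0] the integral is the non-oscillating part of Schlaefli's integrals; the powers of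
    [sinh t] are what differentiation in [c] brings down. *)
Definition moment_fun (k : nat) (p c t : R) : R := sinh t ^ k * exp (- (p * t) - c * sinh t).

Definition moment (k : nat) (p c : R) : R := integral_inf (moment_fun k p c).

Notation expint := (moment 0).

Lemma moment_continuous (k : nat) (p c t : R) : continuous (moment_fun k p c) t.
Proof.
  apply (ex_derive_continuous (moment_fun k p c)). unfold moment_fun, sinh. auto_derive; auto.
Qed.

(** The exponent [c * sinh t] is spent in three shares: one half absorbs [sinh t ^ k], one quarter
    gives [exp (- (c / 4 * t))] by [t <= sinh t], and the last quarter, by [t ^ 2 / 4 <= sinh t],
    dominates the linear term [(1 - p) * t] after completing the square. Only the last share uses
    [c0], so the bound is uniform in [c]. *)
Lemma moment_fun_bound (k : nat) (p c0 : R) : 0 < c0 ->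
  exists K, 0 < K /\ forall c t, c0 <= c -> 0 <= t ->
    0 <= moment_fun k p c t <= K / c ^ k * exp (- ((c / 4 + 1) * t)).
Proof.
  intros Hc0.
  exists ((2 * INR (S k)) ^ k * exp (4 * (1 - p) ^ 2 / c0)).
  pose proof (INR_S_pos k) as Hk.
  split. apply Rmult_lt_0_compat. apply pow_lt; lra. apply exp_pos.
  intros c t Hc Ht. unfold moment_fun.
  pose proof (sinh_ge t Ht) as H1. pose proof (sinh_ge_quadratic t Ht) as H2.
  split. apply Rmult_le_pos. apply pow_le; lra. left; apply exp_pos.
  assert (Hp : sinh t ^ k <= (2 * INR (S k)) ^ k / c ^ k * exp (c / 2 * sinh t)).
  { pose proof (pow_le_exp k (c / 2 * sinh t) ltac:(apply Rmult_le_pos; lra)) as Hp.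
    rewrite Rpow_mult_distr in Hp.
    replace (sinh t ^ k) with ((2 / c) ^ k * ((c / 2) ^ k * sinh t ^ k)).
    2:{ rewrite <- Rmult_assoc, <- Rpow_mult_distr. replace (2 / c * (c / 2)) with 1 by (field; lra).
        rewrite pow1. ring. }
    apply Rle_trans with ((2 / c) ^ k * (INR (S k) ^ k * exp (c / 2 * sinh t))).
    apply Rmult_le_compat_l; auto. apply pow_le, Rdiv_le_0_compat; lra.
    unfold Rdiv. rewrite !Rpow_mult_distr, pow_inv. apply Req_le. ring. }
  apply Rle_trans with ((2 * INR (S k)) ^ k / c ^ k * exp (c / 2 * sinh t) * exp (- (p * t) - c * sinh t)).
  apply Rmult_le_compat_r; auto. left; apply exp_pos.
  rewrite Rmult_assoc, <- exp_plus.
  replace ((2 * INR (S k)) ^ k * exp (4 * (1 - p) ^ 2 / c0) / c ^ k * exp (- ((c / 4 + 1) * t)))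
    with ((2 * INR (S k)) ^ k / c ^ k * (exp (4 * (1 - p) ^ 2 / c0) * exp (- ((c / 4 + 1) * t))))
    by (unfold Rdiv; ring).
  apply Rmult_le_compat_l. apply Rdiv_le_0_compat. apply pow_le; lra. apply pow_lt; lra.
  rewrite <- exp_plus. apply exp_le.
  assert (0 <= 4 * (1 - p) ^ 2 / c0 + c0 * t ^ 2 / 16 - (1 - p) * t).
  { replace (4 * (1 - p) ^ 2 / c0 + c0 * t ^ 2 / 16 - (1 - p) * t) with
      ((2 * (1 - p) - c0 * t / 4) ^ 2 / c0) by (field; lra).
    apply Rdiv_le_0_compat; auto. apply pow2_ge_0. }
  assert (c / 4 * t <= c / 4 * sinh t) by (apply Rmult_le_compat_l; lra).
  assert (c0 / 4 * (t ^ 2 / 4) <= c / 4 * sinh t).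
  { apply Rmult_le_compat; try lra. assert (0 <= t ^ 2) by apply pow2_ge_0. lra. }
  lra.
Qed.

Lemma moment_dominated (k : nat) (p c : R) : 0 < c -> dominated (moment_fun k p c).
Proof.
  intros Hc. split. apply moment_continuous.
  destruct (moment_fun_bound k p c Hc) as [K [HK H]].
  exists (K / c ^ k), (c / 4 + 1). split; [lra | ]. intros u Hu.
  destruct (H c u (Rle_refl c) Hu). rewrite Rabs_pos_eq; auto.
Qed.

Lemma moment_bound (k : nat) (p c0 : R) : 0 < c0 ->
  exists K, 0 < K /\ forall c, c0 <= c -> Rabs (moment k p c) <= K / c ^ S k.
Proof.
  intros Hc0. destruct (moment_fun_bound k p c0 Hc0) as [K [HK H]].
  exists (4 * K). split. lra. intros c Hc.
  apply Rle_trans with (K / c ^ k / (c / 4 + 1)).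
  - apply integral_inf_bound. apply moment_continuous.
    split. lra. intros u Hu. destruct (H c u Hc Hu). rewrite Rabs_pos_eq; auto.
  - assert (0 < c ^ k) by (apply pow_lt; lra).
    replace (4 * K / c ^ S k) with (K / c ^ k / (c / 4)) by (simpl; field; lra).
    unfold Rdiv at 1 3. apply Rmult_le_compat_l. apply Rdiv_le_0_compat; lra.
    apply Rinv_le_contravar; lra.
Qed.

Lemma is_derive_moment (k : nat) (p c : R) : 0 < c ->
  is_derive (moment k p) c (- moment (S k) p c).
Proof.
  intros Hc.
  replace (- moment (S k) p c) with (integral_inf (fun t => (-1) * moment_fun (S k) p c t)).
  2:{ rewrite integral_inf_scal. unfold moment; ring. apply moment_dominated; auto. }
  destruct (moment_fun_bound (S (S k)) p (c / 2) ltac:(lra)) as [K [HK H]].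
  apply (is_derive_integral_inf (moment_fun k p) (fun c t => (-1) * moment_fun (S k) p c t)
    (fun c => moment_fun (S (S k)) p c) c (c / 2) (K / (c / 2) ^ S (S k)) 1).
  - lra.
  - intros x Hx. apply moment_dominated. apply Rabs_lt_between in Hx. lra.
  - apply dominated_scal, moment_dominated; auto.
  - intros x u _. unfold moment_fun. auto_derive; auto. simpl; unfold Rminus; ring.
  - intros x u _. unfold moment_fun. auto_derive; auto. simpl; unfold Rminus; ring.
  - intros x Hx. apply Rabs_lt_between in Hx. split. lra. intros u Hu.
    destruct (H x u ltac:(lra) Hu) as [H1 H2]. rewrite Rabs_pos_eq by auto.
    eapply Rle_trans; [apply H2 | ].
    assert (0 < (c / 2) ^ S (S k)) by (apply pow_lt; lra).
    assert ((c / 2) ^ S (S k) <= x ^ S (S k)) by (apply pow_incr; lra).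
    apply Rmult_le_compat.
    + apply Rdiv_le_0_compat; lra.
    + left; apply exp_pos.
    + apply Rmult_le_compat_l. lra. apply Rinv_le_contravar; lra.
    + apply exp_le. nra.
Qed.

Lemma moment_fun_shift (k : nat) (p c t : R) :
  moment_fun (S k) p c t = (1 / 2) * moment_fun k (p - 1) c t + (- (1 / 2)) * moment_fun k (p + 1) c t.
Proof.
  unfold moment_fun.
  replace (- ((p - 1) * t) - c * sinh t) with (t + (- (p * t) - c * sinh t)) by ring.
  replace (- ((p + 1) * t) - c * sinh t) with (- t + (- (p * t) - c * sinh t)) by ring.
  rewrite !exp_plus. simpl pow. generalize (exp (- (p * t) - c * sinh t)). intros e.
  unfold sinh at 1. field.
Qed.

Lemma moment_shift (k : nat) (p c : R) : 0 < c ->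
  moment (S k) p c = (moment k (p - 1) c - moment k (p + 1) c) / 2.
Proof.
  intros Hc. unfold moment at 1.
  rewrite (integral_inf_ext _ (fun t => (1 / 2) * moment_fun k (p - 1) c t
    + (- (1 / 2)) * moment_fun k (p + 1) c t)) by (intros; apply moment_fun_shift).
  rewrite integral_inf_lin; try apply moment_dominated; auto. unfold moment. field.
Qed.

(** The derivative of [exp (- (p * t) - c * sinh t)] has total integral [-1], and its factor
    [cosh t] averages the orders [p - 1] and [p + 1]. *)
Lemma expint_recurrence (p c : R) : 0 < c ->
  p * expint p c = 1 - c / 2 * (expint (p - 1) c + expint (p + 1) c).
Proof.
  intros Hc.
  destruct (moment_fun_bound 0 p c Hc) as [K [HK H]].
  assert (E : integral_inf (fun t => p * moment_fun 0 p c t +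
     c / 2 * (1 * moment_fun 0 (p - 1) c t + 1 * moment_fun 0 (p + 1) c t)) = - - moment_fun 0 p c 0).
  { apply integral_inf_derive with (f := fun t => - moment_fun 0 p c t) (C := K / c ^ 0) (k := c / 4 + 1).
    - intros t. unfold moment_fun.
      replace (- ((p - 1) * t) - c * sinh t) with (t + (- (p * t) - c * sinh t)) by ring.
      replace (- ((p + 1) * t) - c * sinh t) with (- t + (- (p * t) - c * sinh t)) by ring.
      rewrite !exp_plus.
      auto_derive; auto.
      unfold cosh, Rminus. simpl. field.
    - apply (dominated_lin p (c / 2) (moment_fun 0 p c)). apply moment_dominated; auto.
      apply dominated_lin; apply moment_dominated; auto.
    - split. lra. intros u Hu. destruct (H c u (Rle_refl c) Hu).
      rewrite Rabs_Ropp, Rabs_pos_eq; auto. }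
  rewrite (integral_inf_lin p (c / 2) (moment_fun 0 p c)
    (fun t => 1 * moment_fun 0 (p - 1) c t + 1 * moment_fun 0 (p + 1) c t)) in E.
  rewrite integral_inf_lin in E; try apply moment_dominated; auto.
  - unfold moment. unfold moment_fun at 4 in E. rewrite Rmult_0_r, sinh_0 in E.
    replace (- 0 - c * 0) with 0 in E by ring. rewrite exp_0 in E. simpl in E.
    lra.
  - apply moment_dominated; auto.
  - apply dominated_lin; apply moment_dominated; auto.
Qed.

Lemma expint_pos (p c : R) : 0 < c -> 0 < expint p c.
Proof.
  intros Hc. apply integral_inf_pos. apply moment_dominated; auto.
  intros u _. unfold moment_fun. simpl. rewrite Rmult_1_l. apply exp_pos.
Qed.

Lemma expint_antitone (p q c : R) : 0 < c -> p <= q -> expint q c <= expint p c.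
Proof.
  intros Hc Hpq. apply integral_inf_le; try apply moment_dominated; auto.
  intros u Hu. unfold moment_fun. simpl. rewrite !Rmult_1_l. apply exp_le. nra.
Qed.

(** Eliminating [expint (p + 2) c] between [expint_recurrence] and [moment_shift], both at order
    [p + 1], leaves two terms that [moment_bound] makes [O(1 / c)]. *)
Lemma expint_near_inv (p : R) : exists K, 0 < K /\
  forall c, 1 <= c -> Rabs (c * expint p c - 1) <= K / c.
Proof.
  destruct (moment_bound 0 (p + 1) 1 Rlt_0_1) as [K0 [HK0 H0]].
  destruct (moment_bound 1 (p + 1) 1 Rlt_0_1) as [K1 [HK1 H1]].
  exists (Rabs (p + 1) * K0 + K1). split. pose proof (Rabs_pos (p + 1)). nra.
  intros c Hc. specialize (H0 c Hc). specialize (H1 c Hc).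
  pose proof (expint_recurrence (p + 1) c ltac:(lra)) as E.
  pose proof (moment_shift 0 (p + 1) c ltac:(lra)) as E1.
  replace (p + 1 - 1) with p in * by ring.
  replace (c * expint p c - 1) with (- ((p + 1) * expint (p + 1) c) + c * moment 1 (p + 1) c)
    by (rewrite E1; lra).
  eapply Rle_trans; [apply Rabs_triang | ].
  rewrite Rabs_Ropp, !Rabs_mult, (Rabs_pos_eq c) by lra.
  replace ((Rabs (p + 1) * K0 + K1) / c) with (Rabs (p + 1) * (K0 / c ^ 1) + c * (K1 / c ^ 2))
    by (field; lra).
  apply Rplus_le_compat; apply Rmult_le_compat_l; auto; try lra. apply Rabs_pos.
Qed.

Lemma expint_upper (p c : R) : 0 < c -> 0 <= p -> c * expint p c <= 1.
Proof.
  intros Hc Hp.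
  (* integrate [exp (- p t) <= cosh t] against [exp (- c sinh t)] *)
  assert (F : expint p c <= (expint (-1) c + expint 1 c) / 2).
  { replace ((expint (-1) c + expint 1 c) / 2) with
      (integral_inf (fun t => 1 / 2 * moment_fun 0 (-1) c t + 1 / 2 * moment_fun 0 1 c t)).
    2:{ rewrite integral_inf_lin; try apply moment_dominated; auto. unfold moment; field. }
    apply integral_inf_le. apply moment_dominated; auto.
    apply dominated_lin; apply moment_dominated; auto.
    intros t Ht. unfold moment_fun. simpl. rewrite !Rmult_1_l.
    replace (- (-1 * t) - c * sinh t) with (t + - (c * sinh t)) by ring.
    replace (- t - c * sinh t) with (- t + - (c * sinh t)) by ring.
    replace (- (p * t) - c * sinh t) with (- (p * t) + - (c * sinh t)) by ring.
    rewrite !exp_plus. pose proof (exp_pos (- (c * sinh t))).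
    pose proof (cosh_ge_1 t) as Hch. unfold cosh in Hch.
    pose proof (exp_neg_le_1 (p * t) ltac:(apply Rmult_le_pos; auto)) as Hpt.
    replace (1 / 2 * (exp t * exp (- (c * sinh t))) + 1 / 2 * (exp (- t) * exp (- (c * sinh t))))
      with ((exp t + exp (- t)) / 2 * exp (- (c * sinh t))) by field.
    apply Rmult_le_compat_r; lra. }
  pose proof (expint_recurrence 0 c Hc) as E0.
  replace (0 - 1) with (-1) in E0 by ring. replace (0 + 1) with 1 in E0 by ring.
  apply Rmult_le_compat_l with (r := c) in F; lra.
Qed.

Lemma expint_le_inv (p c : R) : 0 < p -> 0 < c -> expint p c <= / p.
Proof.
  intros Hp Hc. replace (/ p) with (1 / p) by (unfold Rdiv; ring).
  rewrite <- integral_inf_exp by auto.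
  apply integral_inf_le. apply moment_dominated; auto. apply dominated_exp; auto.
  intros t Ht. unfold moment_fun. simpl. apply Rmult_le_compat_l. lra. apply exp_le.
  pose proof (sinh_ge t Ht). nra.
Qed.

(** * The double integrals of Dixon and Ferrar *)

Lemma cosh_neg (t : R) : cosh (- t) = cosh t.
Proof. unfold cosh. rewrite Ropp_involutive. field. Qed.

Lemma cosh_minus (x y : R) : cosh (x - y) = cosh x * cosh y - sinh x * sinh y.
Proof.
  unfold cosh, sinh. replace (- (x - y)) with (- x + - - y) by ring. unfold Rminus at 1.
  rewrite !exp_plus, !Ropp_involutive. field.
Qed.

Lemma Rabs_sinh_le_cosh (t : R) : Rabs (sinh t) <= cosh t.
Proof.
  unfold sinh, cosh. pose proof (exp_pos t). pose proof (exp_pos (- t)). apply Rabs_le. lra.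
Qed.

Lemma cosh_ratio_bound (eta u : R) : 0 <= eta -> 0 <= u ->
  cosh (eta * u) / cosh u <= 2 * exp (- ((1 - eta) * u)).
Proof.
  intros He Hu. pose proof (cosh_ge_1 u).
  apply Rle_div_l. lra.
  apply Rle_trans with (exp (eta * u)).
  - unfold cosh. assert (exp (- (eta * u)) <= exp (eta * u)); [ | lra].
    apply exp_le. assert (0 <= eta * u) by (apply Rmult_le_pos; auto). lra.
  - unfold cosh.
    replace (eta * u) with (- ((1 - eta) * u) + u) by ring. rewrite exp_plus.
    pose proof (exp_pos (- ((1 - eta) * u))). pose proof (exp_pos (- u)). pose proof (exp_pos u).
    nra.
Qed.

Definition outer (w : R -> R) (k : nat) (p r u : R) : R := w u * moment k p (2 * r * cosh u).

(** At [c = 2 * r * cosh u] the inner integral is [O(cosh u ^ - (k + 1))], so a weight as large as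
    [cosh (eta * u) * cosh u ^ k] still leaves the decay [exp (- ((1 - eta) * u))]. *)
Lemma outer_decay (w : R -> R) (k : nat) (p eta r0 : R) : 0 < r0 -> 0 <= eta < 1 ->
  (forall u, 0 <= u -> Rabs (w u) <= cosh (eta * u) * cosh u ^ k) ->
  exists K, 0 < K /\ forall r, r0 <= r -> exp_decay (outer w k p r) K (1 - eta).
Proof.
  intros Hr0 He Hw.
  destruct (moment_bound k p (2 * r0) ltac:(lra)) as [K [HK H]].
  assert (Hp : 0 < (2 * r0) ^ S k) by (apply pow_lt; lra).
  exists (2 * (K / (2 * r0) ^ S k)). split.
  apply Rmult_lt_0_compat. lra. apply Rdiv_lt_0_compat; auto.
  intros r Hr. split. lra. intros u Hu. pose proof (cosh_ge_1 u) as Hc. unfold outer.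
  assert (H2 : 2 * r0 <= 2 * r * cosh u) by nra.
  specialize (H _ H2). specialize (Hw u Hu).
  rewrite Rabs_mult.
  apply Rle_trans with (cosh (eta * u) * cosh u ^ k * (K / (2 * r * cosh u) ^ S k)).
  apply Rmult_le_compat; auto using Rabs_pos.
  apply Rle_trans with (cosh (eta * u) / cosh u * (K / (2 * r0) ^ S k)).
  - rewrite Rpow_mult_distr.
    assert (0 < (2 * r) ^ S k) by (apply pow_lt; lra).
    assert (0 < cosh u ^ k) by (apply pow_lt; lra).
    replace (cosh (eta * u) * cosh u ^ k * (K / ((2 * r) ^ S k * cosh u ^ S k))) with
      (cosh (eta * u) / cosh u * (K / (2 * r) ^ S k)).
    2:{ rewrite <- (tech_pow_Rmult (cosh u)). field. lra. }
    pose proof (cosh_ge_1 (eta * u)).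
    apply Rmult_le_compat_l. apply Rdiv_le_0_compat; lra.
    apply Rmult_le_compat_l. lra. apply Rinv_le_contravar; auto.
    apply pow_incr; lra.
  - replace (2 * (K / (2 * r0) ^ S k) * exp (- ((1 - eta) * u))) with
      (2 * exp (- ((1 - eta) * u)) * (K / (2 * r0) ^ S k)) by ring.
    apply Rmult_le_compat_r. apply Rdiv_le_0_compat; lra.
    apply cosh_ratio_bound; lra.
Qed.

Lemma outer_continuous (w : R -> R) (k : nat) (p r u : R) : 0 < r ->
  continuous w u -> continuous (outer w k p r) u.
Proof.
  intros Hr Hw. apply (continuous_mult w); auto.
  apply (continuous_comp (fun u => 2 * r * cosh u) (moment k p)).
  - apply (ex_derive_continuous (fun u => 2 * r * cosh u)). unfold cosh. auto_derive; auto.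
  - apply (ex_derive_continuous (moment k p)). eexists. apply is_derive_moment.
    pose proof (cosh_ge_1 u). nra.
Qed.

Lemma outer_dominated (w : R -> R) (k : nat) (p eta r : R) : 0 < r -> 0 <= eta < 1 ->
  (forall u, continuous w u) ->
  (forall u, 0 <= u -> Rabs (w u) <= cosh (eta * u) * cosh u ^ k) ->
  dominated (outer w k p r).
Proof.
  intros Hr He Hc Hw. split. intros; apply outer_continuous; auto.
  destruct (outer_decay w k p eta r Hr He Hw) as [K [_ H]].
  exists K, (1 - eta). apply H; lra.
Qed.

Definition cosh_w (eta : R) (k : nat) (u : R) : R := cosh (eta * u) * cosh u ^ k.
Definition sinh_w (eta u : R) : R := sinh (eta * u) * sinh u.

Lemma cosh_w_continuous eta k u : continuous (cosh_w eta k) u.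
Proof. apply (ex_derive_continuous (cosh_w eta k)). unfold cosh_w, cosh. auto_derive; auto. Qed.

Lemma sinh_w_continuous eta u : continuous (sinh_w eta) u.
Proof. apply (ex_derive_continuous (sinh_w eta)). unfold sinh_w, sinh. auto_derive; auto. Qed.

Lemma cosh_w_bound eta k u : Rabs (cosh_w eta k u) <= cosh (eta * u) * cosh u ^ k.
Proof.
  unfold cosh_w. pose proof (cosh_ge_1 (eta * u)). pose proof (cosh_ge_1 u).
  rewrite Rabs_pos_eq. lra. apply Rmult_le_pos. lra. apply pow_le; lra.
Qed.

Lemma sinh_w_bound eta u : Rabs (sinh_w eta u) <= cosh (eta * u) * cosh u ^ 1.
Proof.
  unfold sinh_w. rewrite pow_1, Rabs_mult.
  apply Rmult_le_compat; auto using Rabs_pos, Rabs_sinh_le_cosh.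
Qed.

Lemma cosh_w_dominated eta k p r : 0 < r -> 0 <= eta < 1 -> dominated (outer (cosh_w eta k) k p r).
Proof.
  intros. apply outer_dominated with eta; auto using cosh_w_continuous.
  intros; apply cosh_w_bound.
Qed.

Lemma sinh_w_dominated eta p r : 0 < r -> 0 <= eta < 1 -> dominated (outer (sinh_w eta) 1 p r).
Proof.
  intros. apply outer_dominated with eta; auto using sinh_w_continuous.
  intros; apply sinh_w_bound.
Qed.

(* With [K_eta] the modified Bessel function, [kint eta p r] is
   [int_0^oo K_eta (2 r sinh t) exp (- p t) dt]; the order of integration is
   exchanged so that the inner integral has no singularity. *)
Definition kint (eta p r : R) : R := integral_inf (outer (cosh_w eta 0) 0 p r).

Lemma is_derive_kint (eta p r : R) : 0 < r -> 0 <= eta < 1 ->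
  is_derive (kint eta p) r (-2 * integral_inf (outer (cosh_w eta 1) 1 p r)).
Proof.
  intros Hr He.
  rewrite <- integral_inf_scal by (apply cosh_w_dominated; auto).
  destruct (outer_decay (cosh_w eta 2) 2 p eta (r / 2) ltac:(lra) He
    (fun u _ => cosh_w_bound eta 2 u)) as [K [HK H]].
  apply (is_derive_integral_inf (outer (cosh_w eta 0) 0 p)
    (fun r u => -2 * outer (cosh_w eta 1) 1 p r u)
    (fun r u => 4 * outer (cosh_w eta 2) 2 p r u) r (r / 2) (4 * K) (1 - eta)).
  - lra.
  - intros x Hx. apply Rabs_lt_between in Hx. apply cosh_w_dominated; lra.
  - apply dominated_scal, cosh_w_dominated; auto.
  - intros x u Hx. apply Rabs_lt_between in Hx. pose proof (cosh_ge_1 u).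
    unfold outer, cosh_w.
    assert (D : is_derive (moment 0 p) (2 * x * cosh u) (- moment 1 p (2 * x * cosh u)))
      by (apply is_derive_moment; nra).
    auto_derive. eexists; apply D.
    replace (Derive (fun x0 => moment 0 p x0) (2 * x * cosh u)) with (- moment 1 p (2 * x * cosh u))
      by (symmetry; apply is_derive_unique, D).
    simpl. ring.
  - intros x u Hx. apply Rabs_lt_between in Hx. pose proof (cosh_ge_1 u).
    unfold outer, cosh_w.
    assert (D : is_derive (moment 1 p) (2 * x * cosh u) (- moment 2 p (2 * x * cosh u)))
      by (apply is_derive_moment; nra).
    auto_derive. eexists; apply D.
    replace (Derive (fun x0 => moment 1 p x0) (2 * x * cosh u)) with (- moment 2 p (2 * x * cosh u))
      by (symmetry; apply is_derive_unique, D).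
    simpl. ring.
  - intros x Hx. apply Rabs_lt_between in Hx. destruct (H x ltac:(lra)) as [H1 H2].
    split; auto. intros u Hu. rewrite Rabs_mult, (Rabs_pos_eq 4) by lra.
    rewrite Rmult_assoc. apply Rmult_le_compat_l. lra. auto.
Qed.

(** Integrates the derivative of [sinh (eta * u) * expint p (2 * r * cosh u)] in [u]; this product
    vanishes at [0] and at [oo]. *)
Lemma kint_by_parts (eta p r : R) : 0 < r -> 0 <= eta < 1 ->
  eta * kint eta p r = 2 * r * integral_inf (outer (sinh_w eta) 1 p r).
Proof.
  intros Hr He.
  destruct (outer_decay (fun u => sinh (eta * u)) 0 p eta r Hr He) as [K [HK H]].
  { intros u _. simpl. rewrite Rmult_1_r. apply Rabs_sinh_le_cosh. }
  assert (E : integral_inf (fun u => eta * outer (cosh_w eta 0) 0 p r u +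
    (- (2 * r)) * outer (sinh_w eta) 1 p r u) = - outer (fun u => sinh (eta * u)) 0 p r 0).
  { apply integral_inf_derive with (C := K) (k := 1 - eta).
    - intros u. unfold outer, cosh_w, sinh_w. pose proof (cosh_ge_1 u).
      assert (D : is_derive (moment 0 p) (2 * r * cosh u) (- moment 1 p (2 * r * cosh u)))
        by (apply is_derive_moment; nra).
      auto_derive.
      { eexists; apply D. }
      replace (Derive (fun x0 => moment 0 p x0) (2 * r * cosh u)) with (- moment 1 p (2 * r * cosh u))
        by (symmetry; apply is_derive_unique, D).
      simpl. ring.
    - apply dominated_lin. apply cosh_w_dominated; auto. apply sinh_w_dominated; auto.
    - apply H; lra. }
  rewrite (integral_inf_lin eta (- (2 * r)) (outer (cosh_w eta 0) 0 p r) (outer (sinh_w eta) 1 p r)) in E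
    by (auto using cosh_w_dominated, sinh_w_dominated).
  unfold outer at 3 in E. rewrite Rmult_0_r, sinh_0 in E. unfold kint. lra.
Qed.

(** The pairing of [eta] with [1 - eta] comes from [cosh (eta u) cosh u - sinh (eta u) sinh u = cosh
    ((1 - eta) u)]. *)
Lemma outer_cosh_sinh (eta p r : R) : 0 < r -> 0 < eta < 1 ->
  integral_inf (outer (cosh_w eta 1) 1 p r) - integral_inf (outer (sinh_w eta) 1 p r) =
  (kint (1 - eta) (p - 1) r - kint (1 - eta) (p + 1) r) / 2.
Proof.
  intros Hr He.
  transitivity (integral_inf (fun u => 1 * outer (cosh_w eta 1) 1 p r u + (-1) * outer (sinh_w eta) 1 p r u)).
  { rewrite integral_inf_lin. ring. apply cosh_w_dominated; lra. apply sinh_w_dominated; lra. }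
  transitivity (integral_inf (fun u => 1 / 2 * outer (cosh_w (1 - eta) 0) 0 (p - 1) r u
    + (- (1 / 2)) * outer (cosh_w (1 - eta) 0) 0 (p + 1) r u)).
  2:{ rewrite integral_inf_lin; try (apply cosh_w_dominated; lra). unfold kint. field. }
  apply integral_inf_ext. intros u Hu. pose proof (cosh_ge_1 u).
  unfold outer. rewrite (moment_shift 0) by nra.
  unfold cosh_w, sinh_w. simpl.
  replace ((1 - eta) * u) with (- (eta * u - u)) by ring.
  rewrite cosh_neg, cosh_minus. field.
Qed.

(** The counterpart of [K_eta'(x) = - K_(1-eta)(x) - (eta / x) K_eta(x)]: the chain rule factor
    [2 sinh t] shifts [p] by one in either direction. *)
Lemma kint_derivative (eta p r : R) : 0 < r -> 0 < eta < 1 ->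
  is_derive (kint eta p) r
    (- (eta / r) * kint eta p r + (kint (1 - eta) (p + 1) r - kint (1 - eta) (p - 1) r)).
Proof.
  intros Hr He.
  replace (- (eta / r) * kint eta p r + (kint (1 - eta) (p + 1) r - kint (1 - eta) (p - 1) r))
    with (-2 * integral_inf (outer (cosh_w eta 1) 1 p r)).
  apply is_derive_kint; lra.
  pose proof (outer_cosh_sinh eta p r Hr He). pose proof (kint_by_parts eta p r Hr ltac:(lra)).
  replace (- (eta / r) * kint eta p r) with (- (eta * kint eta p r) / r) by (field; lra).
  rewrite H0. replace (- (2 * r * integral_inf (outer (sinh_w eta) 1 p r)) / r)
    with (- 2 * integral_inf (outer (sinh_w eta) 1 p r)) by (field; lra).
  lra.
Qed.

(** Integration by parts in the inner variable. The term [1] of [expint_recurrence] cannot be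
    integrated against [cosh (eta * u)] over the half-line; taking the difference of the instances
    at [q + 1] and [q - 1] removes it. *)
Lemma kint_recurrence (eta q r : R) : 0 < r -> 0 < eta < 1 ->
  (q + 1 - eta) * kint eta (q + 1) r - (q - 1 + eta) * kint eta (q - 1) r =
  r * (kint (1 - eta) (q - 2) r - kint (1 - eta) (q + 2) r).
Proof.
  intros Hr He.
  pose proof (outer_cosh_sinh eta (q + 1) r Hr He) as E1.
  pose proof (outer_cosh_sinh eta (q - 1) r Hr He) as E2.
  pose proof (kint_by_parts eta (q + 1) r Hr ltac:(lra)) as E3.
  pose proof (kint_by_parts eta (q - 1) r Hr ltac:(lra)) as E4.
  replace (q + 1 - 1) with q in E1 by ring. replace (q + 1 + 1) with (q + 2) in E1 by ring.
  replace (q - 1 - 1) with (q - 2) in E2 by ring. replace (q - 1 + 1) with q in E2 by ring.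
  assert (E : (q + 1) * kint eta (q + 1) r - (q - 1) * kint eta (q - 1) r =
    2 * r * (integral_inf (outer (cosh_w eta 1) 1 (q + 1) r) + integral_inf (outer (cosh_w eta 1) 1 (q - 1) r))).
  { transitivity (integral_inf (fun u => (q + 1) * outer (cosh_w eta 0) 0 (q + 1) r u
      + (- (q - 1)) * outer (cosh_w eta 0) 0 (q - 1) r u)).
    { rewrite integral_inf_lin; try (apply cosh_w_dominated; lra). unfold kint. ring. }
    transitivity (integral_inf (fun u => (2 * r) * outer (cosh_w eta 1) 1 (q + 1) r u
      + (2 * r) * outer (cosh_w eta 1) 1 (q - 1) r u)).
    2:{ rewrite integral_inf_lin; try (apply cosh_w_dominated; lra). ring. }
    apply integral_inf_ext. intros u Hu. pose proof (cosh_ge_1 u).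
    assert (Hc : 0 < 2 * r * cosh u) by nra.
    unfold outer. rewrite !(moment_shift 0) by auto.
    pose proof (expint_recurrence (q + 1) _ Hc) as F1.
    pose proof (expint_recurrence (q - 1) _ Hc) as F2.
    replace (q + 1 - 1) with q in * by ring. replace (q + 1 + 1) with (q + 2) in * by ring.
    replace (q - 1 - 1) with (q - 2) in * by ring. replace (q - 1 + 1) with q in * by ring.
    unfold cosh_w. simpl.
    transitivity (cosh (eta * u) * ((q + 1) * expint (q + 1) (2 * r * cosh u)
      - (q - 1) * expint (q - 1) (2 * r * cosh u))). ring.
    rewrite F1, F2. field. }
  assert (r * (kint (1 - eta) (q - 2) r - kint (1 - eta) (q + 2) r) =
    2 * r * ((kint (1 - eta) q r - kint (1 - eta) (q + 2) r) / 2 +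
      (kint (1 - eta) (q - 2) r - kint (1 - eta) q r) / 2)) by field.
  rewrite H, <- E1, <- E2. lra.
Qed.

Lemma kint_pos (eta p r : R) : 0 < r -> 0 < eta < 1 -> 0 < kint eta p r.
Proof.
  intros Hr He. apply integral_inf_pos. apply cosh_w_dominated; lra.
  intros u _. unfold outer, cosh_w. simpl. rewrite Rmult_1_r. pose proof (cosh_ge_1 u).
  apply Rmult_lt_0_compat. pose proof (cosh_ge_1 (eta * u)); lra. apply expint_pos. nra.
Qed.

Lemma kint_antitone (eta p q r : R) : 0 < r -> 0 < eta < 1 -> p <= q ->
  kint eta q r <= kint eta p r.
Proof.
  intros Hr He Hpq. apply integral_inf_le; try (apply cosh_w_dominated; lra).
  intros u _. unfold outer, cosh_w. simpl. rewrite Rmult_1_r. pose proof (cosh_ge_1 u).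
  apply Rmult_le_compat_l. pose proof (cosh_ge_1 (eta * u)); lra. apply expint_antitone; nra.
Qed.

(** The limit of [r * kint eta p r] at [oo] for every [p], because [c * expint p c] tends to [1].
    Its value is [PI / (4 cos (eta PI / 2))]. *)
Definition kint_lim (eta : R) : R := integral_inf (fun u => cosh (eta * u) / cosh u) / 2.

Lemma cosh_ratio_dominated (eta : R) : 0 < eta < 1 -> dominated (fun u => cosh (eta * u) / cosh u).
Proof.
  intros He. split.
  - intros u. pose proof (cosh_ge_1 u) as H.
    apply (ex_derive_continuous (fun u => cosh (eta * u) / cosh u)).
    unfold cosh in *. auto_derive. lra.
  - exists 2, (1 - eta). split. lra. intros u Hu.
    rewrite Rabs_pos_eq. apply cosh_ratio_bound; lra.
    apply Rdiv_le_0_compat. pose proof (cosh_ge_1 (eta * u)); lra. pose proof (cosh_ge_1 u); lra.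
Qed.

Lemma kint_lim_pos (eta : R) : 0 < eta < 1 -> 0 < kint_lim eta.
Proof.
  intros He. unfold kint_lim. apply Rdiv_lt_0_compat; [ | lra].
  apply integral_inf_pos. apply cosh_ratio_dominated; auto.
  intros u _. apply Rdiv_lt_0_compat. pose proof (cosh_ge_1 (eta * u)); lra. pose proof (cosh_ge_1 u); lra.
Qed.

Lemma kint_upper (eta p r : R) : 0 < r -> 0 < eta < 1 -> 0 <= p ->
  r * kint eta p r <= kint_lim eta.
Proof.
  intros Hr He Hp.
  assert (Hd : dominated (outer (cosh_w eta 0) 0 p r)) by (apply cosh_w_dominated; lra).
  assert (2 * (r * kint eta p r) <= integral_inf (fun u => cosh (eta * u) / cosh u)); [ | unfold kint_lim; lra].
  unfold kint. rewrite <- Rmult_assoc, <- integral_inf_scal by auto.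
  apply integral_inf_le; auto using dominated_scal, cosh_ratio_dominated.
  intros u _. pose proof (cosh_ge_1 u). pose proof (cosh_ge_1 (eta * u)).
  assert (Hc : 0 < 2 * r * cosh u) by nra.
  pose proof (expint_upper p _ Hc Hp). unfold outer, cosh_w. simpl.
  apply (Rle_div_r _ _ (cosh u)). lra.
  apply Rle_trans with (cosh (eta * u) * (2 * r * cosh u * expint p (2 * r * cosh u))).
  apply Req_le; ring. rewrite <- (Rmult_1_r (cosh (eta * u))) at 2. apply Rmult_le_compat_l; lra.
Qed.

Lemma kint_limit (eta p : R) : 0 < eta < 1 ->
  exists K, forall r, 1 <= r -> Rabs (r * kint eta p r - kint_lim eta) <= K / r.
Proof.
  intros He. destruct (expint_near_inv p) as [K [HK H]].
  exists (K / 4 * (2 / (1 - eta))). intros r Hr.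
  assert (Hd : dominated (outer (cosh_w eta 0) 0 p r)) by (apply cosh_w_dominated; lra).
  pose proof (cosh_ratio_dominated eta He) as Hd'.
  replace (r * kint eta p r - kint_lim eta) with
    (integral_inf (fun u => r * outer (cosh_w eta 0) 0 p r u + (- (1 / 2)) * (cosh (eta * u) / cosh u))).
  2:{ rewrite integral_inf_lin by auto. unfold kint, kint_lim. field. }
  replace (K / 4 * (2 / (1 - eta)) / r) with ((K / 4 / r * 2) / (1 - eta)) by (field; lra).
  apply integral_inf_bound. apply dominated_lin; auto.
  split. lra. intros u Hu. pose proof (cosh_ge_1 u) as Hu1. pose proof (cosh_ge_1 (eta * u)) as Hu2.
  specialize (H (2 * r * cosh u) ltac:(nra)).
  unfold outer, cosh_w.
  set (c := 2 * r * cosh u) in *.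
  replace (r * (cosh (eta * u) * cosh u ^ 0 * expint p c) + - (1 / 2) * (cosh (eta * u) / cosh u))
    with (cosh (eta * u) / cosh u * / 2 * (c * expint p c - 1)) by (unfold c; simpl; field; lra).
  assert (0 < cosh (eta * u) / cosh u) by (apply Rdiv_lt_0_compat; lra).
  rewrite Rabs_mult, Rabs_pos_eq by lra.
  replace (K / 4 / r * 2 * exp (- ((1 - eta) * u))) with
    (2 * exp (- ((1 - eta) * u)) * / 2 * (K / (2 * r))) by (field; lra).
  pose proof (cosh_ratio_bound eta u ltac:(lra) Hu).
  apply Rmult_le_compat; try lra. apply Rabs_pos.
  eapply Rle_trans; [apply H | ]. apply Rmult_le_compat_l. lra. apply Rinv_le_contravar.
  lra. unfold c. nra.
Qed.

(** * Bessel's equation as a system, and uniqueness *)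

Lemma le_of_derive_nonneg (f f' : R -> R) (a b : R) : a <= b ->
  (forall x, a <= x <= b -> is_derive f x (f' x)) ->
  (forall x, a <= x <= b -> 0 <= f' x) -> f a <= f b.
Proof.
  intros Hab D H. destruct (MVT_gen f a b f') as [c [Hc E]].
  - intros x Hx. rewrite Rmin_left, Rmax_right in Hx by lra. apply D; lra.
  - intros x Hx. rewrite Rmin_left, Rmax_right in Hx by lra.
    apply continuity_pt_filterlim, (ex_derive_continuous f). eexists; apply D; lra.
  - rewrite Rmin_left, Rmax_right in Hc by lra. specialize (H c Hc). nra.
Qed.

Lemma le_of_derive_nonpos (f f' : R -> R) (a b : R) : a <= b ->
  (forall x, a <= x <= b -> is_derive f x (f' x)) ->
  (forall x, a <= x <= b -> f' x <= 0) -> f b <= f a.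
Proof.
  intros Hab D H.
  assert (- f a <= - f b); [ | lra].
  apply (le_of_derive_nonneg (fun x => - f x) (fun x => - f' x)); auto.
  - intros x Hx. apply (is_derive_opp f). auto.
  - intros x Hx. specialize (H x Hx). lra.
Qed.

(* [y1, y2] are [sqrt r] times two solutions of Bessel's equation of consecutive orders
   [k - 1/2] and [k + 1/2]. *)
Definition bessel_pair (k : R) (y1 y2 : R -> R) : Prop := forall r, 0 < r ->
  is_derive y1 r (k / r * y1 r - y2 r) /\ is_derive y2 r (y1 r - k / r * y2 r).

Lemma bessel_pair_lin (k a b : R) (y1 y2 z1 z2 : R -> R) :
  bessel_pair k y1 y2 -> bessel_pair k z1 z2 ->
  bessel_pair k (fun r => a * y1 r + b * z1 r) (fun r => a * y2 r + b * z2 r).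
Proof.
  intros Hy Hz r Hr. destruct (Hy r Hr) as [Y1 Y2]. destruct (Hz r Hr) as [Z1 Z2].
  assert (L : forall (f g : R -> R) f' g', is_derive f r f' -> is_derive g r g' ->
    is_derive (fun r => a * f r + b * g r) r (a * f' + b * g')).
  { intros f g f' g' F G. apply (is_derive_plus (fun r => a * f r) (fun r => b * g r)).
    apply (is_derive_scal f); auto. apply (is_derive_scal g); auto. }
  split.
  - replace (k / r * (a * y1 r + b * z1 r) - (a * y2 r + b * z2 r)) with
      (a * (k / r * y1 r - y2 r) + b * (k / r * z1 r - z2 r)) by ring. apply L; auto.
  - replace (a * y1 r + b * z1 r - k / r * (a * y2 r + b * z2 r)) with
      (a * (y1 r - k / r * y2 r) + b * (z1 r - k / r * z2 r)) by ring. apply L; auto.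
Qed.

Lemma bessel_pair_norm_derive (k : R) (y1 y2 : R -> R) : bessel_pair k y1 y2 ->
  forall r, 0 < r -> is_derive (fun r => y1 r ^ 2 + y2 r ^ 2) r (2 * k / r * (y1 r ^ 2 - y2 r ^ 2)).
Proof.
  intros H r Hr. destruct (H r Hr) as [D1 D2].
  auto_derive. repeat split; eexists; eassumption.
  replace (Derive (fun x => y1 x) r) with (k / r * y1 r - y2 r)
    by (symmetry; apply is_derive_unique, D1).
  replace (Derive (fun x => y2 x) r) with (y1 r - k / r * y2 r)
    by (symmetry; apply is_derive_unique, D2).
  field; lra.
Qed.

Lemma is_derive_mult_R (f g : R -> R) (r f' g' : R) :
  is_derive f r f' -> is_derive g r g' ->
  is_derive (fun x => f x * g x) r (f' * g r + f r * g').
Proof.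
  intros F G. apply (is_derive_mult f g r f' g'); auto.
  intros; apply Rmult_comm.
Qed.

(** Gronwall's argument: the norm [N] satisfies [|N'| <= 2 |k| / r * N], so [N * r^(2 |k|)]
    increases and [N * r^(-2 |k|)] decreases. The first carries the zero at [r0] to the left, the
    second to the right. *)
Lemma bessel_pair_zero (k r0 : R) (y1 y2 : R -> R) : bessel_pair k y1 y2 -> 0 < r0 ->
  y1 r0 = 0 -> y2 r0 = 0 -> forall r, 0 < r -> y1 r = 0 /\ y2 r = 0.
Proof.
  intros H Hr0 E1 E2 r Hr.
  set (N := fun r => y1 r ^ 2 + y2 r ^ 2).
  assert (N0 : N r0 = 0) by (unfold N; rewrite E1, E2; ring).
  assert (NN : N r <= 0 -> y1 r = 0 /\ y2 r = 0).
  { unfold N. intros HN. pose proof (pow2_ge_0 (y1 r)). pose proof (pow2_ge_0 (y2 r)).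
    split; apply Rsqr_0_uniq; unfold Rsqr; nra. }
  assert (DE : forall c x, 0 < x -> is_derive (fun r => N r * exp (c * ln r)) x
    ((2 * k / x * (y1 x ^ 2 - y2 x ^ 2)) * exp (c * ln x) + N x * (c / x * exp (c * ln x)))).
  { intros c x Hx. apply (is_derive_mult_R N (fun r => exp (c * ln r))).
    apply (bessel_pair_norm_derive k y1 y2); auto.
    auto_derive; auto. field; lra. }
  assert (Hk : forall x, 0 < x -> Rabs (2 * k / x * (y1 x ^ 2 - y2 x ^ 2)) <= 2 * Rabs k / x * N x).
  { intros x Hx. unfold Rdiv. rewrite !Rabs_mult, (Rabs_pos_eq 2), (Rabs_pos_eq (/ x)).
    apply Rmult_le_compat_l.
    apply Rmult_le_pos. pose proof (Rabs_pos k); lra. left; apply Rinv_0_lt_compat; auto.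
    unfold N. pose proof (pow2_ge_0 (y1 x)). pose proof (pow2_ge_0 (y2 x)). apply Rabs_le; lra.
    left; apply Rinv_0_lt_compat; auto. lra. }
  apply NN.
  destruct (Rle_dec r r0) as [Hle | Hle].
  - assert (N r * exp (2 * Rabs k * ln r) <= N r0 * exp (2 * Rabs k * ln r0)).
    { apply (le_of_derive_nonneg (fun r => N r * exp (2 * Rabs k * ln r))
        (fun x => (2 * k / x * (y1 x ^ 2 - y2 x ^ 2)) * exp (2 * Rabs k * ln x)
          + N x * (2 * Rabs k / x * exp (2 * Rabs k * ln x)))); auto.
      intros x Hx; apply DE; lra.
      intros x Hx. specialize (Hk x ltac:(lra)). apply Rabs_le_between in Hk.
      pose proof (exp_pos (2 * Rabs k * ln x)).
      rewrite <- Rmult_assoc, <- Rmult_plus_distr_r. apply Rmult_le_pos; lra. }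
    rewrite N0, Rmult_0_l in H0. pose proof (exp_pos (2 * Rabs k * ln r)). nra.
  - assert (N r * exp (- (2 * Rabs k) * ln r) <= N r0 * exp (- (2 * Rabs k) * ln r0)).
    { apply (le_of_derive_nonpos (fun r => N r * exp (- (2 * Rabs k) * ln r))
        (fun x => (2 * k / x * (y1 x ^ 2 - y2 x ^ 2)) * exp (- (2 * Rabs k) * ln x)
          + N x * (- (2 * Rabs k) / x * exp (- (2 * Rabs k) * ln x)))). lra.
      intros x Hx; apply DE; lra.
      intros x Hx. specialize (Hk x ltac:(lra)). apply Rabs_le_between in Hk.
      pose proof (exp_pos (- (2 * Rabs k) * ln x)).
      rewrite <- Rmult_assoc, <- Rmult_plus_distr_r.
      replace (N x * (- (2 * Rabs k) / x)) with (- (2 * Rabs k / x * N x)) by (field; lra).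
      assert (0 <= (2 * Rabs k / x * N x - 2 * k / x * (y1 x ^ 2 - y2 x ^ 2)) * exp (- (2 * Rabs k) * ln x))
        by (apply Rmult_le_pos; lra). lra. }
    rewrite N0, Rmult_0_l in H0. pose proof (exp_pos (- (2 * Rabs k) * ln r)). nra.
Qed.

(** The derivative of the squared norm is only [O(1 / r)] relative to it, which is not integrable at
    [oo]. Since [(y1 y2)' = y1^2 - y2^2], the cross term cancels it and leaves a relative derivative
    [O(1 / r^2)]. *)
Definition pair_energy (k : R) (y1 y2 : R -> R) (r : R) : R :=
  y1 r ^ 2 + y2 r ^ 2 - 2 * k / r * (y1 r * y2 r).

Lemma pair_energy_bounds (k r : R) (y1 y2 : R -> R) : 2 * Rabs k + 1 <= r ->
  let N := y1 r ^ 2 + y2 r ^ 2 in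
  N / 2 <= pair_energy k y1 y2 r <= 2 * N /\
  Rabs (2 * k / r ^ 2 * (y1 r * y2 r)) <= 2 * Rabs k / r ^ 2 * pair_energy k y1 y2 r.
Proof.
  intros Hr N. pose proof (Rabs_pos k) as Hk.
  assert (HN : Rabs (2 * (y1 r * y2 r)) <= N).
  { unfold N. pose proof (pow2_ge_0 (y1 r - y2 r)). pose proof (pow2_ge_0 (y1 r + y2 r)).
    apply Rabs_le. nra. }
  assert (N0 : 0 <= N) by (pose proof (Rabs_pos (2 * (y1 r * y2 r))); lra).
  assert (H1 : Rabs (2 * k / r * (y1 r * y2 r)) <= N / 2).
  { replace (2 * k / r * (y1 r * y2 r)) with (k * / r * (2 * (y1 r * y2 r))) by (field; lra).
    rewrite (Rabs_mult (k * / r)), (Rabs_mult k), Rabs_inv, (Rabs_pos_eq r) by lra.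
    apply Rle_trans with (/ 2 * N); [ | lra].
    apply Rmult_le_compat; auto using Rabs_pos.
    apply Rmult_le_pos; auto. left; apply Rinv_0_lt_compat; lra.
    apply Rmult_le_reg_r with r. lra. rewrite Rmult_assoc, Rinv_l by lra. lra. }
  assert (H2 : N / 2 <= pair_energy k y1 y2 r <= 2 * N).
  { unfold pair_energy. fold N. apply Rabs_le_between in H1. lra. }
  split; auto.
  replace (2 * k / r ^ 2 * (y1 r * y2 r)) with (k * / r ^ 2 * (2 * (y1 r * y2 r))) by (field; lra).
  assert (0 < / r ^ 2) by (apply Rinv_0_lt_compat, pow_lt; lra).
  rewrite (Rabs_mult (k * / r ^ 2)), (Rabs_mult k), (Rabs_pos_eq (/ r ^ 2)) by lra.
  apply Rle_trans with (Rabs k * / r ^ 2 * N).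
  apply Rmult_le_compat_l; auto. apply Rmult_le_pos; lra.
  replace (2 * Rabs k / r ^ 2 * pair_energy k y1 y2 r) with
    (Rabs k * / r ^ 2 * (2 * pair_energy k y1 y2 r)) by (field; lra).
  apply Rmult_le_compat_l. apply Rmult_le_pos; lra. lra.
Qed.

Lemma pair_energy_derive (k r : R) (y1 y2 : R -> R) : bessel_pair k y1 y2 -> 0 < r ->
  is_derive (pair_energy k y1 y2) r (2 * k / r ^ 2 * (y1 r * y2 r)).
Proof.
  intros H Hr. destruct (H r Hr) as [D1 D2]. unfold pair_energy.
  auto_derive. repeat split; try (eexists; eassumption). lra.
  replace (Derive (fun x => y1 x) r) with (k / r * y1 r - y2 r)
    by (symmetry; apply is_derive_unique, D1).
  replace (Derive (fun x => y2 x) r) with (y1 r - k / r * y2 r)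
    by (symmetry; apply is_derive_unique, D2).
  field; lra.
Qed.

Lemma pair_energy_exp_derive (k c r : R) (y1 y2 : R -> R) : bessel_pair k y1 y2 -> 0 < r ->
  is_derive (fun r => pair_energy k y1 y2 r * exp (c / r)) r
    ((2 * k / r ^ 2 * (y1 r * y2 r) - c / r ^ 2 * pair_energy k y1 y2 r) * exp (c / r)).
Proof.
  intros H Hr.
  replace ((2 * k / r ^ 2 * (y1 r * y2 r) - c / r ^ 2 * pair_energy k y1 y2 r) * exp (c / r))
   with ((2 * k / r ^ 2 * (y1 r * y2 r)) * exp (c / r) +
     pair_energy k y1 y2 r * (- (c / r ^ 2) * exp (c / r))) by ring.
  apply (is_derive_mult_R (pair_energy k y1 y2) (fun r => exp (c / r))). apply pair_energy_derive; auto.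
  auto_derive. lra. unfold Rdiv; field; lra.
Qed.

(** From [2 |k| + 1] on, the energy is comparable with the squared norm, and its product with
    [exp (2 |k| / r)] decreases. *)
Lemma bessel_pair_bounded (k : R) (y1 y2 : R -> R) : bessel_pair k y1 y2 ->
  exists B, forall r, 2 * Rabs k + 1 <= r -> y1 r ^ 2 + y2 r ^ 2 <= B.
Proof.
  intros H. pose proof (Rabs_pos k) as Hk. set (R0 := 2 * Rabs k + 1).
  exists (2 * (pair_energy k y1 y2 R0 * exp (2 * Rabs k / R0))). intros r Hr.
  assert (pair_energy k y1 y2 r * exp (2 * Rabs k / r) <= pair_energy k y1 y2 R0 * exp (2 * Rabs k / R0)).
  { apply (le_of_derive_nonpos (fun r => pair_energy k y1 y2 r * exp (2 * Rabs k / r))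
      (fun r => (2 * k / r ^ 2 * (y1 r * y2 r) - 2 * Rabs k / r ^ 2 * pair_energy k y1 y2 r)
         * exp (2 * Rabs k / r))). auto.
    - intros x Hx. unfold R0 in Hx. apply pair_energy_exp_derive; auto. lra.
    - intros x [Hx _]. destruct (pair_energy_bounds k x y1 y2 Hx) as [_ Hb].
      apply Rabs_le_between in Hb. pose proof (exp_pos (2 * Rabs k / x)). nra. }
  destruct (pair_energy_bounds k r y1 y2 Hr) as [Hb _].
  assert (1 <= exp (2 * Rabs k / r)).
  { rewrite <- exp_0. apply exp_le. apply Rdiv_le_0_compat; unfold R0 in *; lra. }
  pose proof (pow2_ge_0 (y1 r)). pose proof (pow2_ge_0 (y2 r)). nra.
Qed.

(** With the opposite factor [exp (- 2 |k| / r)] the energy increases. If the norm tends to [0] at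
    [oo], the energy at [R0] is therefore nonpositive, so the pair vanishes at [R0] and hence
    everywhere. *)
Lemma bessel_pair_zero_inf (k K R1 : R) (y1 y2 : R -> R) : bessel_pair k y1 y2 ->
  (forall r, R1 <= r -> y1 r ^ 2 + y2 r ^ 2 <= K / r) ->
  forall r, 0 < r -> y1 r = 0 /\ y2 r = 0.
Proof.
  intros H HK. pose proof (Rabs_pos k) as Hk. set (R0 := 2 * Rabs k + 1).
  assert (HR0 : 0 < R0) by (unfold R0; lra).
  assert (Hle : pair_energy k y1 y2 R0 <= 0).
  { assert (Hx : forall x, R0 <= x -> R1 <= x ->
      pair_energy k y1 y2 R0 * exp (- (2 * Rabs k) / R0) <= 2 * Rabs K / x).
    { intros x Hx Hx1.
      apply Rle_trans with (pair_energy k y1 y2 x * exp (- (2 * Rabs k) / x)).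
      - apply (le_of_derive_nonneg (fun r => pair_energy k y1 y2 r * exp (- (2 * Rabs k) / r))
          (fun r => (2 * k / r ^ 2 * (y1 r * y2 r) - - (2 * Rabs k) / r ^ 2 * pair_energy k y1 y2 r)
             * exp (- (2 * Rabs k) / r))). auto.
        + intros z Hz. apply pair_energy_exp_derive; auto. lra.
        + intros z [Hz _]. destruct (pair_energy_bounds k z y1 y2 Hz) as [_ Hb].
          apply Rabs_le_between in Hb. pose proof (exp_pos (- (2 * Rabs k) / z)).
          apply Rmult_le_pos; [ | lra].
          replace (- (2 * Rabs k) / z ^ 2) with (- (2 * Rabs k / z ^ 2)) by (field; lra). lra.
      - destruct (pair_energy_bounds k x y1 y2 Hx) as [Hb _]. specialize (HK x Hx1).
        assert (K / x <= Rabs K / x).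
        { apply Rmult_le_compat_r. left; apply Rinv_0_lt_compat; lra. apply Rle_abs. }
        assert (exp (- (2 * Rabs k) / x) <= 1).
        { replace (- (2 * Rabs k) / x) with (- (2 * Rabs k / x)) by (field; lra).
          apply exp_neg_le_1. apply Rdiv_le_0_compat; lra. }
        pose proof (exp_pos (- (2 * Rabs k) / x)).
        pose proof (pow2_ge_0 (y1 x)). pose proof (pow2_ge_0 (y2 x)).
        replace (2 * Rabs K / x) with (2 * (Rabs K / x)) by (field; lra). nra. }
    destruct (Rle_lt_dec (pair_energy k y1 y2 R0) 0) as [ | Hpos]; auto. exfalso.
    set (P := pair_energy k y1 y2 R0 * exp (- (2 * Rabs k) / R0)) in *.
    assert (HP : 0 < P) by (apply Rmult_lt_0_compat; auto; apply exp_pos).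
    pose proof (Rabs_pos K) as HKp. pose proof (Rabs_pos R1) as HR1. pose proof (Rle_abs R1).
    assert (Hq : 0 <= 2 * Rabs K / P) by (apply Rdiv_le_0_compat; lra).
    specialize (Hx (R0 + Rabs R1 + 2 * Rabs K / P) ltac:(lra) ltac:(lra)).
    apply Rmult_le_compat_r with (r := R0 + Rabs R1 + 2 * Rabs K / P) in Hx; [ | lra].
    unfold Rdiv at 2 in Hx. rewrite (Rmult_assoc (2 * Rabs K) (/ _)), Rinv_l, Rmult_1_r in Hx by lra.
    rewrite !Rmult_plus_distr_l in Hx.
    replace (P * (2 * Rabs K / P)) with (2 * Rabs K) in Hx by (field; lra).
    nra. }
  destruct (pair_energy_bounds k R0 y1 y2 (Rle_refl _)) as [Hb _].
  pose proof (pow2_ge_0 (y1 R0)). pose proof (pow2_ge_0 (y2 R0)).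
  intros r Hr. apply (bessel_pair_zero k R0); auto; apply Rsqr_0_uniq; unfold Rsqr; nra.
Qed.

(* The recurrences shared by all Bessel functions [f s r] of order [s]. *)
Definition cylinder (f : R -> R -> R) : Prop := forall s r, 0 < r ->
  is_derive (f s) r ((f (s - 1) r - f (s + 1) r) / 2) /\
  f (s - 1) r + f (s + 1) r = 2 * s / r * f s r.

Lemma cylinder_pair (f : R -> R -> R) (s : R) : cylinder f ->
  bessel_pair (s + 1 / 2) (fun r => sqrt r * f s r) (fun r => sqrt r * f (s + 1) r).
Proof.
  intros Hf r Hr.
  destruct (Hf s r Hr) as [D1 E1]. destruct (Hf (s + 1) r Hr) as [D2 E2].
  replace (s + 1 - 1) with s in * by ring.
  assert (Ds : is_derive sqrt r (sqrt r / (2 * r))).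
  { replace (sqrt r / (2 * r)) with (/ (2 * sqrt r)).
    auto_derive; auto. ring.
    pose proof (sqrt_lt_R0 r Hr). rewrite <- (sqrt_sqrt r) at 3 by lra. field; lra. }
  split.
  - replace ((s + 1 / 2) / r * (sqrt r * f s r) - sqrt r * f (s + 1) r) with
      (sqrt r / (2 * r) * f s r + sqrt r * ((f (s - 1) r - f (s + 1) r) / 2)).
    apply (is_derive_mult_R sqrt (f s)); auto.
    replace (f (s - 1) r) with (2 * s / r * f s r - f (s + 1) r) by lra. field; lra.
  - replace (sqrt r * f s r - (s + 1 / 2) / r * (sqrt r * f (s + 1) r)) with
      (sqrt r / (2 * r) * f (s + 1) r + sqrt r * ((f s r - f (s + 1 + 1) r) / 2)).
    apply (is_derive_mult_R sqrt (f (s + 1))); auto.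
    replace (f (s + 1 + 1) r) with (2 * (s + 1) / r * f (s + 1) r - f s r) by lra. field; lra.
Qed.

Lemma cylinder_lin (a b : R) (f g : R -> R -> R) : cylinder f -> cylinder g ->
  cylinder (fun s r => a * f s r + b * g s r).
Proof.
  intros Hf Hg s r Hr. destruct (Hf s r Hr) as [D1 E1]. destruct (Hg s r Hr) as [D2 E2].
  split.
  - replace ((a * f (s - 1) r + b * g (s - 1) r - (a * f (s + 1) r + b * g (s + 1) r)) / 2) with
      (a * ((f (s - 1) r - f (s + 1) r) / 2) + b * ((g (s - 1) r - g (s + 1) r) / 2)) by field.
    apply (is_derive_plus (fun r => a * f s r) (fun r => b * g s r)).
    apply (is_derive_scal (f s)); auto. apply (is_derive_scal (g s)); auto.
  - replace (2 * s / r * (a * f s r + b * g s r)) with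
      (a * (2 * s / r * f s r) + b * (2 * s / r * g s r)) by ring.
    rewrite <- E1, <- E2. ring.
Qed.

Lemma cylinder_zero (f : R -> R -> R) (s r0 : R) : cylinder f -> 0 < r0 ->
  f s r0 = 0 -> f (s + 1) r0 = 0 -> forall r, 0 < r -> f s r = 0 /\ f (s + 1) r = 0.
Proof.
  intros Hf Hr0 E1 E2 r Hr.
  destruct (bessel_pair_zero _ r0 _ _ (cylinder_pair f s Hf)) with (r := r) as [H1 H2]; auto.
  rewrite E1; ring. rewrite E2; ring.
  pose proof (sqrt_lt_R0 r Hr).
  split; [apply Rmult_integral in H1 as [ | ] | apply Rmult_integral in H2 as [ | ]]; auto; lra.
Qed.

(** * Schlaefli's integrals *)

Lemma Rabs_sin_le (x : R) : Rabs (sin x) <= Rabs x.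
Proof.
  assert (H : forall x, 0 <= x -> Rabs (sin x) <= x).
  { intros y Hy. apply Rabs_le. split.
    - assert (- y + sin 0 + 0 <= sin y); [ | rewrite sin_0 in *; lra].
      assert (sin 0 + 0 <= sin y + y); [ | lra].
      apply (le_of_derive_nonneg (fun x => sin x + x) (fun x => cos x + 1)); auto.
      intros z _. auto_derive; auto. ring.
      intros z _. pose proof (COS_bound z). lra.
    - assert (sin y - y <= sin 0 - 0); [ | rewrite sin_0 in *; lra].
      apply (le_of_derive_nonpos (fun x => sin x - x) (fun x => cos x - 1)); auto.
      intros z _. auto_derive; auto. ring.
      intros z _. pose proof (COS_bound z). lra. }
  destruct (Rle_dec 0 x).
  - rewrite (Rabs_pos_eq x) by lra. auto.
  - rewrite <- (Ropp_involutive x) at 1. rewrite sin_neg, Rabs_Ropp, (Rabs_left x) by lra. apply H; lra.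
Qed.

Lemma one_minus_cos (x : R) : 0 <= 1 - cos x <= x ^ 2 / 2.
Proof.
  replace x with (2 * (x / 2)) at 1 2 by field. rewrite cos_2a_sin.
  pose proof (Rabs_sin_le (x / 2)) as H. pose proof (Rabs_pos (sin (x / 2))).
  assert (sin (x / 2) ^ 2 <= (x / 2) ^ 2).
  { rewrite <- (pow2_abs (sin _)), <- (pow2_abs (x / 2)). apply pow_incr; lra. }
  pose proof (pow2_ge_0 (sin (x / 2))). split; nra.
Qed.

(** A crude form of Jordan's inequality: with [1 / 3] the leading part [2 / 3 - x ^ 2 / 6] of the
    Taylor bound stays nonnegative up to [x = 2], which [PI <= 4] allows. *)
Lemma sin_ge_third (x : R) : 0 <= x <= PI / 2 -> x / 3 <= sin x.
Proof.
  intros Hx. pose proof PI_4 as H4. pose proof PI_RGT_0.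
  destruct (SIN x) as [Hsin _]; try lra.
  eapply Rle_trans; [ | apply Hsin]. unfold sin_lb, sin_approx, sin_term. simpl.
  assert (0 <= x <= 2) by lra.
  assert (0 <= x ^ 2 <= 4) by nra.
  assert (0 <= x * (2 / 3 - x ^ 2 / 6 + x ^ 2 * x ^ 2 * (1 / 120 - x ^ 2 / 5040))); [ | simpl in *; lra].
  apply Rmult_le_pos; try lra. nra.
Qed.

(** Schlaefli's integral over [[0, PI]], folded at the midpoint by [theta = PI / 2 + phi] and
    [theta = PI / 2 - phi]. The order then enters through [cos (s * phi)] and through factors
    [cos (s * PI / 2)], [sin (s * PI / 2)] outside the integral; the phases [w = 0] and
    [w = - PI / 2] give the cosine and the sine of [r * cos phi]. *)
Definition osc_fun (w s r phi : R) : R := cos (r * cos phi + w) * cos (s * phi).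

Definition osc (w s r : R) : R :=
  2 * RInt (osc_fun w s r) 0 (PI / 2).

Lemma osc_fun_continuous (w s r phi : R) :
  continuous (osc_fun w s r) phi.
Proof.
  apply (ex_derive_continuous (osc_fun w s r)). unfold osc_fun. auto_derive; auto.
Qed.

Lemma sin_shift (x w : R) : sin (x + w) = cos (x + (w - PI / 2)).
Proof. rewrite <- cos_shift, <- cos_neg. f_equal. ring. Qed.

Lemma RInt_lin_R (c d a b : R) (f g : R -> R) :
  (forall x, continuous f x) -> (forall x, continuous g x) ->
  RInt (fun x => c * f x + d * g x) a b = c * RInt f a b + d * RInt g a b.
Proof.
  intros Hf Hg. apply is_RInt_unique.
  apply (is_RInt_plus (fun x => c * f x) (fun x => d * g x)).
  apply (is_RInt_scal f), (RInt_correct f), ex_RInt_cont; auto.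
  apply (is_RInt_scal g), (RInt_correct g), ex_RInt_cont; auto.
Qed.

Lemma osc_derivative (w s r : R) :
  is_derive (osc w s) r (- (osc (w - PI / 2) (s + 1) r + osc (w - PI / 2) (s - 1) r) / 2).
Proof.
  pose proof PI_RGT_0 as HPI.
  replace (- (osc (w - PI / 2) (s + 1) r + osc (w - PI / 2) (s - 1) r) / 2) with
    (2 * RInt (fun phi => - sin (r * cos phi + w) * cos phi * cos (s * phi)) 0 (PI / 2)).
  2:{ unfold osc.
      rewrite (RInt_ext _ (fun phi => (- (1 / 2)) * (osc_fun (w - PI / 2) (s + 1) r phi)
        + (- (1 / 2)) * (osc_fun (w - PI / 2) (s - 1) r phi))).
      rewrite RInt_lin_R by (intros; apply osc_fun_continuous). field.
      intros x _. unfold osc_fun. replace ((s + 1) * x) with (s * x + x) by ring.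
      replace ((s - 1) * x) with (s * x - x) by ring.
      rewrite <- sin_shift, cos_plus, cos_minus. simpl; field. }
  apply (is_derive_scal (fun r => RInt (osc_fun w s r) 0 (PI / 2))).
  apply (is_derive_RInt_quadratic (osc_fun w s)
    (fun r phi => - sin (r * cos phi + w) * cos phi * cos (s * phi))
    (fun r phi => - cos (r * cos phi + w) * cos phi * cos phi * cos (s * phi)) 0 (PI / 2) r 1 1); try lra.
  - intros. apply osc_fun_continuous.
  - intros u. auto_continuous.
  - intros x u. unfold osc_fun. auto_derive; auto. ring.
  - intros x u. auto_derive; auto. ring.
  - intros x u _ _. rewrite !Rabs_mult, Rabs_Ropp.
    assert (Hc : forall y, 0 <= Rabs (cos y) <= 1).
    { intros y. split. apply Rabs_pos. apply Rabs_le. pose proof (COS_bound y). lra. }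
    pose proof (Hc (x * cos u + w)). pose proof (Hc u). pose proof (Hc (s * u)).
    replace 1 with (1 * 1 * 1 * 1) by ring.
    repeat (apply Rmult_le_compat; try (repeat apply Rmult_le_pos; apply Rabs_pos); try lra).
Qed.

(** Integrates the derivative of [sin (s * phi) * cos (r * cos phi + w)]. The right-hand side is the
    boundary term at [PI / 2], where [r * cos phi] vanishes. *)
Lemma osc_recurrence (w s r : R) :
  s * osc w s r + r / 2 * (osc (w - PI / 2) (s - 1) r - osc (w - PI / 2) (s + 1) r) =
  2 * (sin (s * (PI / 2)) * cos w).
Proof.
  assert (E : is_RInt (fun phi => s * cos (s * phi) * cos (r * cos phi + w) +
    sin (s * phi) * (sin (r * cos phi + w) * (r * sin phi))) 0 (PI / 2)
    (minus (sin (s * (PI / 2)) * cos (r * cos (PI / 2) + w)) (sin (s * 0) * cos (r * cos 0 + w)))).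
  { apply (is_RInt_derive (fun phi => sin (s * phi) * cos (r * cos phi + w))).
    - intros x _. auto_derive; auto. ring.
    - intros x _. auto_continuous. }
  apply (is_RInt_unique (V := R_CompleteNormedModule)) in E.
  rewrite Rmult_0_r, sin_0, cos_PI2, Rmult_0_r, Rplus_0_l in E.
  change (minus ?a ?b) with (a - b) in E. rewrite Rmult_0_l, Rminus_0_r in E.
  rewrite <- E. unfold osc. symmetry.
  rewrite (RInt_ext _ (fun phi => s * osc_fun w s r phi + (r / 2) *
    (1 * (osc_fun (w - PI / 2) (s - 1) r phi) +
     -1 * osc_fun (w - PI / 2) (s + 1) r phi))).
  - rewrite (RInt_lin_R s (r / 2) _ _ (osc_fun w s r)
     (fun phi => 1 * (osc_fun (w - PI / 2) (s - 1) r phi) +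
     -1 * osc_fun (w - PI / 2) (s + 1) r phi)).
    rewrite RInt_lin_R by (intros; apply osc_fun_continuous). field.
    intros; apply osc_fun_continuous.
    intros. apply (continuous_plus (V := R_NormedModule));
      apply (continuous_scal_r (V := R_NormedModule)), osc_fun_continuous.
  - intros x _. unfold osc_fun. replace ((s + 1) * x) with (s * x + x) by ring.
    replace ((s - 1) * x) with (s * x - x) by ring.
    rewrite <- sin_shift, (cos_plus (s * x)), (cos_minus (s * x)). simpl; field.
Qed.

Lemma osc_bound (w s r : R) : Rabs (osc w s r) <= PI.
Proof.
  pose proof PI_RGT_0. unfold osc. rewrite Rabs_mult, (Rabs_pos_eq 2) by lra.
  assert (Rabs (RInt (osc_fun w s r) 0 (PI / 2)) <= (PI / 2 - 0) * 1); [ | lra].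
  apply abs_RInt_le_const. lra. apply ex_RInt_cont; intros; apply osc_fun_continuous.
  intros x _. unfold osc_fun. rewrite Rabs_mult. replace 1 with (1 * 1) by ring.
  apply Rmult_le_compat; auto using Rabs_pos; apply Rabs_le; apply COS_bound.
Qed.

Lemma osc_neg_order (w s r : R) : osc w (- s) r = osc w s r.
Proof.
  unfold osc. f_equal. apply RInt_ext. intros x _. unfold osc_fun. f_equal.
  replace (- s * x) with (- (s * x)) by ring. apply cos_neg.
Qed.

Lemma osc_phase_PI (w s r : R) : osc (w - PI / 2 - PI / 2) s r = - osc w s r.
Proof.
  unfold osc. rewrite Ropp_mult_distr_r. f_equal.
  replace (- RInt (osc_fun w s r) 0 (PI / 2)) with
    (RInt (fun phi => -1 * osc_fun w s r phi +
      0 * osc_fun w s r phi) 0 (PI / 2)).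
  - apply RInt_ext. intros x _. unfold osc_fun.
    replace (r * cos x + (w - PI / 2 - PI / 2)) with (- (PI - (r * cos x + w))) by field.
    rewrite cos_neg, Rtrigo_facts.cos_pi_minus.
    real_eq. ring.
  - rewrite RInt_lin_R by (intros; apply osc_fun_continuous). real_eq. ring.
Qed.

(* Integration by parts against [r * sin phi * cos (r * cos phi + w)], the weight
   [(cos (s * phi) - 1) / sin phi] having a bounded derivative. *)
Lemma osc_order_asymptotics (w s : R) : exists K, forall r, 0 < r ->
  Rabs (osc w s r - osc w 0 r) <= K / r.
Proof.
  pose proof PI_RGT_0 as HPI. pose proof PI_4 as HPI4.
  set (Q := fun phi => (cos (s * phi) - 1) / sin phi).
  set (Q' := fun phi => (- s * sin (s * phi) * sin phi - (cos (s * phi) - 1) * cos phi) / sin phi ^ 2).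
  (* The numerator of [Q'] is at most [3 / 2 * s^2 * x^2] and [sin x ^ 2 >= x^2 / 9], which gives
     [27 / 2 * s^2]; the doubled value bounds [Q] as well. *)
  set (B := 27 * s ^ 2). assert (HB : 0 <= B) by (unfold B; pose proof (pow2_ge_0 s); lra).
  assert (Hs : forall x, 0 < x <= PI / 2 -> 0 < sin x) by (intros; apply sin_gt_0; lra).
  assert (HQ : forall x, 0 < x <= PI / 2 -> Rabs (Q x) <= B).
  { intros x Hx. pose proof (sin_ge_third x ltac:(lra)) as H3. pose proof (one_minus_cos (s * x)) as H1.
    specialize (Hs x Hx). unfold Q. rewrite Rabs_div, (Rabs_pos_eq (sin x)) by lra. apply Rle_div_l; auto.
    apply Rle_trans with ((s * x) ^ 2 / 2). apply Rabs_le; lra.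
    apply Rle_trans with (B * (x / 3)). unfold B. pose proof (pow2_ge_0 s). nra.
    apply Rmult_le_compat_l; auto. }
  assert (HQ' : forall x, 0 < x <= PI / 2 -> Rabs (Q' x) <= B).
  { intros x Hx. pose proof (sin_ge_third x ltac:(lra)) as H3. pose proof (one_minus_cos (s * x)) as H1.
    specialize (Hs x Hx). assert (Hs2 : 0 < sin x ^ 2) by (apply pow_lt; auto).
    unfold Q'. rewrite Rabs_div, (Rabs_pos_eq (sin x ^ 2)) by lra. apply Rle_div_l; auto.
    apply Rle_trans with (B * (x / 3) ^ 2).
    2:{ apply Rmult_le_compat_l; auto. apply pow_incr. lra. }
    unfold Rminus at 1. eapply Rle_trans; [apply Rabs_triang | ]. rewrite Rabs_Ropp, !Rabs_mult, Rabs_Ropp.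
    pose proof (Rabs_sin_le (s * x)) as Ha. pose proof (Rabs_sin_le x) as Hb.
    rewrite Rabs_mult in Ha. rewrite (Rabs_pos_eq x) in * by lra.
    assert (Rabs (cos x) <= 1) by (apply Rabs_le, COS_bound).
    assert (Rabs (cos (s * x) - 1) <= (s * x) ^ 2 / 2) by (apply Rabs_le; lra).
    assert (Rabs s * Rabs (sin (s * x)) * Rabs (sin x) <= Rabs s * (Rabs s * x) * x).
    { apply Rmult_le_compat; auto using Rabs_pos. apply Rmult_le_pos; apply Rabs_pos.
      apply Rmult_le_compat_l; auto using Rabs_pos. }
    assert (Rabs (cos (s * x) - 1) * Rabs (cos x) <= (s * x) ^ 2 / 2 * 1).
    { apply Rmult_le_compat; auto using Rabs_pos. }
    replace (Rabs s * (Rabs s * x) * x) with (s ^ 2 * x ^ 2) in H2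
      by (rewrite <- (pow2_abs s); ring).
    unfold B. replace ((s * x) ^ 2) with (s ^ 2 * x ^ 2) in * by ring.
    pose proof (Rmult_le_pos _ _ (pow2_ge_0 s) (pow2_ge_0 x)). nra. }
  exists (8 * B). intros r Hr.
  set (F := fun phi => cos (r * cos phi + w) * (cos (s * phi) - 1)).
  assert (CF : forall x, continuous F x).
  { intros x. apply (ex_derive_continuous F). unfold F. auto_derive; auto. }
  assert (E : osc w s r - osc w 0 r = 2 * RInt F 0 (PI / 2)).
  { unfold osc. rewrite (RInt_ext F (fun phi => 1 * osc_fun w s r phi +
      -1 * osc_fun w 0 r phi)).
    rewrite RInt_lin_R by (intros; apply osc_fun_continuous). ring.
    intros x _. unfold F, osc_fun. rewrite Rmult_0_l, cos_0. simpl. ring. }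
  (* [Q] and [Q'] are quotients [0 / 0] at [0], so the integration by parts stays on [[a, PI / 2]]
     with a bound independent of [a]; the remaining piece is at most [2 * a], and [a] is
     arbitrary. *)
  assert (Hcut : forall a, 0 < a <= PI / 2 -> Rabs (RInt F a (PI / 2)) <= 4 * B / r).
  { intros a Ha.
    assert (I : is_RInt (fun phi => - r * F phi + sin (r * cos phi + w) * Q' phi) a (PI / 2)
      (minus (sin (r * cos (PI / 2) + w) * Q (PI / 2)) (sin (r * cos a + w) * Q a))).
    { apply (is_RInt_derive (fun phi => sin (r * cos phi + w) * Q phi)).
      - intros x Hx. rewrite Rmin_left, Rmax_right in Hx by lra. specialize (Hs x ltac:(lra)).
        unfold Q, F, Q'. auto_derive. lra. field. lra.
      - intros x Hx. rewrite Rmin_left, Rmax_right in Hx by lra. specialize (Hs x ltac:(lra)).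
        apply (ex_derive_continuous (fun phi => - r * F phi + sin (r * cos phi + w) * Q' phi)).
        unfold Q, F, Q'. auto_derive. simpl; nra. }
    assert (CQ : ex_RInt (fun phi => sin (r * cos phi + w) * Q' phi) a (PI / 2)).
    { apply (ex_RInt_continuous (fun phi => sin (r * cos phi + w) * Q' phi)). intros x Hx.
      rewrite Rmin_left, Rmax_right in Hx by lra. specialize (Hs x ltac:(lra)).
      apply (ex_derive_continuous (fun phi => sin (r * cos phi + w) * Q' phi)).
      unfold Q'. auto_derive. simpl; nra. }
    apply (is_RInt_unique (V := R_CompleteNormedModule)) in I.
    assert (I2 : RInt (fun phi => - r * F phi + sin (r * cos phi + w) * Q' phi) a (PI / 2) =
      - r * RInt F a (PI / 2) + RInt (fun phi => sin (r * cos phi + w) * Q' phi) a (PI / 2)).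
    { apply is_RInt_unique. apply (is_RInt_plus (fun phi => - r * F phi)).
      apply (is_RInt_scal F), (RInt_correct F), ex_RInt_cont; auto.
      apply (RInt_correct (fun phi => sin (r * cos phi + w) * Q' phi)); auto. }
    assert (Hsin : forall y, Rabs (sin y) <= 1) by (intros; apply Rabs_le, SIN_bound).
    assert (I3 : Rabs (RInt (fun phi => sin (r * cos phi + w) * Q' phi) a (PI / 2)) <= (PI / 2 - a) * B).
    { apply abs_RInt_le_const; auto. lra. intros x Hx. rewrite Rabs_mult.
      rewrite <- (Rmult_1_l B). apply Rmult_le_compat; auto using Rabs_pos. apply HQ'; lra. }
    change (minus ?x ?y) with (x - y) in I.
    assert (I4 : forall y x, 0 < x <= PI / 2 -> Rabs (sin y * Q x) <= B).
    { intros y x Hx. rewrite Rabs_mult. rewrite <- (Rmult_1_l B).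
      apply Rmult_le_compat; auto using Rabs_pos. }
    pose proof (I4 (r * cos (PI / 2) + w) (PI / 2) ltac:(lra)) as J1.
    pose proof (I4 (r * cos a + w) a Ha) as J2.
    apply Rmult_le_reg_l with r; auto.
    replace (r * (4 * B / r)) with (4 * B) by (field; lra).
    rewrite <- (Rabs_pos_eq r) at 1 by lra. rewrite <- Rabs_mult.
    assert ((PI / 2 - a) * B <= 2 * B) by (apply Rmult_le_compat_r; lra).
    apply Rabs_le_between in I3. apply Rabs_le_between in J1. apply Rabs_le_between in J2.
    apply Rabs_le. lra. }
  rewrite E, Rabs_mult, (Rabs_pos_eq 2) by lra.
  replace (8 * B / r) with (2 * (4 * B / r)) by (field; lra).
  apply Rmult_le_compat_l. lra.
  apply le_epsilon. intros eps Heps.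
  set (a := Rmin (eps / 2) (PI / 2)).
  assert (Ha : 0 < a <= PI / 2).
  { split. apply Rmin_pos; lra. apply Rmin_r. }
  assert (Ha2 : a <= eps / 2) by apply Rmin_l.
  rewrite <- (RInt_Chasles F 0 a (PI / 2)) by (apply ex_RInt_cont; auto).
  change (plus ?x ?y) with (x + y).
  eapply Rle_trans; [apply Rabs_triang | ]. rewrite Rplus_comm. apply Rplus_le_compat. auto.
  apply Rle_trans with ((a - 0) * 2); [ | lra].
  apply abs_RInt_le_const. lra. apply ex_RInt_cont; auto.
  intros x _. unfold F. rewrite Rabs_mult. replace 2 with (1 * 2) by ring.
  apply Rmult_le_compat; auto using Rabs_pos. apply Rabs_le, COS_bound.
  apply Rabs_le. pose proof (COS_bound (s * x)). lra.
Qed.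

Definition schlafli_J (s r : R) : R :=
  (cos (s * (PI / 2)) * osc 0 s r + sin (s * (PI / 2)) * osc (0 - PI / 2) s r
   - sin (s * PI) * expint s r) / PI.

Definition schlafli_Y (s r : R) : R :=
  (cos (s * (PI / 2)) * osc (0 - PI / 2) s r - sin (s * (PI / 2)) * osc 0 s r
   - expint (- s) r - cos (s * PI) * expint s r) / PI.

Lemma trig_order_shift (s : R) :
  cos ((s - 1) * (PI / 2)) = sin (s * (PI / 2)) /\
  sin ((s - 1) * (PI / 2)) = - cos (s * (PI / 2)) /\
  cos ((s + 1) * (PI / 2)) = - sin (s * (PI / 2)) /\
  sin ((s + 1) * (PI / 2)) = cos (s * (PI / 2)) /\
  cos ((s - 1) * PI) = - cos (s * PI) /\ sin ((s - 1) * PI) = - sin (s * PI) /\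
  cos ((s + 1) * PI) = - cos (s * PI) /\ sin ((s + 1) * PI) = - sin (s * PI).
Proof.
  rewrite !Rmult_minus_distr_r, !Rmult_plus_distr_r, !Rmult_1_l.
  rewrite !cos_minus, !cos_plus, !sin_minus, !sin_plus, cos_PI2, sin_PI2, cos_PI, sin_PI.
  repeat split; ring.
Qed.

Lemma cos_sin_double_order (s : R) :
  cos (s * PI) = 1 - 2 * sin (s * (PI / 2)) ^ 2 /\
  sin (s * PI) = 2 * sin (s * (PI / 2)) * cos (s * (PI / 2)).
Proof.
  replace (s * PI) with (2 * (s * (PI / 2))) by field. rewrite cos_2a_sin, sin_2a. split; ring.
Qed.

Lemma is_derive_expint (s r : R) : 0 < r ->
  is_derive (expint s) r (- ((expint (s - 1) r - expint (s + 1) r) / 2)).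
Proof. intros Hr. rewrite <- moment_shift by auto. apply is_derive_moment; auto. Qed.

(** Separately, the oscillating and the exponential integrals satisfy the three-term recurrence only
    up to boundary terms, [2 * sin (s * (PI / 2)) * cos w] and [1]. The trigonometric weights cancel
    these through [sin (s * PI) = 2 * sin (s * (PI / 2)) * cos (s * (PI / 2))]. *)
Lemma schlafli_J_cylinder : cylinder schlafli_J.
Proof.
  intros s r Hr. destruct (trig_order_shift s) as (T1 & T2 & T3 & T4 & T5 & T6 & T7 & T8).
  pose proof PI_RGT_0 as HPI. split.
  - pose proof (osc_derivative 0 s r) as D1. pose proof (osc_derivative (0 - PI / 2) s r) as D2.
    rewrite !osc_phase_PI in D2. pose proof (is_derive_expint s r Hr) as D3.
    unfold schlafli_J. rewrite T1, T2, T3, T4, T6, T8.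
    auto_derive. repeat split; eexists; eassumption.
    apply is_derive_unique in D1, D2, D3.
    eta_reduce. unfold Rminus in D1, D2, D3 |- *.
    rewrite D1, D2, D3. field; lra.
  - pose proof (osc_recurrence 0 s r) as E1. pose proof (osc_recurrence (0 - PI / 2) s r) as E2.
    rewrite !osc_phase_PI in E2. rewrite cos_0 in E1.
    replace (0 - PI / 2) with (- (PI / 2)) in * by ring. rewrite cos_neg, cos_PI2 in E2.
    pose proof (expint_recurrence s r Hr) as E3.
    unfold schlafli_J. rewrite T1, T2, T3, T4, T6, T8.
    replace (0 - PI / 2) with (- (PI / 2)) by ring.
    destruct (cos_sin_double_order s) as [_ E4]. rewrite E4.
    apply Rmult_eq_reg_r with (r * PI); [ | nra].
    transitivity (2 * (cos (s * (PI / 2)) * (s * osc 0 s r) + sin (s * (PI / 2)) * (s * osc (- (PI / 2)) s r)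
      - 2 * sin (s * (PI / 2)) * cos (s * (PI / 2)) * (s * expint s r))).
    2: field; lra.
    rewrite E3.
    replace (s * osc 0 s r) with (2 * (sin (s * (PI / 2)) * 1) - r / 2 *
      (osc (- (PI / 2)) (s - 1) r - osc (- (PI / 2)) (s + 1) r)) by lra.
    replace (s * osc (- (PI / 2)) s r) with (2 * (sin (s * (PI / 2)) * 0) - r / 2 *
      (- osc 0 (s - 1) r - - osc 0 (s + 1) r)) by lra.
    field; lra.
Qed.

Lemma schlafli_Y_cylinder : cylinder schlafli_Y.
Proof.
  intros s r Hr. destruct (trig_order_shift s) as (T1 & T2 & T3 & T4 & T5 & T6 & T7 & T8).
  pose proof PI_RGT_0 as HPI.
  assert (N1 : - (s - 1) = - s + 1) by ring. assert (N2 : - (s + 1) = - s - 1) by ring. split.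
  - pose proof (osc_derivative 0 s r) as D1. pose proof (osc_derivative (0 - PI / 2) s r) as D2.
    rewrite !osc_phase_PI in D2. pose proof (is_derive_expint s r Hr) as D3.
    pose proof (is_derive_expint (- s) r Hr) as D4.
    unfold schlafli_Y. rewrite T1, T2, T3, T4, T5, T7, N1, N2.
    auto_derive. repeat split; eexists; eassumption.
    apply is_derive_unique in D1, D2, D3, D4.
    eta_reduce. unfold Rminus in D1, D2, D3, D4 |- *.
    rewrite D1, D2, D3, D4. unfold Rminus. field; lra.
  - pose proof (osc_recurrence 0 s r) as E1. pose proof (osc_recurrence (0 - PI / 2) s r) as E2.
    rewrite !osc_phase_PI in E2. rewrite cos_0 in E1.
    replace (0 - PI / 2) with (- (PI / 2)) in * by ring. rewrite cos_neg, cos_PI2 in E2.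
    pose proof (expint_recurrence s r Hr) as E3. pose proof (expint_recurrence (- s) r Hr) as E5.
    unfold schlafli_Y. rewrite T1, T2, T3, T4, T5, T7, N1, N2.
    replace (0 - PI / 2) with (- (PI / 2)) by ring.
    destruct (cos_sin_double_order s) as [E4 _]. rewrite E4.
    apply Rmult_eq_reg_r with (r * PI); [ | nra].
    transitivity (2 * (cos (s * (PI / 2)) * (s * osc (- (PI / 2)) s r) - sin (s * (PI / 2)) * (s * osc 0 s r)
      + (- s * expint (- s) r) - (1 - 2 * sin (s * (PI / 2)) ^ 2) * (s * expint s r))).
    2: field; lra.
    rewrite E3, E5.
    replace (s * osc 0 s r) with (2 * (sin (s * (PI / 2)) * 1) - r / 2 *
      (osc (- (PI / 2)) (s - 1) r - osc (- (PI / 2)) (s + 1) r)) by lra.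
    replace (s * osc (- (PI / 2)) s r) with (2 * (sin (s * (PI / 2)) * 0) - r / 2 *
      (- osc 0 (s - 1) r - - osc 0 (s + 1) r)) by lra.
    field; lra.
Qed.

Lemma schlafli_Y_J (s r : R) :
  sin (s * PI) * schlafli_Y s r = schlafli_J s r * cos (s * PI) - schlafli_J (- s) r.
Proof.
  pose proof PI_RGT_0 as HPI. unfold schlafli_Y, schlafli_J.
  rewrite !osc_neg_order, !Ropp_mult_distr_l_reverse, !cos_neg, !sin_neg.
  destruct (cos_sin_double_order s) as [E1 E2]. rewrite E1, E2.
  pose proof (sin2_cos2 (s * (PI / 2))) as E. unfold Rsqr in E.
  set (c := cos (s * (PI / 2))) in *. set (d := sin (s * (PI / 2))) in *.
  replace (d ^ 2) with (d * d) by ring.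
  replace (d * d) with (1 - c * c) by lra. apply Rmult_eq_reg_r with PI; [ | lra].
  field_simplify; try lra.
  replace (d ^ 2) with (1 - c ^ 2) by (simpl; lra). ring.
Qed.

(** [osc_cos] is [J_0] and [osc_sin] is the Struve function [H_0], which differs from [Y_0] by a
    non-oscillating [O(1 / r)]. They are the reference oscillations that the order rotates. *)
Definition osc_cos (r : R) : R := osc 0 0 r / PI.
Definition osc_sin (r : R) : R := osc (0 - PI / 2) 0 r / PI.

Lemma schlafli_asymptotics (s : R) : exists K, forall r, 1 <= r ->
  Rabs (schlafli_J s r - (cos (s * (PI / 2)) * osc_cos r + sin (s * (PI / 2)) * osc_sin r)) <= K / r /\
  Rabs (schlafli_Y s r - (cos (s * (PI / 2)) * osc_sin r + sin (s * (PI / 2)) * - osc_cos r)) <= K / r.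
Proof.
  pose proof PI_RGT_0 as HPI.
  destruct (osc_order_asymptotics 0 s) as [K1 H1].
  destruct (osc_order_asymptotics (0 - PI / 2) s) as [K2 H2].
  destruct (moment_bound 0 s 1 Rlt_0_1) as [K3 [_ H3]].
  destruct (moment_bound 0 (- s) 1 Rlt_0_1) as [K4 [_ H4]].
  exists ((K1 + K2 + K3 + K4) / PI). intros r Hr.
  specialize (H1 r ltac:(lra)). specialize (H2 r ltac:(lra)). specialize (H3 r Hr). specialize (H4 r Hr).
  rewrite pow_1 in H3, H4.
  assert (Hc : forall x e K, -1 <= x <= 1 -> Rabs e <= K -> Rabs (x * e) <= K).
  { intros x e K Hx He. rewrite Rabs_mult. rewrite <- (Rmult_1_l K).
    apply Rmult_le_compat; auto using Rabs_pos. apply Rabs_le; lra. }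
  assert (K4p : 0 <= K4 / r) by (pose proof (Rabs_pos (expint (- s) r)); lra).
  assert (KE : (K1 + K2 + K3 + K4) / PI / r = (K1 / r + K2 / r + K3 / r + K4 / r) / PI) by (field; lra).
  rewrite KE.
  assert (Hdiv : forall x y, Rabs (x * PI) <= y -> Rabs x <= y / PI).
  { intros x y H. apply Rle_div_r; auto. rewrite Rabs_mult, (Rabs_pos_eq PI) in H by lra. auto. }
  split; apply Hdiv.
  - replace ((schlafli_J s r - (cos (s * (PI / 2)) * osc_cos r + sin (s * (PI / 2)) * osc_sin r)) * PI) with
      (cos (s * (PI / 2)) * (osc 0 s r - osc 0 0 r) + sin (s * (PI / 2)) * (osc (0 - PI / 2) s r - osc (0 - PI / 2) 0 r)
       + - (sin (s * PI)) * expint s r) by (unfold schlafli_J, osc_cos, osc_sin; field; lra).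
    pose proof (Hc _ _ _ (COS_bound (s * (PI / 2))) H1) as A1.
    pose proof (Hc _ _ _ (SIN_bound (s * (PI / 2))) H2) as A2.
    pose proof (Hc (- sin (s * PI)) _ _ ltac:(pose proof (SIN_bound (s * PI)); lra) H3) as A3.
    apply Rabs_le_between in A1. apply Rabs_le_between in A2. apply Rabs_le_between in A3.
    apply Rabs_le. lra.
  - replace ((schlafli_Y s r - (cos (s * (PI / 2)) * osc_sin r + sin (s * (PI / 2)) * - osc_cos r)) * PI) with
      (cos (s * (PI / 2)) * (osc (0 - PI / 2) s r - osc (0 - PI / 2) 0 r) + - sin (s * (PI / 2)) * (osc 0 s r - osc 0 0 r)
       + - (cos (s * PI)) * expint s r + - expint (- s) r) by (unfold schlafli_Y, osc_cos, osc_sin; field; lra).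
    pose proof (Hc _ _ _ (COS_bound (s * (PI / 2))) H2) as A1.
    pose proof (Hc (- sin (s * (PI / 2))) _ _ ltac:(pose proof (SIN_bound (s * (PI / 2))); lra) H1) as A2.
    pose proof (Hc (- cos (s * PI)) _ _ ltac:(pose proof (COS_bound (s * PI)); lra) H3) as A3.
    apply Rabs_le_between in A1. apply Rabs_le_between in A2. apply Rabs_le_between in A3.
    apply Rabs_le_between in H4.
    apply Rabs_le. lra.
Qed.

(** * The Gamma function *)

Definition inv_seq (n : nat) : R := / INR (S n).

Lemma inv_seq_pos (n : nat) : 0 < inv_seq n <= 1.
Proof.
  unfold inv_seq. rewrite S_INR. pose proof (pos_INR n). split.
  apply Rinv_0_lt_compat; lra. rewrite <- Rinv_1. apply Rinv_le_contravar; lra.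
Qed.

Lemma is_lim_inv_seq : is_lim_seq inv_seq 0.
Proof.
  unfold inv_seq. apply (is_lim_seq_incr_1 (fun n => / INR n)).
  replace (Finite 0) with (Rbar_inv p_infty) by reflexivity.
  apply is_lim_seq_inv. apply is_lim_seq_INR. discriminate.
Qed.

Lemma is_lim_inv_seq_power (x : R) : 0 < x -> is_lim_seq (fun n => exp (x * ln (inv_seq n))) 0.
Proof.
  intros Hx.
  apply is_lim_seq_spec. intros eps.
  pose proof is_lim_inv_seq as H. apply is_lim_seq_spec in H.
  destruct (H (mkposreal (exp (ln eps / x)) (exp_pos _))) as [N HN].
  exists N. intros n Hn. specialize (HN n Hn). simpl in HN.
  destruct (inv_seq_pos n) as [Hp _].
  rewrite Rminus_0_r in *. rewrite Rabs_pos_eq in HN by lra.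
  rewrite Rabs_pos_eq by (left; apply exp_pos).
  apply ln_increasing in HN; auto. rewrite ln_exp in HN.
  rewrite <- (exp_ln eps) by apply eps. apply exp_increasing.
  apply Rmult_lt_compat_l with (r := x) in HN; auto.
  replace (x * (ln eps / x)) with (ln eps) in HN by (field; lra). auto.
Qed.

(* As [r] tends to [0+], [scaled_expint x r] tends to [2^x Gamma(x)] for [x > 0]. *)
Definition scaled_expint (x r : R) : R := exp (x * ln r) * expint (- x) r.

Lemma scaled_expint_pos (x r : R) : 0 < r -> 0 < scaled_expint x r.
Proof. intros Hr. apply Rmult_lt_0_compat. apply exp_pos. apply expint_pos; auto. Qed.

Lemma scaled_expint_derivative (x r : R) : 0 < r ->
  is_derive (scaled_expint x) r (exp (x * ln r) / r * (r * expint (1 - x) r - 1)).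
Proof.
  intros Hr. unfold scaled_expint.
  replace (exp (x * ln r) / r * (r * expint (1 - x) r - 1)) with
    (x / r * exp (x * ln r) * expint (- x) r +
     exp (x * ln r) * - ((expint (- x - 1) r - expint (- x + 1) r) / 2)).
  - apply (is_derive_mult_R (fun r => exp (x * ln r)) (expint (- x))).
    auto_derive; auto. field; lra.
    apply is_derive_expint; auto.
  - pose proof (expint_recurrence (- x) r Hr) as E.
    replace (1 - x) with (- x + 1) by ring.
    replace (x / r * exp (x * ln r) * expint (- x) r) with
      (- (exp (x * ln r) / r * (- x * expint (- x) r))) by (field; lra).
    rewrite E. field; lra.
Qed.

Definition scaled_limit (x g : R) : Prop := is_lim_seq (fun n => scaled_expint x (inv_seq n)) g.

(** By [expint_upper], [scaled_expint x] grows as [r] falls to [0]; adding [r^x / x] makes its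
    derivative positive instead, which bounds the growth. *)
Lemma scaled_limit_exists (x : R) : 0 < x < 1 -> exists g, 0 < g /\ scaled_limit x g.
Proof.
  intros Hx.
  assert (A : forall a b, 0 < a <= b -> scaled_expint x b <= scaled_expint x a).
  { intros a b Hab.
    apply (le_of_derive_nonpos (scaled_expint x)
      (fun r => exp (x * ln r) / r * (r * expint (1 - x) r - 1))). lra.
    intros; apply scaled_expint_derivative; lra.
    intros r Hr. pose proof (expint_upper (1 - x) r ltac:(lra) ltac:(lra)).
    assert (0 < exp (x * ln r) / r) by (apply Rdiv_lt_0_compat; [apply exp_pos | lra]). nra. }
  assert (B : forall a, 0 < a <= 1 -> scaled_expint x a <= scaled_expint x 1 + 1 / x).
  { intros a Ha.
    assert (scaled_expint x a + exp (x * ln a) / x <= scaled_expint x 1 + exp (x * ln 1) / x).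
    { apply (le_of_derive_nonneg (fun r => scaled_expint x r + exp (x * ln r) / x)
        (fun r => exp (x * ln r) / r * (r * expint (1 - x) r - 1) + exp (x * ln r) / r)). lra.
      - intros r Hr. apply (is_derive_plus (scaled_expint x) (fun r => exp (x * ln r) / x)).
        apply scaled_expint_derivative; lra. auto_derive. lra. field; lra.
      - intros r Hr. replace (exp (x * ln r) / r * (r * expint (1 - x) r - 1) + exp (x * ln r) / r)
          with (exp (x * ln r) * expint (1 - x) r) by (field; lra).
        left; apply Rmult_lt_0_compat. apply exp_pos. apply expint_pos; lra. }
    rewrite ln_1, Rmult_0_r, exp_0 in H.
    assert (0 < exp (x * ln a) / x) by (apply Rdiv_lt_0_compat; [apply exp_pos | lra]). lra. }
  destruct (ex_finite_lim_seq_incr (fun n => scaled_expint x (inv_seq n)) (scaled_expint x 1 + 1 / x)) as [g Hg].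
  - intros n. apply A. destruct (inv_seq_pos (S n)). split; auto.
    unfold inv_seq. rewrite (S_INR (S n)). pose proof (INR_S_pos n).
    apply Rinv_le_contravar; lra.
  - intros n. apply B, inv_seq_pos.
  - exists g. split; auto. apply Rlt_le_trans with (scaled_expint x 1).
    apply scaled_expint_pos; lra.
    apply (is_lim_seq_le (fun _ => scaled_expint x 1) (fun n => scaled_expint x (inv_seq n)) (scaled_expint x 1) g).
    intros n. apply A, inv_seq_pos. apply is_lim_seq_const. auto.
Qed.

Lemma scaled_limit_one : scaled_limit 1 2.
Proof.
  apply (is_lim_seq_ext (fun n => 2 - inv_seq n * expint 1 (inv_seq n))).
  - intros n. destruct (inv_seq_pos n) as [Hp _].
    pose proof (expint_recurrence 0 (inv_seq n) Hp) as E.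
    replace (0 - 1) with (- (1)) in E by ring. replace (0 + 1) with 1 in E by ring.
    unfold scaled_expint. rewrite Rmult_1_l, exp_ln by auto. lra.
  - replace (Finite 2) with (Finite (2 - 0)) by (f_equal; ring).
    apply is_lim_seq_minus'. apply is_lim_seq_const.
    apply (is_lim_seq_le_le (fun _ => 0) _ inv_seq).
    + intros n. destruct (inv_seq_pos n) as [Hp _]. pose proof (expint_pos 1 _ Hp).
      pose proof (expint_le_inv 1 (inv_seq n) Rlt_0_1 Hp) as H1. rewrite Rinv_1 in H1. nra.
    + apply is_lim_seq_const.
    + apply is_lim_inv_seq.
Qed.

(** The functional equation of Gamma: [expint_recurrence] times a power of [r], whose boundary term
    and whose term of order [1 - x] disappear in the limit. *)
Lemma scaled_limit_succ (x g : R) : 0 < x -> scaled_limit x g -> scaled_limit (x + 1) (2 * x * g).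
Proof.
  intros Hx Hg.
  apply (is_lim_seq_ext (fun n => 2 * exp (x * ln (inv_seq n)) + 2 * x * scaled_expint x (inv_seq n)
    - inv_seq n * exp (x * ln (inv_seq n)) * expint (1 - x) (inv_seq n))).
  - intros n. destruct (inv_seq_pos n) as [Hp _].
    pose proof (expint_recurrence (- x) _ Hp) as E.
    unfold scaled_expint. rewrite Rmult_plus_distr_r, Rmult_1_l, exp_plus, exp_ln by auto.
    replace (- (x + 1)) with (- x - 1) by ring. replace (1 - x) with (- x + 1) by ring.
    set (r := inv_seq n) in *. set (e := exp (x * ln r)).
    transitivity (e * (2 - 2 * (- x * expint (- x) r) - r * expint (- x + 1) r)). ring.
    rewrite E. field.
  - replace (Finite (2 * x * g)) with (Finite (2 * 0 + 2 * x * g - 0)) by (f_equal; ring).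
    apply is_lim_seq_minus'. apply is_lim_seq_plus'.
    apply (is_lim_seq_scal_l _ 2 0), is_lim_inv_seq_power; auto.
    apply (is_lim_seq_scal_l _ (2 * x) g); auto.
    apply (is_lim_seq_le_le (fun _ => 0) _ (fun n => inv_seq n * scaled_expint x (inv_seq n))).
    + intros n. destruct (inv_seq_pos n) as [Hp _].
      pose proof (expint_pos (1 - x) _ Hp). pose proof (expint_antitone (- x) (1 - x) _ Hp ltac:(lra)).
      pose proof (exp_pos (x * ln (inv_seq n))). unfold scaled_expint. rewrite <- Rmult_assoc.
      assert (0 < inv_seq n * exp (x * ln (inv_seq n))) by (apply Rmult_lt_0_compat; auto).
      split. apply Rmult_le_pos; lra. apply Rmult_le_compat_l; lra.
    + apply is_lim_seq_const.
    + replace (Finite 0) with (Finite (0 * g)) by (f_equal; ring).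
      apply is_lim_seq_mult'; auto. apply is_lim_inv_seq.
Qed.

(** * Gauss's limit by the Bohr-Mollerup argument *)

Definition rising (x : R) (n : nat) : R := prod_f_R0 (fun k => x + INR k) n.

Lemma rising_S x n : rising x (S n) = rising x n * (x + INR (S n)).
Proof. reflexivity. Qed.

Lemma scaled_limit_shift (x g : R) (n : nat) : 0 < x -> scaled_limit x g ->
  scaled_limit (x + INR (S n)) (2 ^ S n * rising x n * g).
Proof.
  intros Hx Hg. induction n as [ | n IHn].
  - unfold rising. simpl.
    replace (2 * 1 * (x + 0) * g) with (2 * x * g) by ring. apply scaled_limit_succ; auto.
  - rewrite (S_INR (S n)), rising_S.
    replace (x + (INR (S n) + 1)) with (x + INR (S n) + 1) by ring.
    replace (2 ^ S (S n) * (rising x n * (x + INR (S n))) * g) with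
      (2 * (x + INR (S n)) * (2 ^ S n * rising x n * g)) by (simpl; ring).
    apply scaled_limit_succ; auto. pose proof (pos_INR (S n)). lra.
Qed.

Lemma scaled_limit_nat (n : nat) : scaled_limit (INR (S n)) (2 ^ S n * INR (fact n)).
Proof.
  induction n as [ | n IHn].
  - simpl. replace (2 * 1 * 1) with 2 by ring. apply scaled_limit_one.
  - rewrite (S_INR (S n)).
    replace (2 ^ S (S n) * INR (fact (S n))) with (2 * INR (S n) * (2 ^ S n * INR (fact n))).
    apply scaled_limit_succ; auto. apply lt_0_INR; lia.
    rewrite fact_simpl, mult_INR. simpl pow. ring.
Qed.

Lemma exp_convex (theta v : R) : 0 <= theta <= 1 -> exp (theta * v) <= 1 - theta + theta * exp v.
Proof.
  intros Ht.
  pose proof (exp_ineq1_le (- (theta * v))) as H1. pose proof (exp_ineq1_le ((1 - theta) * v)) as H2.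
  pose proof (exp_pos (theta * v)) as H3.
  replace (exp v) with (exp ((1 - theta) * v) * exp (theta * v))
    by (rewrite <- exp_plus; f_equal; ring).
  assert (E : exp (- (theta * v)) * exp (theta * v) = 1) by (rewrite <- exp_plus, Rplus_opp_l; apply exp_0).
  assert (H : 1 <= (1 - theta) * exp (- (theta * v)) + theta * exp ((1 - theta) * v)) by nra.
  apply Rmult_le_compat_r with (r := exp (theta * v)) in H; [ | lra].
  rewrite Rmult_plus_distr_r, Rmult_1_l, (Rmult_assoc (1 - theta)), E in H. lra.
Qed.

(** Hoelder's inequality in a linear form that only needs the convexity of [exp] under the integral;
    the free parameter [lam] is optimised once the limits are known. *)
Lemma scaled_expint_log_convex (a theta lam r : R) : 0 < r -> 0 <= theta <= 1 ->
  scaled_expint (a + theta) r <=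
  exp (theta * lam) * ((1 - theta) * scaled_expint a r + theta * exp (- lam) * scaled_expint (a + 1) r).
Proof.
  intros Hr Ht. unfold scaled_expint, moment.
  pose proof (exp_pos ((a + theta) * ln r)) as HA.
  rewrite <- (integral_inf_scal (exp ((a + theta) * ln r))) by (apply moment_dominated; auto).
  apply Rle_trans with (integral_inf (fun t =>
    (exp (theta * lam) * (1 - theta) * exp (a * ln r)) * moment_fun 0 (- a) r t +
    (exp (theta * lam) * theta * exp (- lam) * exp ((a + 1) * ln r)) * moment_fun 0 (- (a + 1)) r t)).
  - apply integral_inf_le. apply dominated_scal, moment_dominated; auto.
    apply dominated_lin; apply moment_dominated; auto.
    intros t Ht'. unfold moment_fun. simpl. rewrite !Rmult_1_l.
    pose proof (exp_convex theta (ln r + t - lam) Ht) as Hc.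
    set (e := exp (a * ln r + a * t - r * sinh t)).
    assert (He : 0 < e) by apply exp_pos.
    replace (exp ((a + theta) * ln r) * exp (- (- (a + theta) * t) - r * sinh t)) with
      (exp (theta * lam) * e * exp (theta * (ln r + t - lam)))
      by (unfold e; rewrite <- !exp_plus; f_equal; ring).
    replace (exp (theta * lam) * (1 - theta) * exp (a * ln r) * exp (- (- a * t) - r * sinh t) +
      exp (theta * lam) * theta * exp (- lam) * exp ((a + 1) * ln r) * exp (- (- (a + 1) * t) - r * sinh t))
      with (exp (theta * lam) * e * (1 - theta + theta * exp (ln r + t - lam))).
    apply Rmult_le_compat_l; auto. apply Rmult_le_pos. left; apply exp_pos. lra.
    replace (exp (theta * lam) * e * (1 - theta + theta * exp (ln r + t - lam))) with
      (exp (theta * lam) * (1 - theta) * e + exp (theta * lam) * theta * (e * exp (ln r + t - lam))) by ring.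
    f_equal.
    + rewrite (Rmult_assoc _ (exp (a * ln r))), <- exp_plus. f_equal. unfold e. f_equal. ring.
    + rewrite !(Rmult_assoc (exp (theta * lam) * theta)), <- !exp_plus. f_equal.
      unfold e. rewrite <- !exp_plus. f_equal. ring.
  - rewrite integral_inf_lin by (apply moment_dominated; auto). apply Req_le. ring.
Qed.

(** The limits at [a + 1] and [a] have ratio [2 * a]; for [lam = ln (2 * a)] the arithmetic mean of
    the linear bound becomes the geometric mean of log-convexity. *)
Lemma scaled_limit_log_convex (a theta g h : R) : 0 < a -> 0 <= theta <= 1 ->
  scaled_limit a g -> scaled_limit (a + theta) h -> h <= g * exp (theta * ln (2 * a)).
Proof.
  intros Ha Ht Hg Hh. pose proof (scaled_limit_succ a g Ha Hg) as Hg1.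
  set (lam := ln (2 * a)).
  replace (g * exp (theta * lam)) with
    (exp (theta * lam) * ((1 - theta) * g + theta * exp (- lam) * (2 * a * g))).
  2:{ unfold lam. rewrite exp_Ropp, exp_ln by lra. field; lra. }
  apply (is_lim_seq_le (fun n => scaled_expint (a + theta) (inv_seq n))
    (fun n => exp (theta * lam) * ((1 - theta) * scaled_expint a (inv_seq n) + theta * exp (- lam) * scaled_expint (a + 1) (inv_seq n)))
    h (exp (theta * lam) * ((1 - theta) * g + theta * exp (- lam) * (2 * a * g)))); auto.
  - intros n. apply scaled_expint_log_convex; auto. apply inv_seq_pos.
  - apply (is_lim_seq_scal_l _ (exp (theta * lam)) ((1 - theta) * g + theta * exp (- lam) * (2 * a * g))).
    apply is_lim_seq_plus'.
    apply (is_lim_seq_scal_l _ (1 - theta) g); auto.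
    apply (is_lim_seq_scal_l _ (theta * exp (- lam)) (2 * a * g)); auto.
Qed.

Definition gauss_term (z : R) (n : nat) : R :=
  rising z n / (INR (fact n) * Rpower (INR n) z).

Lemma rising_pos x n : 0 < x -> 0 < rising x n.
Proof.
  intros Hx. induction n as [ | n IHn]. unfold rising; simpl; lra.
  rewrite rising_S. apply Rmult_lt_0_compat; auto. pose proof (pos_INR (S n)). lra.
Qed.

(** The Bohr-Mollerup squeeze: log-convexity from [S m] to [x + S m] bounds the rising product
    above, and from [x + S m] to [S (S m)] below; both integer points are known factorials. *)
Lemma gauss_term_squeeze (x g : R) (m : nat) : 0 < x < 1 -> 0 < g -> scaled_limit x g ->
  exp (x * ln 2) / g <= gauss_term x (S m) <= exp (x * ln 2) / g * (1 + x * inv_seq m).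
Proof.
  intros Hx Hg0 Hg. pose proof (rising_pos x m ltac:(lra)) as HP.
  pose proof (INR_S_pos m) as HS.
  pose proof (scaled_limit_shift x g m ltac:(lra) Hg) as H1.
  assert (Hf : 0 < INR (fact m)) by (apply INR_fact_lt_0).
  assert (H2 : 0 < 2 ^ S m) by (apply pow_lt; lra).
  pose proof (scaled_limit_log_convex (INR (S m)) x _ _ HS ltac:(lra) (scaled_limit_nat m)
    ltac:(rewrite Rplus_comm; apply H1)) as U.
  pose proof (scaled_limit_log_convex (x + INR (S m)) (1 - x) _ _ ltac:(lra) ltac:(lra) H1
    ltac:(replace (x + INR (S m) + (1 - x)) with (INR (S (S m))) by (rewrite (S_INR (S m)); ring);
      apply (scaled_limit_nat (S m)))) as L.
  rewrite ln_mult in U, L by lra.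
  rewrite Rmult_plus_distr_l, exp_plus in U, L.
  replace ((1 - x) * ln 2) with (ln 2 + - (x * ln 2)) in L by ring.
  replace ((1 - x) * ln (x + INR (S m))) with (ln (x + INR (S m)) + - (x * ln (x + INR (S m)))) in L by ring.
  rewrite !exp_plus, !exp_Ropp, !exp_ln in L by lra.
  rewrite fact_simpl, mult_INR in L.
  assert (E : gauss_term x (S m) = rising x m * (x + INR (S m)) /
    (INR (S m) * INR (fact m) * exp (x * ln (INR (S m))))).
  { unfold gauss_term, Rpower. rewrite rising_S, fact_simpl, mult_INR. reflexivity. }
  rewrite E.
  set (P := rising x m) in *. set (N := INR (S m)) in *. set (F := INR (fact m)) in *.
  set (e := exp (x * ln N)) in *. set (t := exp (x * ln 2)) in *.
  set (e' := exp (x * ln (x + N))) in *.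
  assert (He : 0 < e) by apply exp_pos. assert (He' : 0 < e') by apply exp_pos.
  assert (Ht : 0 < t) by apply exp_pos.
  assert (Hee : e <= e').
  { apply exp_le. apply Rmult_le_compat_l. lra. left; apply ln_increasing; lra. }
  assert (HN : 0 < N * F * e) by (repeat apply Rmult_lt_0_compat; auto).
  split.
  - apply Rmult_le_reg_r with (N * F * e); auto. unfold Rdiv at 2. rewrite (Rmult_assoc _ (/ _)), Rinv_l, Rmult_1_r by lra.
    apply Rmult_le_reg_l with g; auto.
    replace (g * (t / g * (N * F * e))) with (t * N * F * e) by (field; lra).
    apply Rle_trans with (t * N * F * e').
    apply Rmult_le_compat_l; auto. repeat apply Rmult_le_pos; lra.
    replace (2 ^ S (S m)) with (2 ^ S m * 2) in L by (simpl; ring).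
    apply Rmult_le_reg_l with (2 ^ S m * 2 / (t * e')).
    apply Rdiv_lt_0_compat. lra. apply Rmult_lt_0_compat; auto.
    replace (2 ^ S m * 2 / (t * e') * (t * N * F * e')) with (2 ^ S m * 2 * (N * F)) by (field; lra).
    replace (2 ^ S m * 2 / (t * e') * (g * (P * (x + N)))) with
      (2 ^ S m * P * g * (2 * / t * ((x + N) * / e'))) by (field; lra). auto.
  - apply Rmult_le_reg_r with (N * F * e); auto. unfold Rdiv at 1. rewrite (Rmult_assoc _ (/ _)), Rinv_l, Rmult_1_r by lra.
    apply Rmult_le_reg_l with g; auto.
    unfold inv_seq. fold N.
    replace (g * (t / g * (1 + x * / N) * (N * F * e))) with (t * F * e * (x + N)) by (field; lra).
    replace (g * (P * (x + N))) with ((P * g) * (x + N)) by ring.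
    apply Rmult_le_compat_r. lra.
    apply Rmult_le_reg_l with (2 ^ S m); auto. lra.
Qed.

Lemma gauss_term_lim (x g : R) : 0 < x < 1 -> 0 < g -> scaled_limit x g ->
  is_lim_seq (gauss_term x) (exp (x * ln 2) / g).
Proof.
  intros Hx Hg0 Hg. apply is_lim_seq_incr_1.
  apply (is_lim_seq_le_le (fun _ => exp (x * ln 2) / g) _ (fun m => exp (x * ln 2) / g * (1 + x * inv_seq m))).
  - intros m. apply gauss_term_squeeze; auto.
  - apply is_lim_seq_const.
  - replace (Finite (exp (x * ln 2) / g)) with (Rbar_mult (exp (x * ln 2) / g) (1 + x * 0))
      by (simpl; f_equal; ring).
    apply is_lim_seq_scal_l. apply is_lim_seq_plus'. apply is_lim_seq_const.
    apply (is_lim_seq_scal_l _ x 0), is_lim_inv_seq.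
Qed.

Lemma rising_shift z n : z * rising (z + 1) n = rising z n * (z + INR n + 1).
Proof.
  induction n as [ | n IHn]. unfold rising; simpl; ring.
  rewrite !rising_S, <- Rmult_assoc, IHn, !S_INR. ring.
Qed.

Lemma gauss_term_shift z n : (0 < n)%nat ->
  z * INR n * gauss_term (z + 1) n = (z + INR n + 1) * gauss_term z n.
Proof.
  intros Hn. apply lt_0_INR in Hn. unfold gauss_term.
  rewrite Rpower_plus, Rpower_1 by auto.
  assert (0 < Rpower (INR n) z) by apply exp_pos.
  assert (0 < INR (fact n)) by apply INR_fact_lt_0.
  replace (z * INR n * (rising (z + 1) n / (INR (fact n) * (Rpower (INR n) z * INR n)))) with
    (z * rising (z + 1) n / (INR (fact n) * Rpower (INR n) z)) by (field; lra).
  rewrite rising_shift. field; lra.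
Qed.

Lemma is_lim_seq_shift_ratio (z : R) : is_lim_seq (fun n => (z + INR n + 1) / INR n) 1.
Proof.
  apply is_lim_seq_incr_1.
  apply (is_lim_seq_ext (fun n => 1 + (z + 1) * inv_seq n)).
  - intros n. unfold inv_seq. pose proof (INR_S_pos n). field; lra.
  - replace (Finite 1) with (Finite (1 + (z + 1) * 0)) by (f_equal; ring).
    apply is_lim_seq_plus'. apply is_lim_seq_const.
    apply (is_lim_seq_scal_l _ (z + 1) 0), is_lim_inv_seq.
Qed.

Lemma gauss_term_lim_up (z l : R) : z <> 0 -> is_lim_seq (gauss_term z) l ->
  is_lim_seq (gauss_term (z + 1)) (l / z).
Proof.
  intros Hz H.
  apply (is_lim_seq_ext_loc (fun n => / z * ((z + INR n + 1) / INR n * gauss_term z n))).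
  - exists 1%nat. intros n Hn. pose proof (gauss_term_shift z n ltac:(lia)) as E.
    apply lt_0_INR in Hn.
    replace ((z + INR n + 1) / INR n * gauss_term z n) with ((z + INR n + 1) * gauss_term z n / INR n) by (field; lra).
    rewrite <- E. field; lra.
  - replace (Finite (l / z)) with (Rbar_mult (/ z) (1 * l)) by (simpl; f_equal; field; auto).
    apply is_lim_seq_scal_l, is_lim_seq_mult'; auto. apply is_lim_seq_shift_ratio.
Qed.

Lemma gauss_term_lim_down (z l : R) : is_lim_seq (gauss_term (z + 1)) l ->
  is_lim_seq (gauss_term z) (z * l).
Proof.
  intros H.
  apply (is_lim_seq_ext_loc (fun n => z * (gauss_term (z + 1) n / ((z + INR n + 1) / INR n)))).
  (* For negative [z] the denominator [z + n + 1] may vanish for small [n], so the identity is used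
     only from [|z + 1|] on. *)
  - destruct (nfloor_ex (Rabs (z + 1)) (Rabs_pos _)) as [N [_ HN]].
    exists (S N). intros n Hn. pose proof (gauss_term_shift z n ltac:(lia)) as E.
    apply le_INR in Hn. rewrite S_INR in Hn.
    assert (0 < z + INR n + 1) by (pose proof (Rle_abs (- (z + 1))); rewrite Rabs_Ropp in *; lra).
    pose proof (pos_INR N).
    replace (z * (gauss_term (z + 1) n / ((z + INR n + 1) / INR n))) with
      (z * INR n * gauss_term (z + 1) n / (z + INR n + 1)) by (field; lra).
    rewrite E. field; lra.
  - replace (Finite (z * l)) with (Rbar_mult z (l / 1)) by (simpl; f_equal; field).
    apply is_lim_seq_scal_l, is_lim_seq_div'; auto. apply is_lim_seq_shift_ratio.
Qed.

Lemma gauss_term_lim_one : is_lim_seq (gauss_term 1) 1.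
Proof.
  replace (Finite 1) with (Finite (1 * 1)) by (f_equal; ring).
  apply (is_lim_seq_ext_loc (fun n => (0 + INR n + 1) / INR n * 1)).
  - exists 1%nat. intros n Hn. apply lt_0_INR in Hn. unfold gauss_term.
    rewrite Rpower_1 by auto.
    assert (0 < INR (fact n)) by apply INR_fact_lt_0.
    assert (E : rising 1 n = INR (fact n) * (INR n + 1)).
    { clear. induction n as [ | n IHn]. unfold rising; simpl; ring.
      rewrite rising_S, IHn, fact_simpl, mult_INR, !S_INR. ring. }
    rewrite E. field; lra.
  - apply is_lim_seq_mult'. apply is_lim_seq_shift_ratio. apply is_lim_seq_const.
Qed.

(** From [(0, 1]] the shift upwards divides by [x - 1 > 0], while the shift downwards multiplies,
    and so passes through the poles of Gamma, where the limit is [0]. *)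
Lemma gauss_term_converges z : ex_finite_lim_seq (gauss_term z).
Proof.
  assert (base : forall x, 0 < x <= 1 -> ex_finite_lim_seq (gauss_term x)).
  { intros x Hx. destruct (Req_dec x 1) as [-> | H1]. exists 1; apply gauss_term_lim_one.
    destruct (scaled_limit_exists x ltac:(lra)) as [g [Hg0 Hg]].
    eexists. apply gauss_term_lim; eauto. lra. }
  assert (up : forall n x, 0 < x <= 1 + INR n -> ex_finite_lim_seq (gauss_term x)).
  { induction n as [ | n IHn]; intros x Hx. apply base; simpl in Hx; lra.
    destruct (Rle_dec x 1). apply base; lra.
    rewrite S_INR in Hx. destruct (IHn (x - 1) ltac:(lra)) as [l Hl].
    exists (l / (x - 1)). replace x with (x - 1 + 1) at 1 by ring. apply gauss_term_lim_up; auto. lra. }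
  assert (down : forall n x, - INR n < x -> ex_finite_lim_seq (gauss_term x)).
  { induction n as [ | n IHn]; intros x Hx.
    - simpl in Hx. destruct (nfloor_ex x ltac:(lra)) as [N HN]. apply (up N). lra.
    - rewrite S_INR in Hx. destruct (IHn (x + 1) ltac:(lra)) as [l Hl].
      exists (x * l). apply gauss_term_lim_down; auto. }
  destruct (nfloor_ex (Rabs z) (Rabs_pos z)) as [N HN]. apply (down (S N)).
  rewrite S_INR. pose proof (Rle_abs (- z)). rewrite Rabs_Ropp in *. lra.
Qed.

Lemma rGamma_correct z : is_lim_seq (gauss_term z) (rGamma z).
Proof. apply Lim_seq_correct', gauss_term_converges. Qed.

Lemma rGamma_unique z l : is_lim_seq (gauss_term z) (Finite l) -> rGamma z = l.
Proof. intros H. change (real (Lim_seq (gauss_term z)) = l). now rewrite (is_lim_seq_unique _ _ H). Qed.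

Lemma rGamma_succ z : rGamma z = z * rGamma (z + 1).
Proof. apply rGamma_unique, gauss_term_lim_down, rGamma_correct. Qed.

Lemma rGamma_1 : rGamma 1 = 1.
Proof. apply rGamma_unique, gauss_term_lim_one. Qed.

Lemma rGamma_scaled_limit x : 0 < x < 1 -> 0 < rGamma x /\ scaled_limit x (exp (x * ln 2) / rGamma x).
Proof.
  intros Hx. destruct (scaled_limit_exists x Hx) as [g [Hg0 Hg]].
  rewrite (rGamma_unique x _ (gauss_term_lim x g Hx Hg0 Hg)).
  pose proof (exp_pos (x * ln 2)). split. apply Rdiv_lt_0_compat; auto.
  replace (exp (x * ln 2) / (exp (x * ln 2) / g)) with g by (field; lra). auto.
Qed.

Lemma rGamma_pos z : 0 < z -> 0 < rGamma z.
Proof.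
  assert (H : forall n x, 0 < x <= 1 + INR n -> 0 < rGamma x).
  { induction n as [ | n IHn]; intros x Hx.
    - simpl in Hx. destruct (Req_dec x 1) as [-> | H1]. rewrite rGamma_1; lra.
      apply rGamma_scaled_limit; lra.
    - destruct (Rle_dec x (1 + INR n)). apply IHn; lra. rewrite S_INR in Hx.
      pose proof (pos_INR n).
      specialize (IHn (x - 1) ltac:(lra)). rewrite rGamma_succ in IHn.
      replace (x - 1 + 1) with x in IHn by ring.
      apply Rmult_lt_reg_l with (x - 1). lra. lra. }
  intros Hz. destruct (nfloor_ex z ltac:(lra)) as [N HN]. apply (H N). lra.
Qed.

(** From an argument at least [1] on, each shift divides by a number at least [1], so the values do
    not increase; the finitely many earlier ones are added to the bound. *)
Lemma rGamma_bounded s : exists M, 0 < M /\ forall k, Rabs (rGamma (s + INR k)) <= M.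
Proof.
  assert (base : forall x, 1 <= x -> forall k, 0 < rGamma (x + INR k) <= rGamma x).
  { intros x Hx. induction k as [ | k IHk].
    - simpl. rewrite Rplus_0_r. pose proof (rGamma_pos x). lra.
    - pose proof (pos_INR k). pose proof (rGamma_pos (x + INR (S k))) as HP. rewrite S_INR in *.
      specialize (HP ltac:(lra)).
      rewrite (rGamma_succ (x + INR k)) in IHk.
      replace (x + INR k + 1) with (x + (INR k + 1)) in IHk by ring. nra. }
  assert (H : forall n x, 1 - INR n <= x -> exists M, 0 < M /\ forall k, Rabs (rGamma (x + INR k)) <= M).
  { induction n as [ | n IHn]; intros x Hx.
    - simpl in Hx. exists (rGamma x). split. apply rGamma_pos; lra.
      intros k. destruct (base x ltac:(lra) k). rewrite Rabs_pos_eq; lra.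
    - rewrite S_INR in Hx. destruct (IHn (x + 1) ltac:(lra)) as [M [HM HB]].
      exists (M + Rabs (rGamma x)). pose proof (Rabs_pos (rGamma x)). split. lra.
      intros [ | k]. simpl. rewrite Rplus_0_r. lra.
      specialize (HB k). rewrite S_INR. replace (x + (INR k + 1)) with (x + 1 + INR k) by ring. lra. }
  destruct (nfloor_ex (Rabs s) (Rabs_pos s)) as [N HN]. apply (H (S (S N))).
  rewrite !S_INR. pose proof (Rle_abs (- s)). rewrite Rabs_Ropp in *. lra.
Qed.

(** * The power series of J *)

(* The recurrence of [wallis] yields Euler's product for [sin (s * PI)]. *)
Definition wallis (z : R) (n : nat) : R := RInt (fun t => cos t ^ n * cos (z * t)) 0 (PI / 2).

Lemma wallis_continuous z n t : continuous (fun t => cos t ^ n * cos (z * t)) t.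
Proof. auto_continuous. Qed.

Lemma wallis_recurrence z n :
  ((INR n + 2) ^ 2 - z ^ 2) * wallis z (S (S n)) = (INR n + 2) * (INR n + 1) * wallis z n.
Proof.
  set (N := INR n + 2).
  assert (E : is_RInt (fun t => (N ^ 2 - z ^ 2) * (cos t ^ S (S n) * cos (z * t)) +
      (- (N * (N - 1))) * (cos t ^ n * cos (z * t))) 0 (PI / 2)
    (minus (N * (cos (PI / 2) ^ S n * sin (PI / 2)) * cos (z * (PI / 2)) - z * (cos (PI / 2) ^ S (S n) * sin (z * (PI / 2))))
       (N * (cos 0 ^ S n * sin 0) * cos (z * 0) - z * (cos 0 ^ S (S n) * sin (z * 0))))).
  { apply (is_RInt_derive (fun t => N * (cos t ^ S n * sin t) * cos (z * t) - z * (cos t ^ S (S n) * sin (z * t)))).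
    - intros t _. auto_derive; auto.
      change (match n with 0%nat => 1 | S _ => INR n + 1 end) with (INR (S n)).
      rewrite S_INR, <- !tech_pow_Rmult.
      pose proof (sin2_cos2 t) as Hs. unfold Rsqr in Hs.
      unfold N.
      set (c := cos t) in *. set (d := sin t) in *. set (p := c ^ n). set (u := cos (z * t)). set (v := sin (z * t)).
      transitivity ((INR n + 2) * ((INR n + 1) * - (d * d) * p + c * (c * p)) * u
         + z * z * - (c * (c * p) * u)). ring.
      replace (d * d) with (1 - c * c) by lra. ring.
    - intros t _. auto_continuous. }
  apply (is_RInt_unique (V := R_CompleteNormedModule)) in E.
  rewrite RInt_lin_R in E by (intros; apply wallis_continuous).
  change (minus ?a ?b) with (a - b) in E.
  rewrite cos_PI2, !Rmult_0_r, !sin_0 in E. rewrite <- !tech_pow_Rmult in E.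
  unfold wallis. unfold N in *. simpl pow in *. lra.
Qed.

Lemma wallis_pos n : 0 < wallis 0 n.
Proof.
  pose proof PI_RGT_0. apply RInt_gt_0. lra.
  - intros t Ht. rewrite Rmult_0_l, cos_0, Rmult_1_r. apply pow_lt, cos_gt_0; lra.
  - intros; apply wallis_continuous.
Qed.

Lemma wallis_zero z : z <> 0 -> wallis z 0 = sin (z * (PI / 2)) / z.
Proof.
  intros Hz. apply is_RInt_unique.
  replace (sin (z * (PI / 2)) / z) with (minus (sin (z * (PI / 2)) / z) (sin (z * 0) / z)).
  2:{ change (minus ?a ?b) with (a - b). rewrite Rmult_0_r, sin_0. real_eq. field; auto. }
  apply (is_RInt_derive (fun t => sin (z * t) / z)).
  - intros t _. auto_derive; auto. simpl. field; auto.
  - intros; apply wallis_continuous.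
Qed.

Lemma wallis_zero_zero : wallis 0 0 = PI / 2.
Proof.
  unfold wallis. rewrite (RInt_ext _ (fun _ => 1)).
  rewrite RInt_const. change (scal ?a ?b) with (a * b). real_eq. ring.
  intros t _. rewrite Rmult_0_l, cos_0. simpl. real_eq. ring.
Qed.

(** The weight [cos t ^ (2 n)] concentrates at [0]. Indeed [1 - cos (2 s t) <= 2 s^2 t^2 <= 18 s^2
    sin^2 t], and by the recurrence the mean of [sin^2 t] for this weight is [1 / (2 n + 2)]. *)
Lemma wallis_ratio_lim s : is_lim_seq (fun n => wallis (2 * s) (2 * n) / wallis 0 (2 * n)) 1.
Proof.
  pose proof PI_RGT_0 as HPI.
  apply (is_lim_seq_le_le (fun n => 1 - 9 * s ^ 2 * inv_seq n) _ (fun _ => 1)).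
  - intros n. pose proof (wallis_pos (2 * n)) as HW.
    set (W := wallis 0 (2 * n)) in *. set (W2 := wallis 0 (S (S (2 * n)))).
    set (Z := wallis (2 * s) (2 * n)).
    assert (E : W - W2 = W * inv_seq n / 2).
    { pose proof (wallis_recurrence 0 (2 * n)) as E. fold W W2 in E. rewrite mult_INR in E. change (INR 2) with 2 in E.
      unfold inv_seq. rewrite S_INR. pose proof (pos_INR n).
      replace (W2) with
        (((2 * INR n + 2) ^ 2 - 0 ^ 2) * W2 / (2 * INR n + 2) ^ 2) by (field; lra).
      rewrite E. field. lra. }
    assert (B : forall t, 0 < t < PI / 2 -> 0 <= cos t ^ (2 * n)) by (intros; apply pow_le, cos_ge_0; lra).
    assert (U : Z <= W).
    { apply RInt_le. lra. apply ex_RInt_cont; intros; apply wallis_continuous.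
      apply ex_RInt_cont; intros; apply wallis_continuous.
      intros t Ht. apply Rmult_le_compat_l; auto. rewrite Rmult_0_l, cos_0. apply COS_bound. }
    assert (L : 1 * W + -1 * Z <=
      18 * s ^ 2 * W + - (18 * s ^ 2) * W2).
    { unfold W, W2, Z, wallis. rewrite <- !RInt_lin_R by (intros; apply wallis_continuous).
      apply RInt_le. lra.
      - apply ex_RInt_cont. intros t. auto_continuous.
      - apply ex_RInt_cont. intros t. auto_continuous.
      - intros t Ht. specialize (B t Ht). rewrite Rmult_0_l, cos_0, <- (tech_pow_Rmult (cos t) (S (2 * n))), <- (tech_pow_Rmult (cos t) (2 * n)).
        pose proof (sin2_cos2 t) as Hs. unfold Rsqr in Hs.
        pose proof (sin_ge_third t ltac:(lra)) as H3. pose proof (one_minus_cos (2 * s * t)) as H1.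
        replace (1 * (cos t ^ (2 * n) * 1) + -1 * (cos t ^ (2 * n) * cos (2 * s * t))) with
          (cos t ^ (2 * n) * (1 - cos (2 * s * t))) by ring.
        replace (18 * s ^ 2 * (cos t ^ (2 * n) * 1) + - (18 * s ^ 2) * (cos t * (cos t * cos t ^ (2 * n)) * 1))
          with (cos t ^ (2 * n) * (18 * s ^ 2 * (1 - cos t * cos t))) by ring.
        apply Rmult_le_compat_l; auto.
        replace (1 - cos t * cos t) with (sin t * sin t) by lra.
        apply Rle_trans with ((2 * s * t) ^ 2 / 2). lra.
        replace ((2 * s * t) ^ 2 / 2) with (18 * s ^ 2 * (t / 3 * (t / 3))) by field.
        apply Rmult_le_compat_l. pose proof (pow2_ge_0 s); lra.
        apply Rmult_le_compat; lra. }
    split.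
    + apply Rle_div_r; auto.
      replace (18 * s ^ 2 * W + - (18 * s ^ 2) * W2) with
        (18 * s ^ 2 * (W - W2)) in L by ring.
      rewrite E in L. lra.
    + apply Rle_div_l; auto. lra.
  - replace (Finite 1) with (Finite (1 - 9 * s ^ 2 * 0)) by (f_equal; ring).
    apply is_lim_seq_minus'. apply is_lim_seq_const.
    apply (is_lim_seq_scal_l _ (9 * s ^ 2) 0), is_lim_inv_seq.
  - apply is_lim_seq_const.
Qed.

(** Euler's product for the sine cut off at [n], with the Wallis quotient as its remainder factor;
    the sine itself comes from the elementary integral at [n = 0]. *)
Lemma rising_reflection s n : 0 < s < 1 ->
  rising s n * rising (1 - s) n * (wallis (2 * s) (2 * n) / wallis 0 (2 * n)) =
  sin (s * PI) / PI * (INR n + 1 - s) * INR (fact n) ^ 2.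
Proof.
  intros Hs. pose proof PI_RGT_0 as HPI. induction n as [ | n IHn].
  - change (2 * 0)%nat with 0%nat. rewrite wallis_zero, wallis_zero_zero by lra.
    replace (2 * s * (PI / 2)) with (s * PI) by field. unfold rising; simpl. field; lra.
  - rewrite !rising_S.
    replace (2 * S n)%nat with (S (S (2 * n))) by lia.
    pose proof (wallis_pos (2 * n)) as HW. pose proof (wallis_pos (S (S (2 * n)))) as HW2.
    pose proof (wallis_recurrence (2 * s) (2 * n)) as E1.
    pose proof (wallis_recurrence 0 (2 * n)) as E0.
    rewrite mult_INR in E1, E0. change (INR 2) with 2 in E1, E0.
    rewrite fact_simpl, mult_INR, S_INR. set (N := INR n) in *.
    assert (HN : 0 <= N) by apply pos_INR.
    set (A := wallis (2 * s) (2 * n)) in *. set (A2 := wallis (2 * s) (S (S (2 * n)))) in *.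
    set (B := wallis 0 (2 * n)) in *. set (B2 := wallis 0 (S (S (2 * n)))) in *.
    assert (R2 : ((N + 1) ^ 2 - s ^ 2) * (A2 / B2) = (N + 1) ^ 2 * (A / B)).
    { apply Rmult_eq_reg_r with (4 * B2 * B); [ | apply Rgt_not_eq; repeat apply Rmult_lt_0_compat; lra].
      transitivity (((2 * N + 2) ^ 2 - (2 * s) ^ 2) * A2 * B). field; lra.
      rewrite E1.
      transitivity (((2 * N + 2) ^ 2 - 0 ^ 2) * B2 * A). 2: field; lra.
      rewrite E0. ring. }
    transitivity (rising s n * rising (1 - s) n * ((N + 2 - s) / (N + 1 - s)) *
      (((N + 1) ^ 2 - s ^ 2) * (A2 / B2))). field. split; lra.
    rewrite R2.
    transitivity ((rising s n * rising (1 - s) n * (A / B)) * ((N + 2 - s) / (N + 1 - s)) * (N + 1) ^ 2).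
    field; split; lra.
    rewrite IHn. field. split; lra.
Qed.

Lemma rGamma_reflection s : 0 < s < 1 -> rGamma s * rGamma (1 - s) = sin (s * PI) / PI.
Proof.
  intros Hs. pose proof PI_RGT_0 as HPI.
  assert (H1 : is_lim_seq (fun n => gauss_term s n * gauss_term (1 - s) n *
    (wallis (2 * s) (2 * n) / wallis 0 (2 * n))) (rGamma s * rGamma (1 - s) * 1)).
  { apply is_lim_seq_mult'. apply is_lim_seq_mult'; apply rGamma_correct. apply wallis_ratio_lim. }
  assert (H2 : is_lim_seq (fun n => gauss_term s n * gauss_term (1 - s) n *
    (wallis (2 * s) (2 * n) / wallis 0 (2 * n))) (sin (s * PI) / PI * 1)).
  { apply (is_lim_seq_ext_loc (fun n => sin (s * PI) / PI * ((- s + INR n + 1) / INR n))).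
    - exists 1%nat. intros n Hn. apply lt_0_INR in Hn.
      unfold gauss_term.
      assert (0 < INR (fact n)) by apply INR_fact_lt_0.
      assert (HR : Rpower (INR n) s * Rpower (INR n) (1 - s) = INR n).
      { rewrite <- Rpower_plus. replace (s + (1 - s)) with 1 by ring. apply Rpower_1; auto. }
      assert (0 < Rpower (INR n) s) by apply exp_pos.
      assert (0 < Rpower (INR n) (1 - s)) by apply exp_pos.
      pose proof (wallis_pos (2 * n)).
      transitivity (rising s n * rising (1 - s) n * (wallis (2 * s) (2 * n) / wallis 0 (2 * n)) /
        (INR (fact n) ^ 2 * (Rpower (INR n) s * Rpower (INR n) (1 - s)))).
      rewrite rising_reflection, HR by auto. field; lra. field; lra.
    - apply is_lim_seq_scal_l with (a := sin (s * PI) / PI) (lu := 1). apply is_lim_seq_shift_ratio. }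
  apply is_lim_seq_unique in H1, H2. rewrite H1 in H2. injection H2. intros E. lra.
Qed.

(** * The series as an entire function, and the recurrences of [J] *)

Definition bessel_coef (s : R) (k : nat) : R := (-1) ^ k * rGamma (s + INR k + 1) / INR (fact k).

Lemma bessel_coef_radius s : CV_radius (bessel_coef s) = p_infty.
Proof.
  destruct (rGamma_bounded (s + 1)) as [M [HM H]].
  assert (F : forall n, 0 < INR (fact n)) by (intros; apply INR_fact_lt_0).
  assert (D : forall x, CV_disk (bessel_coef s) x).
  { intros x.
    assert (E : CV_disk (fun k => M / INR (fact k)) x).
    { apply CV_disk_DAlembert with 0; [ | | left; auto].
      - intros n. apply Rgt_not_eq. apply Rdiv_lt_0_compat; auto.
      - apply (is_lim_seq_ext inv_seq); [ | apply is_lim_inv_seq].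
        intros n. pose proof (F n). pose proof (inv_seq_pos n).
        replace (M / INR (fact (S n)) / (M / INR (fact n))) with (inv_seq n).
        rewrite Rabs_pos_eq; lra.
        unfold inv_seq. rewrite fact_simpl, mult_INR. pose proof (INR_S_pos n).
        field; lra. }
    unfold CV_disk in *. apply (@ex_series_le R_AbsRing R_CompleteNormedModule) with (2 := E).
    intros n. change (norm ?y) with (Rabs y). rewrite Rabs_Rabsolu, !Rabs_mult.
    apply Rmult_le_compat_r; auto using Rabs_pos. unfold bessel_coef, Rdiv. specialize (F n).
    rewrite !Rabs_mult, pow_1_abs, Rmult_1_l.
    apply Rmult_le_compat_r; auto using Rabs_pos. rewrite (Rabs_pos_eq M) by lra.
    replace (s + INR n + 1) with (s + 1 + INR n) by ring. auto. }
  unfold CV_radius. destruct (Lub_Rbar_correct (CV_disk (bessel_coef s))) as [U _].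
  destruct (Lub_Rbar (CV_disk (bessel_coef s))) as [c | | ]; auto; exfalso.
  - specialize (U (c + 1) (D _)). simpl in U. lra.
  - exact (U 0 (D _)).
Qed.

Definition bessel_series (s z : R) : R := PSeries (bessel_coef s) z.

Lemma bessel_series_derivative s z : is_derive (bessel_series s) z (- bessel_series (s + 1) z).
Proof.
  replace (- bessel_series (s + 1) z) with (PSeries (PS_derive (bessel_coef s)) z).
  - apply is_derive_PSeries. rewrite bessel_coef_radius. exact I.
  - unfold bessel_series. rewrite <- PSeries_opp. apply PSeries_ext. intros n.
    unfold PS_derive, PS_opp, bessel_coef. change (opp ?x) with (- x).
    rewrite fact_simpl, mult_INR, S_INR. replace (s + (INR n + 1) + 1) with (s + 1 + INR n + 1) by ring.
    assert (0 < INR (fact n)) by apply INR_fact_lt_0. pose proof (pos_INR n).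
    simpl pow. field; lra.
Qed.

Lemma bessel_series_recurrence s z :
  bessel_series (s - 1) z + z * bessel_series (s + 1) z = s * bessel_series s z.
Proof.
  unfold bessel_series. rewrite <- PSeries_incr_1, <- PSeries_scal.
  rewrite <- PSeries_plus.
  - apply PSeries_ext. intros n. unfold PS_plus, PS_scal, PS_incr_1.
    change (plus ?x ?y) with (x + y). change (scal ?x ?y) with (x * y). change (@zero _) with 0.
    unfold bessel_coef. destruct n as [ | m].
    + simpl. rewrite !Rplus_0_r. replace (s - 1 + 1) with s by ring. rewrite (rGamma_succ s).
      field.
    + rewrite fact_simpl, mult_INR, S_INR.
      replace (s - 1 + (INR m + 1) + 1) with (s + INR m + 1) by ring.
      replace (s + (INR m + 1) + 1) with (s + INR m + 1 + 1) by ring.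
      replace (s + 1 + INR m + 1) with (s + INR m + 1 + 1) by ring.
      rewrite (rGamma_succ (s + INR m + 1)).
      assert (0 < INR (fact m)) by apply INR_fact_lt_0. pose proof (pos_INR m).
      simpl pow. field; lra.
  - apply CV_radius_inside. rewrite bessel_coef_radius. exact I.
  - apply ex_pseries_incr_1. apply CV_radius_inside. rewrite bessel_coef_radius. exact I.
Qed.

Lemma besselJ_series s r : besselJ s r = exp (s * ln (r / 2)) * bessel_series s (r ^ 2 / 4).
Proof. reflexivity. Qed.

Lemma besselJ_cylinder : cylinder besselJ.
Proof.
  intros s r Hr.
  assert (E : besselJ (s - 1) r + besselJ (s + 1) r = 2 * s / r * besselJ s r).
  { rewrite !besselJ_series. rewrite Rmult_minus_distr_r, Rmult_plus_distr_r, Rmult_1_l.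
    unfold Rminus at 1. rewrite !exp_plus, exp_Ropp, exp_ln by lra.
    pose proof (bessel_series_recurrence s (r ^ 2 / 4)) as E.
    transitivity (exp (s * ln (r / 2)) * (2 / r) * (bessel_series (s - 1) (r ^ 2 / 4)
      + r ^ 2 / 4 * bessel_series (s + 1) (r ^ 2 / 4))). field; lra.
    rewrite E. field; lra. }
  split; auto.
  replace ((besselJ (s - 1) r - besselJ (s + 1) r) / 2) with (s / r * besselJ s r - besselJ (s + 1) r)
    by (replace (besselJ (s - 1) r) with (2 * s / r * besselJ s r - besselJ (s + 1) r) by lra; field; lra).
  apply (is_derive_ext (fun r => exp (s * ln (r / 2)) * bessel_series s (r ^ 2 / 4))).
  { intros t. symmetry. apply besselJ_series. }
  rewrite !besselJ_series.
  pose proof (bessel_series_derivative s (r ^ 2 / 4)) as D.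
  replace (s / r * (exp (s * ln (r / 2)) * bessel_series s (r ^ 2 / 4)) -
    exp ((s + 1) * ln (r / 2)) * bessel_series (s + 1) (r ^ 2 / 4)) with
    (s / r * exp (s * ln (r / 2)) * bessel_series s (r ^ 2 / 4) +
     exp (s * ln (r / 2)) * (r / 2 * - bessel_series (s + 1) (r ^ 2 / 4))).
  - apply (is_derive_mult_R (fun r => exp (s * ln (r / 2))) (fun r => bessel_series s (r ^ 2 / 4))).
    + auto_derive. lra. unfold Rdiv. field; lra.
    + apply (is_derive_comp (bessel_series s) (fun r => r ^ 2 / 4) r _ (r / 2)); auto.
      auto_derive; auto. field.
  - rewrite Rmult_plus_distr_r, Rmult_1_l, exp_plus, exp_ln by lra. field; lra.
Qed.

Lemma besselJ_scaled_limit s :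
  is_lim_seq (fun n => exp (- s * ln (inv_seq n)) * besselJ s (inv_seq n)) (exp (- s * ln 2) * rGamma (s + 1)).
Proof.
  apply (is_lim_seq_ext (fun n => exp (- s * ln 2) * bessel_series s (inv_seq n ^ 2 / 4))).
  - intros n. destruct (inv_seq_pos n) as [Hp _]. rewrite besselJ_series, <- Rmult_assoc, <- exp_plus.
    f_equal. f_equal. rewrite ln_div by lra. ring.
  - apply (is_lim_seq_scal_l _ (exp (- s * ln 2)) (rGamma (s + 1))).
    replace (rGamma (s + 1)) with (bessel_series s 0).
    2:{ unfold bessel_series. rewrite PSeries_0. unfold bessel_coef. simpl. rewrite Rplus_0_r. field. }
    apply (is_lim_seq_continuous (bessel_series s)).
    + apply continuity_pt_filterlim, (ex_derive_continuous (bessel_series s)).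
      eexists. apply bessel_series_derivative.
    + replace (Finite 0) with (Finite (0 * (0 * / 4))) by (f_equal; ring).
      apply (is_lim_seq_ext (fun n => inv_seq n * (inv_seq n * / 4))). intros n; field.
      apply is_lim_seq_mult'. apply is_lim_inv_seq.
      apply (is_lim_seq_scal_r _ (/ 4) 0), is_lim_inv_seq.
Qed.

Lemma besselJ_nonzero s : 0 < s + 1 -> exists x, 0 < x /\ besselJ s x <> 0.
Proof.
  intros Hs. pose proof (besselJ_scaled_limit s) as L. apply is_lim_seq_spec in L.
  assert (HP : 0 < exp (- s * ln 2) * rGamma (s + 1))
    by (apply Rmult_lt_0_compat; [apply exp_pos | apply rGamma_pos; lra]).
  destruct (L (mkposreal _ HP)) as [N HN]. specialize (HN N (Nat.le_refl N)).
  exists (inv_seq N). split. apply inv_seq_pos. intros E. rewrite E, Rmult_0_r in HN. simpl in HN.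
  rewrite Rminus_0_l, Rabs_Ropp, Rabs_pos_eq in HN; lra.
Qed.

(** * Power series and Schlaefli's integrals agree *)

(** Abel's identity, with the neighbouring order standing for the derivative: the recurrences make
    the derivative of [r] times the determinant vanish. *)
Lemma cylinder_wronskian (f g : R -> R -> R) (s a b : R) : cylinder f -> cylinder g -> 0 < a -> 0 < b ->
  a * (f s a * g (s + 1) a - f (s + 1) a * g s a) = b * (f s b * g (s + 1) b - f (s + 1) b * g s b).
Proof.
  intros Hf Hg.
  set (W := fun r => r * (f s r * g (s + 1) r - f (s + 1) r * g s r)).
  assert (D : forall r, 0 < r -> is_derive W r 0).
  { intros r Hr. destruct (Hf s r Hr) as [D1 E1]. destruct (Hf (s + 1) r Hr) as [D2 E2].
    destruct (Hg s r Hr) as [D3 E3]. destruct (Hg (s + 1) r Hr) as [D4 E4].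
    replace (s + 1 - 1) with s in * by ring.
    unfold W. auto_derive. repeat split; eexists; eassumption.
    apply is_derive_unique in D1, D2, D3, D4.
    eta_reduce.
    rewrite D1, D2, D3, D4.
    replace (f (s - 1) r) with (2 * s / r * f s r - f (s + 1) r) by lra.
    replace (g (s - 1) r) with (2 * s / r * g s r - g (s + 1) r) by lra.
    replace (f (s + 1 + 1) r) with (2 * (s + 1) / r * f (s + 1) r - f s r) by lra.
    replace (g (s + 1 + 1) r) with (2 * (s + 1) / r * g (s + 1) r - g s r) by lra.
    field; lra. }
  assert (L : forall x y, 0 < x <= y -> W x = W y).
  { intros x y Hxy. apply Rle_antisym.
    - apply (le_of_derive_nonneg W (fun _ => 0)); [lra | | intros; lra]. intros; apply D; lra.
    - apply (le_of_derive_nonpos W (fun _ => 0)); [lra | | intros; lra]. intros; apply D; lra. }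
  intros Ha Hb. change (W a = W b).
  destruct (Rle_dec a b). apply L; lra. symmetry; apply L; lra.
Qed.

Lemma is_lim_seq_mult_bounded (u v : nat -> R) (B : R) :
  is_lim_seq u 0 -> (forall n, Rabs (v n) <= B) -> is_lim_seq (fun n => u n * v n) 0.
Proof.
  intros Hu Hv. apply is_lim_seq_abs_0.
  apply (is_lim_seq_le_le (fun _ => 0) _ (fun n => Rabs (u n) * B)).
  - intros n. split. apply Rabs_pos. rewrite Rabs_mult. apply Rmult_le_compat_l; auto using Rabs_pos.
  - apply is_lim_seq_const.
  - replace (Finite 0) with (Rbar_mult (Rabs 0) B) by (rewrite Rabs_R0; simpl; f_equal; ring).
    apply is_lim_seq_scal_r. apply (is_lim_seq_abs u 0); auto.
Qed.

Lemma schlafli_J_osc_bound (s r : R) :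
  Rabs ((cos (s * (PI / 2)) * osc 0 s r + sin (s * (PI / 2)) * osc (0 - PI / 2) s r) / PI) <= 2.
Proof.
  pose proof PI_RGT_0 as HPI.
  unfold Rdiv at 1. rewrite Rabs_mult, Rabs_inv, (Rabs_pos_eq PI) by lra.
  apply (Rle_div_l _ _ PI); auto.
  eapply Rle_trans; [apply Rabs_triang | ]. rewrite !Rabs_mult.
  assert (H : forall x y, Rabs x <= 1 -> Rabs y <= PI -> Rabs x * Rabs y <= 1 * PI).
  { intros. apply Rmult_le_compat; auto using Rabs_pos. }
  pose proof (H _ _ (Rabs_le _ 1 (COS_bound (s * (PI / 2)))) (osc_bound 0 s r)).
  pose proof (H _ _ (Rabs_le _ 1 (SIN_bound (s * (PI / 2)))) (osc_bound (0 - PI / 2) s r)). lra.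
Qed.

Lemma schlafli_J_bounded (s : R) : 0 <= s -> exists B, forall r, 0 < r -> Rabs (schlafli_J s r) <= B.
Proof.
  intros Hs. pose proof PI_RGT_0 as HPI.
  exists (2 + / s). intros r Hr.
  replace (schlafli_J s r) with
    ((cos (s * (PI / 2)) * osc 0 s r + sin (s * (PI / 2)) * osc (0 - PI / 2) s r) / PI
     + - (sin (s * PI) / PI) * expint s r) by (unfold schlafli_J; field; lra).
  eapply Rle_trans; [apply Rabs_triang | ]. apply Rplus_le_compat. apply schlafli_J_osc_bound.
  destruct (Req_dec s 0) as [-> | Hne].
  - rewrite Rmult_0_l, sin_0. unfold Rdiv. rewrite Rmult_0_l, Ropp_0, Rmult_0_l, Rabs_R0, Rinv_0. lra.
  - rewrite Rabs_mult, Rabs_Ropp. pose proof (expint_pos s r Hr). rewrite (Rabs_pos_eq (expint s r)) by lra.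
    pose proof (expint_le_inv s r ltac:(lra) Hr).
    assert (Rabs (sin (s * PI) / PI) <= 1).
    { rewrite Rabs_div, (Rabs_pos_eq PI) by lra. apply Rle_div_l; auto. rewrite Rmult_1_l.
      apply Rle_trans with 1. apply Rabs_le, SIN_bound. pose proof PI2_1. lra. }
    rewrite <- (Rmult_1_l (/ s)). apply Rmult_le_compat; auto using Rabs_pos; lra.
Qed.

(** For [s > 0] the oscillating part is bounded and disappears after scaling by [r^s]. The
    exponential part tends to [sin (s PI) / PI * 2^s Gamma(s)], which the reflection formula turns
    into the leading coefficient of the series. At [s = 0] the exponential part is absent. *)
Lemma schlafli_J_scaled_limit (s : R) : 0 <= s < 1 ->
  is_lim_seq (fun n => exp (s * ln (inv_seq n)) * schlafli_J (- s) (inv_seq n))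
    (exp (s * ln 2) * rGamma (1 - s)).
Proof.
  intros Hs. pose proof PI_RGT_0 as HPI. destruct (Req_dec s 0) as [-> | Hne].
  - rewrite Ropp_0, Rmult_0_l, exp_0, Rminus_0_r, rGamma_1, Rmult_1_l.
    apply (is_lim_seq_ext (fun n => osc 0 0 (inv_seq n) / PI)).
    { intros n. unfold schlafli_J. rewrite !Rmult_0_l, cos_0, sin_0, exp_0. field; lra. }
    replace (Finite 1) with (Finite (osc 0 0 0 * / PI)).
    2:{ f_equal. unfold osc, osc_fun. rewrite (RInt_ext _ (fun _ => 1)). rewrite RInt_const.
        change (scal ?a ?b) with (a * b). field; lra.
        intros x _. rewrite !Rmult_0_l, Rplus_0_l, cos_0. real_eq. ring. }
    apply (is_lim_seq_scal_r _ (/ PI) (osc 0 0 0)).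
    apply (is_lim_seq_continuous (osc 0 0)); [ | apply is_lim_inv_seq].
    apply continuity_pt_filterlim, (ex_derive_continuous (osc 0 0)). eexists; apply osc_derivative.
  - destruct (rGamma_scaled_limit s ltac:(lra)) as [Hp Hl].
    pose proof (rGamma_reflection s ltac:(lra)) as HR.
    replace (Finite (exp (s * ln 2) * rGamma (1 - s))) with
      (Finite (0 + sin (s * PI) / PI * (exp (s * ln 2) / rGamma s)))
      by (f_equal; rewrite <- HR; field; lra).
    apply (is_lim_seq_ext (fun n => exp (s * ln (inv_seq n)) *
      ((cos (- s * (PI / 2)) * osc 0 (- s) (inv_seq n) + sin (- s * (PI / 2)) * osc (0 - PI / 2) (- s) (inv_seq n)) / PI)
      + sin (s * PI) / PI * scaled_expint s (inv_seq n))).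
    { intros n. unfold schlafli_J, scaled_expint. rewrite (Ropp_mult_distr_l_reverse s PI), sin_neg.
      field; lra. }
    apply is_lim_seq_plus'.
    + apply is_lim_seq_mult_bounded with 2. apply is_lim_inv_seq_power; lra.
      intros n. apply schlafli_J_osc_bound.
    + apply (is_lim_seq_scal_l _ (sin (s * PI) / PI) (exp (s * ln 2) / rGamma s)), Hl.
Qed.

(** The strip of orders [- s] in [(-1, 0]] is chosen so that the Wronskian with the orders [1 - s]
    tends to [0] at [0]: functions of order [- s] grow like [r^(-s)], those of order [1 - s] are
    bounded, and the factor [r] leaves [r^(1 - s)]. Being constant, the Wronskian is zero, so the
    two functions are proportional, and their equal leading coefficients give the factor [1]. *)
Lemma besselJ_eq_schlafli_base (s r : R) : 0 <= s < 1 -> 0 < r ->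
  besselJ (- s) r = schlafli_J (- s) r /\ besselJ (- s + 1) r = schlafli_J (- s + 1) r.
Proof.
  intros Hs Hr.
  set (L := exp (s * ln 2) * rGamma (1 - s)).
  assert (HL : 0 < L) by (apply Rmult_lt_0_compat; [apply exp_pos | apply rGamma_pos; lra]).
  assert (LS : is_lim_seq (fun n => exp (s * ln (inv_seq n)) * schlafli_J (- s) (inv_seq n)) L)
    by (apply schlafli_J_scaled_limit; auto).
  assert (LJ : is_lim_seq (fun n => exp (s * ln (inv_seq n)) * besselJ (- s) (inv_seq n)) L).
  { pose proof (besselJ_scaled_limit (- s)) as H. rewrite Ropp_involutive in H.
    replace (- s + 1) with (1 - s) in H by ring. exact H. }
  assert (LJ1 : is_lim_seq (fun n => exp (- (1 - s) * ln (inv_seq n)) * besselJ (- s + 1) (inv_seq n))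
    (exp (- (1 - s) * ln 2) * rGamma (1 - s + 1))).
  { replace (- s + 1) with (1 - s) by ring. apply besselJ_scaled_limit. }
  set (W := fun r => r * (schlafli_J (- s) r * besselJ (- s + 1) r - schlafli_J (- s + 1) r * besselJ (- s) r)).
  assert (W0 : is_lim_seq (fun n => W (inv_seq n)) 0).
  { destruct (schlafli_J_bounded (- s + 1) ltac:(lra)) as [B HB].
    apply (is_lim_seq_ext (fun n =>
      exp ((2 - 2 * s) * ln (inv_seq n)) * ((exp (s * ln (inv_seq n)) * schlafli_J (- s) (inv_seq n)) *
        (exp (- (1 - s) * ln (inv_seq n)) * besselJ (- s + 1) (inv_seq n)))
      - (exp ((1 - s) * ln (inv_seq n)) * (exp (s * ln (inv_seq n)) * besselJ (- s) (inv_seq n)))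
        * schlafli_J (- s + 1) (inv_seq n))).
    - intros n. destruct (inv_seq_pos n) as [Hp _]. unfold W. set (x := inv_seq n) in *.
      transitivity (exp ((2 - 2 * s) * ln x) * exp (s * ln x) * exp (- (1 - s) * ln x) *
        (schlafli_J (- s) x * besselJ (- s + 1) x) - exp ((1 - s) * ln x) * exp (s * ln x) *
        (besselJ (- s) x * schlafli_J (- s + 1) x)). ring.
      rewrite <- !exp_plus.
      replace ((2 - 2 * s) * ln x + s * ln x + - (1 - s) * ln x) with (ln x) by ring.
      replace ((1 - s) * ln x + s * ln x) with (ln x) by ring. rewrite exp_ln by auto. ring.
    - replace (Finite 0) with (Finite (0 * (L * (exp (- (1 - s) * ln 2) * rGamma (1 - s + 1))) - 0)) by (f_equal; ring).
      apply is_lim_seq_minus'.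
      + apply is_lim_seq_mult'. apply is_lim_inv_seq_power; lra. apply is_lim_seq_mult'; auto.
      + apply is_lim_seq_mult_bounded with B.
        * replace (Finite 0) with (Finite (0 * L)) by (f_equal; ring).
          apply is_lim_seq_mult'; auto. apply is_lim_inv_seq_power; lra.
        * intros n. apply HB, inv_seq_pos. }
  assert (WZ : forall x, 0 < x -> W x = 0).
  { intros x Hx. assert (H : is_lim_seq (fun n => W (inv_seq n)) (W x)).
    { apply (is_lim_seq_ext (fun _ => W x)); [ | apply is_lim_seq_const].
      intros n. apply (cylinder_wronskian schlafli_J besselJ (- s) x (inv_seq n));
      auto using schlafli_J_cylinder, besselJ_cylinder. apply inv_seq_pos. }
    apply is_lim_seq_unique in H, W0. rewrite H in W0. now injection W0. }
  destruct (besselJ_nonzero (- s) ltac:(lra)) as [x [Hx HJ]].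
  set (c := schlafli_J (- s) x / besselJ (- s) x).
  assert (EC : forall y, 0 < y -> 1 * schlafli_J (- s) y + - c * besselJ (- s) y = 0 /\
    1 * schlafli_J (- s + 1) y + - c * besselJ (- s + 1) y = 0).
  { apply (cylinder_zero (fun s r => 1 * schlafli_J s r + - c * besselJ s r) (- s) x); auto.
    - apply cylinder_lin. apply schlafli_J_cylinder. apply besselJ_cylinder.
    - unfold c. field; auto.
    - specialize (WZ x Hx). unfold W in WZ. apply Rmult_integral in WZ as [ | WZ]; [lra | ].
      unfold c. apply Rmult_eq_reg_r with (besselJ (- s) x); auto. field_simplify; auto. lra. }
  assert (Ec : c = 1).
  { assert (H : is_lim_seq (fun n => exp (s * ln (inv_seq n)) * schlafli_J (- s) (inv_seq n)) (c * L)).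
    { apply (is_lim_seq_ext (fun n => c * (exp (s * ln (inv_seq n)) * besselJ (- s) (inv_seq n)))).
      - intros n. destruct (EC (inv_seq n)) as [E _]. apply inv_seq_pos.
        replace (schlafli_J (- s) (inv_seq n)) with (c * besselJ (- s) (inv_seq n)) by lra. ring.
      - apply (is_lim_seq_scal_l _ c L); auto. }
    apply is_lim_seq_unique in H, LS. rewrite H in LS. injection LS. intros E.
    apply Rmult_eq_reg_r with L; lra. }
  destruct (EC r Hr) as [E1 E2]. rewrite Ec in *. lra.
Qed.

Lemma cylinder_agree (f g : R -> R -> R) (s r : R) : cylinder f -> cylinder g -> 0 < r ->
  f s r = g s r -> f (s + 1) r = g (s + 1) r -> forall n,
  (f (s + INR n) r = g (s + INR n) r /\ f (s + INR n + 1) r = g (s + INR n + 1) r) /\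
  (f (s - INR n) r = g (s - INR n) r /\ f (s - INR n + 1) r = g (s - INR n + 1) r).
Proof.
  intros Hf Hg Hr E0 E1 n. induction n as [ | n [[IH1 IH2] [IH3 IH4]]].
  - simpl. rewrite Rplus_0_r, Rminus_0_r. auto.
  - rewrite S_INR. split; split.
    + replace (s + (INR n + 1)) with (s + INR n + 1) by ring. auto.
    + replace (s + (INR n + 1) + 1) with (s + INR n + 1 + 1) by ring.
      destruct (Hf (s + INR n + 1) r Hr) as [_ F]. destruct (Hg (s + INR n + 1) r Hr) as [_ G].
      replace (s + INR n + 1 - 1) with (s + INR n) in * by ring. rewrite IH1, IH2 in F. lra.
    + replace (s - (INR n + 1)) with (s - INR n - 1) by ring.
      destruct (Hf (s - INR n) r Hr) as [_ F]. destruct (Hg (s - INR n) r Hr) as [_ G].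
      rewrite IH3, IH4 in F. lra.
    + replace (s - (INR n + 1) + 1) with (s - INR n) by ring. auto.
Qed.

Lemma besselJ_eq_schlafli (s r : R) : 0 < r -> besselJ s r = schlafli_J s r.
Proof.
  intros Hr.
  assert (base : forall t, 0 <= t < 1 -> forall n,
    besselJ (- t + INR n) r = schlafli_J (- t + INR n) r /\ besselJ (- t - INR n) r = schlafli_J (- t - INR n) r).
  { intros t Ht n. destruct (besselJ_eq_schlafli_base t r Ht Hr) as [E1 E2].
    destruct (cylinder_agree besselJ schlafli_J (- t) r besselJ_cylinder schlafli_J_cylinder Hr E1 E2 n)
      as [[H1 _] [H2 _]]. auto. }
  destruct (Rle_dec s 0) as [Hs | Hs].
  - destruct (nfloor_ex (- s) ltac:(lra)) as [n Hn].
    replace s with (- (- s - INR n) - INR n) by ring. apply base. lra.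
  - destruct (nfloor_ex s ltac:(lra)) as [n Hn].
    destruct (Req_dec s (INR n)) as [-> | Hne].
    + replace (INR n) with (- 0 + INR n) by ring. apply base. lra.
    + replace s with (- (INR (S n) - s) + INR (S n)) by ring. apply base. rewrite S_INR. lra.
Qed.

(** * Continuity in the order, and the function [Y] *)

Lemma expint_continuous_order (p c : R) : 0 < c -> continuous (fun p => expint p c) p.
Proof.
  intros Hc. apply (ex_derive_continuous (fun p => expint p c)).
  (* Since [t * t <= sinh t ^ 2] and nearby orders exceed [p - 1], the second moment at [p - 1] is a
     majorant uniform in the order. *)
  destruct (moment_fun_bound 2 (p - 1) c Hc) as [K [HK H]].
  exists (integral_inf (fun t => - t * moment_fun 0 p c t)).
  apply (is_derive_integral_inf (fun p => moment_fun 0 p c) (fun p t => - t * moment_fun 0 p c t)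
    (fun p t => t * t * moment_fun 0 p c t) p 1 (K / c ^ 2) (c / 4 + 1)).
  - lra.
  - intros; apply moment_dominated; auto.
  - split.
    + intros t. apply (ex_derive_continuous (fun t => - t * moment_fun 0 p c t)).
      unfold moment_fun, sinh. auto_derive; auto.
    + destruct (moment_dominated 1 p c Hc) as [_ [C [k [Hk HC]]]].
      exists C, k. split; auto. intros t Ht. eapply Rle_trans; [ | apply HC; auto].
      unfold moment_fun. rewrite !Rabs_mult, Rabs_Ropp, <- Rmult_assoc.
      apply Rmult_le_compat_r; auto using Rabs_pos. simpl.
      pose proof (sinh_ge t Ht). rewrite Rabs_R1, !Rmult_1_r, !Rabs_pos_eq; lra.
  - intros x t _. unfold moment_fun. auto_derive; auto. simpl. unfold Rminus. ring.
  - intros x t _. unfold moment_fun. auto_derive; auto. simpl. unfold Rminus. ring.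
  - intros x Hx. apply Rabs_lt_between in Hx. split. lra. intros t Ht.
    destruct (H c t (Rle_refl c) Ht) as [_ H2]. eapply Rle_trans; [ | apply H2].
    unfold moment_fun. pose proof (exp_pos (- (x * t) - c * sinh t)).
    pose proof (sinh_ge t Ht). simpl.
    rewrite Rabs_pos_eq by (repeat apply Rmult_le_pos; lra).
    rewrite Rmult_1_l, Rmult_1_r. apply Rmult_le_compat; try nra. apply exp_le. nra.
Qed.

Lemma osc_continuous_order (w s r : R) : continuous (fun s => osc w s r) s.
Proof.
  pose proof PI_RGT_0 as HPI. pose proof PI_4.
  apply (ex_derive_continuous (fun s => osc w s r)). unfold osc, osc_fun.
  exists (2 * RInt (fun phi => - phi * (cos (r * cos phi + w) * sin (s * phi))) 0 (PI / 2)).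
  apply (is_derive_scal (fun s => RInt (fun phi => cos (r * cos phi + w) * cos (s * phi)) 0 (PI / 2))).
  apply (is_derive_RInt_quadratic (fun s phi => cos (r * cos phi + w) * cos (s * phi))
    (fun s phi => - phi * (cos (r * cos phi + w) * sin (s * phi)))
    (fun s phi => - (phi * phi) * (cos (r * cos phi + w) * cos (s * phi))) 0 (PI / 2) s 1 4); try lra.
  - intros x u. apply (osc_fun_continuous w x r u).
  - intros u. auto_continuous.
  - intros x u. auto_derive; auto. ring.
  - intros x u. auto_derive; auto. ring.
  - intros x u _ Hu. rewrite Rabs_mult, Rabs_Ropp, (Rabs_pos_eq (u * u)) by nra.
    replace 4 with (4 * (1 * 1)) by ring. rewrite Rabs_mult.
    apply Rmult_le_compat; try nra. apply Rmult_le_pos; apply Rabs_pos.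
    apply Rmult_le_compat; auto using Rabs_pos; apply Rabs_le, COS_bound.
Qed.

Lemma schlafli_Y_continuous_order (s r : R) : 0 < r -> continuous (fun s => schlafli_Y s r) s.
Proof.
  intros Hr. unfold schlafli_Y, Rdiv, Rminus.
  assert (C1 : forall h : R -> R, (forall x, continuous h x) -> continuous (fun s => cos (h s)) s)
    by (intros; apply (continuous_comp h cos); auto using continuous_cos).
  assert (C2 : forall h : R -> R, (forall x, continuous h x) -> continuous (fun s => sin (h s)) s)
    by (intros; apply (continuous_comp h sin); auto using continuous_sin).
  assert (L : forall a x, continuous (fun s => s * a) x)
    by (intros; apply (ex_derive_continuous (fun s => s * a)); auto_derive; auto).
  apply (continuous_mult (K := R_AbsRing)); [ | apply continuous_const].
  repeat apply (continuous_plus (V := R_NormedModule)).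
  - apply (continuous_mult (K := R_AbsRing)). apply (C1 (fun s => s * (PI * / 2))); auto.
    apply osc_continuous_order.
  - apply (continuous_opp (V := R_NormedModule)). apply (continuous_mult (K := R_AbsRing)).
    apply (C2 (fun s => s * (PI * / 2))); auto. apply osc_continuous_order.
  - apply (continuous_opp (V := R_NormedModule)).
    apply (continuous_comp Ropp (fun p => expint p r)). apply (continuous_opp (V := R_NormedModule)), continuous_id.
    apply expint_continuous_order; auto.
  - apply (continuous_opp (V := R_NormedModule)). apply (continuous_mult (K := R_AbsRing)).
    apply (C1 (fun s => s * PI)); auto. apply expint_continuous_order; auto.
Qed.

Lemma besselY_quot_eq_schlafli (s r : R) : 0 < r -> sin (s * PI) <> 0 -> besselY_quot s r = schlafli_Y s r.
Proof.
  intros Hr Hs. unfold besselY_quot. rewrite !besselJ_eq_schlafli by auto.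
  rewrite <- schlafli_Y_J. field; auto.
Qed.

(** At an integer order the limit of the quotient is evaluated by replacing it with [schlafli_Y],
    which is continuous in the order there. *)
Lemma besselY_eq_schlafli (s r : R) : 0 < r -> besselY s r = schlafli_Y s r.
Proof.
  intros Hr. unfold besselY. destruct (Req_EM_T (sin (s * PI)) 0) as [E | E].
  2: apply besselY_quot_eq_schlafli; auto.
  assert (H : is_lim (fun t => besselY_quot t r) s (schlafli_Y s r)).
  { apply (is_lim_ext_loc (fun t => schlafli_Y t r)).
    (* The zeros of [sin (t * PI)] are at distance [1] from each other, so [s] is the only one in
       this neighbourhood. *)
    - exists (mkposreal 1 Rlt_0_1). intros t Ht Hne. symmetry. apply besselY_quot_eq_schlafli; auto.
      change (Rabs (t - s) < 1) in Ht. apply Rabs_lt_between in Ht.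
      replace (t * PI) with ((t - s) * PI + s * PI) by ring. rewrite sin_plus, E, Rmult_0_r, Rplus_0_r.
      pose proof (sin2_cos2 (s * PI)) as Hc. rewrite E in Hc. unfold Rsqr in Hc.
      pose proof PI_RGT_0 as HPI.
      apply Rmult_integral_contrapositive_currified.
      + destruct (Rle_dec t s).
        * apply Rlt_not_eq. apply sin_lt_0_var; nra.
        * apply Rgt_not_eq. apply sin_gt_0; nra.
      + intros E2. rewrite E2 in Hc. lra.
    - apply (is_lim_continuity (fun t => schlafli_Y t r) s), continuity_pt_filterlim. apply schlafli_Y_continuous_order; auto. }
  now rewrite (is_lim_unique _ _ _ H).
Qed.

(** * Interpolation between consecutive orders *)

Definition gint (eta p r : R) : R := r * kint eta p r.

Lemma gint_derivative (eta p r : R) : 0 < r -> 0 < eta < 1 ->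
  is_derive (gint eta p) r
    ((1 - eta) / r * gint eta p r + (gint (1 - eta) (p + 1) r - gint (1 - eta) (p - 1) r)).
Proof.
  intros Hr He. unfold gint.
  replace ((1 - eta) / r * (r * kint eta p r) + (r * kint (1 - eta) (p + 1) r - r * kint (1 - eta) (p - 1) r))
    with (1 * kint eta p r + r * (- (eta / r) * kint eta p r
      + (kint (1 - eta) (p + 1) r - kint (1 - eta) (p - 1) r))) by (field; lra).
  apply (is_derive_mult_R (fun r => r) (kint eta p)). apply (is_derive_id r).
  apply kint_derivative; auto.
Qed.

Lemma gint_recurrence (eta q r : R) : 0 < r -> 0 < eta < 1 ->
  (q + 1 - eta) * gint eta (q + 1) r - (q - 1 + eta) * gint eta (q - 1) r =
  r * (gint (1 - eta) (q - 2) r - gint (1 - eta) (q + 2) r).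
Proof.
  intros Hr He. pose proof (kint_recurrence eta q r Hr He) as E. unfold gint.
  transitivity (r * ((q + 1 - eta) * kint eta (q + 1) r - (q - 1 + eta) * kint eta (q - 1) r)). ring.
  rewrite E. ring.
Qed.

(* [A] and [B] serve the order [m]; [- C] and [(p - d) / r * B + F] serve [m + 1]. *)
Lemma gint_system (d p r : R) : 0 < r -> 0 < d < 1 ->
  let A := gint d p r in let B := gint (1 - d) (p - 1) r in
  let C := gint (1 - d) (p + 1) r in let F := gint d (p - 2) r in
  is_derive (gint d p) r ((1 - d) / r * A + C - B) /\
  is_derive (gint (1 - d) (p - 1)) r (d / r * B + A - F) /\
  is_derive (gint (1 - d) (p + 1)) r (- (p / r) * C + (p - d) / r * B + F - A) /\
  is_derive (gint d (p - 2)) r ((p - 1) / r * F - (p - d) / r * A + B - C).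
Proof.
  intros Hr Hd A B C F.
  pose proof (gint_derivative d p r Hr Hd) as D1.
  pose proof (gint_derivative (1 - d) (p - 1) r Hr ltac:(lra)) as D2.
  pose proof (gint_derivative (1 - d) (p + 1) r Hr ltac:(lra)) as D3.
  pose proof (gint_derivative d (p - 2) r Hr Hd) as D4.
  (* The derivatives of [C] and [F] involve [gint d (p + 2)] and [gint (1 - d) (p - 3)]; the two
     recurrences express these by the four functions and close the system. *)
  pose proof (gint_recurrence (1 - d) p r Hr ltac:(lra)) as E3.
  pose proof (gint_recurrence d (p - 1) r Hr Hd) as E4.
  replace (1 - (1 - d)) with d in * by ring.
  replace (p - 1 + 1) with p in * by ring. replace (p - 1 - 1) with (p - 2) in * by ring.
  replace (p + 1 + 1) with (p + 2) in * by ring. replace (p + 1 - 1) with p in * by ring.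
  replace (p - 2 + 1) with (p - 1) in * by ring. replace (p - 2 - 1) with (p - 3) in * by ring.
  replace (p - 1 - 2) with (p - 3) in * by ring. replace (p - 1 + 2) with (p + 1) in * by ring.
  refine (conj _ (conj _ (conj _ _))).
  - replace ((1 - d) / r * A + C - B) with ((1 - d) / r * A + (C - B)) by ring. exact D1.
  - replace (d / r * B + A - F) with (d / r * B + (A - F)) by ring. exact D2.
  - replace (- (p / r) * C + (p - d) / r * B + F - A) with (d / r * C + (gint d (p + 2) r - A)). exact D3.
    fold B C F in E3.
    replace (gint d (p + 2) r) with (F - ((p + 1 - (1 - d)) * C - (p - 1 + (1 - d)) * B) / r)
      by (rewrite E3; field; lra). field; lra.
  - replace ((p - 1) / r * F - (p - d) / r * A + B - C) with ((1 - d) / r * F + (B - gint (1 - d) (p - 3) r)).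
    exact D4. fold A C F in E4.
    replace (gint (1 - d) (p - 3) r) with (C + ((p - d) * A - (p - 2 + d) * F) / r)
      by (rewrite E4; field; lra). field; lra.
Qed.

Definition shifted_fst (d nu : R) (x1 x2 : R -> R) (r : R) : R :=
  gint d (2 * nu + (1 - d)) r * x1 r + gint (1 - d) (2 * nu + (1 - d) - 1) r * x2 r.

(** Forced by the first equation of [bessel_pair]: it is [(nu + 1 - d) / r] times [shifted_fst]
    minus its derivative. *)
Definition shifted_snd (d nu : R) (x1 x2 : R -> R) (r : R) : R :=
  - gint (1 - d) (2 * nu + (1 - d) + 1) r * x1 r +
  ((2 * nu + (1 - d) - d) / r * gint (1 - d) (2 * nu + (1 - d) - 1) r
    + gint d (2 * nu + (1 - d) - 2) r) * x2 r.

Lemma shifted_pair (d nu : R) (x1 x2 : R -> R) : 0 < d < 1 -> bessel_pair nu x1 x2 ->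
  bessel_pair (nu + (1 - d)) (shifted_fst d nu x1 x2) (shifted_snd d nu x1 x2).
Proof.
  intros Hd Hx r Hr. destruct (Hx r Hr) as [X1 X2].
  unfold shifted_fst, shifted_snd.
  set (p := 2 * nu + (1 - d)).
  destruct (gint_system d p r Hr Hd) as (D1 & D2 & D3 & D4).
  set (A := gint d p) in *. set (B := gint (1 - d) (p - 1)) in *.
  set (C := gint (1 - d) (p + 1)) in *. set (F := gint d (p - 2)) in *.
  clearbody A B C F. split.
  - auto_derive. repeat split; eexists; eassumption.
    apply is_derive_unique in D1, D2, D3, D4, X1, X2.
    eta_reduce.
    rewrite D1, D2, X1, X2. unfold p. field; lra.
  - auto_derive. repeat split; try (eexists; eassumption). lra.
    apply is_derive_unique in D1, D2, D3, D4, X1, X2.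
    eta_reduce.
    rewrite D2, D3, D4, X1, X2. unfold p. field; lra.
Qed.

(** The functions [p] and [q] are left arbitrary: only the rotation by the order is recorded. The
    error [1 / r] is small compared with the size [r^(-1/2)] of solutions. *)
Definition phase_asymptotic (f : R -> R -> R) (p q : R -> R) : Prop := forall s,
  exists K, forall r, 1 <= r ->
  Rabs (f s r - (cos (s * (PI / 2)) * p r + sin (s * (PI / 2)) * q r)) <= K / r.

(** At [oo] the combination of orders [nu - 1/2] and [nu + 1/2] with weights [kint_lim d] and
    [kint_lim (1 - d)] is an oscillation; these are its coordinates in the frame of order
    [nu + 1/2 - d], along the function and along its quarter turn. *)
Definition amp_x (d : R) : R := kint_lim d * sin (d * (PI / 2)) + kint_lim (1 - d) * cos (d * (PI / 2)).
Definition amp_y (d : R) : R := - kint_lim d * cos (d * (PI / 2)) + kint_lim (1 - d) * sin (d * (PI / 2)).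

Lemma gint_limit (eta p : R) : 0 < eta < 1 ->
  exists K, forall r, 1 <= r -> Rabs (gint eta p r - kint_lim eta) <= K / r.
Proof. intros He. apply (kint_limit eta p He). Qed.

Lemma Rabs_lin_le (a b x y X Y : R) : Rabs x <= X -> Rabs y <= Y ->
  Rabs (a * x + b * y) <= Rabs a * X + Rabs b * Y.
Proof.
  intros Hx Hy. eapply Rle_trans; [apply Rabs_triang | ]. rewrite !Rabs_mult.
  apply Rplus_le_compat; apply Rmult_le_compat_l; auto using Rabs_pos.
Qed.

(** The weights converge at rate [1 / r] and multiply quantities bounded after scaling by [sqrt r];
    the phase errors are [O(1 / r)] before that scaling. Hence the scaled difference is
    [O(r^(-1/2))], and its square has the form required by [bessel_pair_zero_inf]. *)
Lemma combination_asymptotic (f h : R -> R -> R) (g1 g2 p q : R -> R) (l1 l2 t s1 s2 R0 : R)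
  (p' q' : R -> R) : 1 <= R0 ->
  phase_asymptotic f p q -> phase_asymptotic h p' q' ->
  (exists B, forall r, R0 <= r -> sqrt r * Rabs (f s1 r) <= B /\ sqrt r * Rabs (f s2 r) <= B) ->
  (exists K, forall r, 1 <= r -> Rabs (g1 r - l1) <= K / r) ->
  (exists K, forall r, 1 <= r -> Rabs (g2 r - l2) <= K / r) ->
  (forall r, l1 * (cos (s1 * (PI / 2)) * p r + sin (s1 * (PI / 2)) * q r) +
     l2 * (cos (s2 * (PI / 2)) * p r + sin (s2 * (PI / 2)) * q r) =
     cos (t * (PI / 2)) * p' r + sin (t * (PI / 2)) * q' r) ->
  exists K, 0 <= K /\ forall r, R0 <= r ->
  (g1 r * (sqrt r * f s1 r) + g2 r * (sqrt r * f s2 r) - sqrt r * h t r) ^ 2 <= K / r.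
Proof.
  intros HR0 Hf Hh [B HB] [K1 H1] [K2 H2] E.
  destruct (Hf s1) as [K3 H3]. destruct (Hf s2) as [K4 H4]. destruct (Hh t) as [K5 H5].
  set (K := Rabs K1 * B + Rabs K2 * B + (Rabs l1 * Rabs K3 + Rabs l2 * Rabs K4 + Rabs K5)).
  exists (K ^ 2). split. apply pow2_ge_0. intros r Hr0. assert (Hr : 1 <= r) by lra.
  specialize (H1 r Hr). specialize (H2 r Hr). specialize (H3 r Hr). specialize (H4 r Hr).
  specialize (H5 r Hr). specialize (E r). destruct (HB r Hr0) as [B1 B2].
  set (w := sqrt r) in *. assert (Hw : 0 < w) by (apply sqrt_lt_R0; lra).
  assert (Hww : w * w = r) by (apply sqrt_sqrt; lra).
  assert (Hw1 : 1 <= w) by nra.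
  assert (HK : forall k, k / r <= Rabs k / r).
  { intros k. apply Rmult_le_compat_r. left; apply Rinv_0_lt_compat; lra. apply Rle_abs. }
  set (e3 := f s1 r - (cos (s1 * (PI / 2)) * p r + sin (s1 * (PI / 2)) * q r)) in *.
  set (e4 := f s2 r - (cos (s2 * (PI / 2)) * p r + sin (s2 * (PI / 2)) * q r)) in *.
  set (e5 := h t r - (cos (t * (PI / 2)) * p' r + sin (t * (PI / 2)) * q' r)) in *.
  set (Z := g1 r * (w * f s1 r) + g2 r * (w * f s2 r) - w * h t r).
  assert (EZ : Z = (g1 r - l1) * (w * f s1 r) + (g2 r - l2) * (w * f s2 r) + w * (l1 * e3 + l2 * e4 + - e5)).
  { unfold Z, e3, e4, e5. rewrite <- E. ring. }
  assert (T1 : forall g k y, Rabs g <= k / r -> w * Rabs y <= B -> Rabs (g * (w * y)) <= Rabs k * B / w).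
  { intros g k y Hg Hy. rewrite Rabs_mult, (Rabs_mult w), (Rabs_pos_eq w) by lra.
    apply Rle_trans with (Rabs k / r * B).
    - apply Rmult_le_compat; auto using Rabs_pos. apply Rmult_le_pos; auto using Rabs_pos; lra.
      eapply Rle_trans; [apply Hg | apply HK].
    - assert (0 <= Rabs k * B).
      { apply Rmult_le_pos. apply Rabs_pos. pose proof (Rabs_pos y). nra. }
      replace (Rabs k / r * B) with (Rabs k * B / r) by (field; lra).
      apply Rmult_le_compat_l; auto. apply Rinv_le_contravar; nra. }
  assert (T2 : Rabs (w * (l1 * e3 + l2 * e4 + - e5)) <= (Rabs l1 * Rabs K3 + Rabs l2 * Rabs K4 + Rabs K5) / w).
  { rewrite Rabs_mult, (Rabs_pos_eq w) by lra.
    replace ((Rabs l1 * Rabs K3 + Rabs l2 * Rabs K4 + Rabs K5) / w) with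
      (w * (Rabs l1 * (Rabs K3 / r) + Rabs l2 * (Rabs K4 / r) + Rabs K5 / r))
      by (rewrite <- Hww; field; lra).
    apply Rmult_le_compat_l. lra.
    eapply Rle_trans; [apply Rabs_triang | ]. rewrite Rabs_Ropp. apply Rplus_le_compat.
    apply Rabs_lin_le; eapply Rle_trans; eauto. eapply Rle_trans; eauto. }
  pose proof (T1 _ _ _ H1 B1) as T3. pose proof (T1 _ _ _ H2 B2) as T4.
  assert (HZ : Rabs Z <= K / w).
  { rewrite EZ. unfold K, Rdiv. rewrite !Rmult_plus_distr_r.
    eapply Rle_trans; [apply Rabs_triang | ]. apply Rplus_le_compat.
    eapply Rle_trans; [apply Rabs_triang | ]. apply Rplus_le_compat; auto.
    rewrite <- !Rmult_plus_distr_r. auto. }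
  rewrite <- pow2_abs. apply Rle_trans with ((K / w) ^ 2).
  apply pow_incr. split; auto using Rabs_pos.
  apply Req_le. rewrite <- Hww. field; lra.
Qed.

Lemma cylinder_decay (f : R -> R -> R) (s : R) : cylinder f ->
  exists B, forall r, 2 * Rabs (s + 1 / 2) + 1 <= r ->
    sqrt r * Rabs (f s r) <= B /\ sqrt r * Rabs (f (s + 1) r) <= B.
Proof.
  intros Hf. destruct (bessel_pair_bounded _ _ _ (cylinder_pair f s Hf)) as [B HB].
  exists (1 + B). intros r Hr. specialize (HB r Hr).
  assert (H : forall x, (sqrt r * x) ^ 2 <= B -> sqrt r * Rabs x <= 1 + B).
  { intros x Hx. rewrite <- (Rabs_pos_eq (sqrt r)), <- Rabs_mult by apply sqrt_pos.
    rewrite <- pow2_abs in Hx. pose proof (Rabs_pos (sqrt r * x)).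
    pose proof (pow2_ge_0 (Rabs (sqrt r * x) - 1)). nra. }
  pose proof (pow2_ge_0 (sqrt r * f s r)). pose proof (pow2_ge_0 (sqrt r * f (s + 1) r)).
  split; apply H; lra.
Qed.

Lemma order_combination (d nu : R) (f h : R -> R -> R) (p q : R -> R) : 0 < d < 1 ->
  cylinder f -> cylinder h -> phase_asymptotic f p q ->
  phase_asymptotic h (fun r => amp_x d * p r + amp_y d * q r) (fun r => amp_x d * q r - amp_y d * p r) ->
  forall r, 0 < r ->
  gint d (2 * nu + (1 - d)) r * f (nu - 1 / 2) r + gint (1 - d) (2 * nu + (1 - d) - 1) r * f (nu + 1 / 2) r
  = h (nu + 1 / 2 - d) r.
Proof.
  intros Hd Hf Hh Pf Ph r Hr.
  set (P := 2 * nu + (1 - d)).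
  assert (F := cylinder_pair f (nu - 1 / 2) Hf).
  assert (H := cylinder_pair h (nu + 1 / 2 - d) Hh).
  replace (nu - 1 / 2 + 1 / 2) with nu in F by field.
  replace (nu - 1 / 2 + 1) with (nu + 1 / 2) in F by field.
  replace (nu + 1 / 2 - d + 1 / 2) with (nu + (1 - d)) in H by field.
  apply (shifted_pair d nu _ _ Hd) in F.
  pose proof (bessel_pair_lin _ 1 (-1) _ _ _ _ F H) as D.
  set (R0 := 2 * Rabs (nu - 1 / 2 + 1 / 2) + 1).
  assert (HR0 : 1 <= R0) by (unfold R0; pose proof (Rabs_pos (nu - 1 / 2 + 1 / 2)); lra).
  assert (BF : exists B, forall r, R0 <= r ->
    sqrt r * Rabs (f (nu - 1 / 2) r) <= B /\ sqrt r * Rabs (f (nu + 1 / 2) r) <= B).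
  { destruct (cylinder_decay f (nu - 1 / 2) Hf) as [B HB].
    replace (nu - 1 / 2 + 1) with (nu + 1 / 2) in HB by field. exists B. auto. }
  (* [ph] is the phase of order [nu + 1/2] and [th] the angle back to order [nu + 1/2 - d]; with
     them the matching at [oo] is a rotation identity. *)
  set (th := d * (PI / 2)). set (ph := (nu + 1 / 2) * (PI / 2)).
  assert (A1 : (nu - 1 / 2) * (PI / 2) = ph - PI / 2) by (unfold ph; field).
  assert (A2 : (nu + 1 / 2 - d) * (PI / 2) = ph - th) by (unfold ph, th; field).
  assert (A3 : (nu + 1 / 2 - d + 1) * (PI / 2) = ph - th + PI / 2) by (unfold ph, th; field).
  pose proof (sin2_cos2 th) as Hth. unfold Rsqr in Hth.
  destruct (combination_asymptotic f h (gint d P) (gint (1 - d) (P - 1)) p q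
    (kint_lim d) (kint_lim (1 - d)) (nu + 1 / 2 - d) (nu - 1 / 2) (nu + 1 / 2) R0 _ _
    HR0 Pf Ph BF (gint_limit d P Hd) (gint_limit (1 - d) (P - 1) ltac:(lra))) as [K1 [HK1 L1]].
  { intros x. rewrite A1, A2. fold ph. unfold amp_x, amp_y. fold th.
    rewrite !cos_minus, !sin_minus, cos_PI2, sin_PI2.
    set (c := cos th) in *. set (s := sin th) in *.
    transitivity ((kint_lim d * sin ph + kint_lim (1 - d) * cos ph) * (s * s + c * c) * p x
      + (kint_lim (1 - d) * sin ph - kint_lim d * cos ph) * (s * s + c * c) * q x).
    rewrite Hth. ring. ring. }
  (* The term with [(P - d) / r] dies out, so the limiting weights of the companion are
     [- kint_lim (1 - d)] and [kint_lim d], a quarter turn of the first pair; this matches the order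
     raised by one. *)
  destruct (combination_asymptotic f h (fun r => - gint (1 - d) (P + 1) r)
    (fun r => (P - d) / r * gint (1 - d) (P - 1) r + gint d (P - 2) r) p q
    (- kint_lim (1 - d)) (kint_lim d) (nu + 1 / 2 - d + 1) (nu - 1 / 2) (nu + 1 / 2) R0 _ _
    HR0 Pf Ph BF) as [K2 [HK2 L2]].
  { destruct (gint_limit (1 - d) (P + 1) ltac:(lra)) as [K HK]. exists K. intros x Hx.
    replace (- gint (1 - d) (P + 1) x - - kint_lim (1 - d)) with (- (gint (1 - d) (P + 1) x - kint_lim (1 - d))) by ring.
    rewrite Rabs_Ropp. auto. }
  { destruct (gint_limit (1 - d) (P - 1) ltac:(lra)) as [K HK]. destruct (gint_limit d (P - 2) Hd) as [K' HK'].
    exists (Rabs (P - d) * (K + Rabs (kint_lim (1 - d))) + K'). intros x Hx.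
    specialize (HK x Hx). specialize (HK' x Hx).
    replace ((P - d) / x * gint (1 - d) (P - 1) x + gint d (P - 2) x - kint_lim d) with
      ((P - d) / x * gint (1 - d) (P - 1) x + (gint d (P - 2) x - kint_lim d)) by ring.
    eapply Rle_trans; [apply Rabs_triang | ].
    replace ((Rabs (P - d) * (K + Rabs (kint_lim (1 - d))) + K') / x) with
      (Rabs (P - d) / x * (K + Rabs (kint_lim (1 - d))) + K' / x) by (field; lra).
    apply Rplus_le_compat; auto.
    unfold Rdiv at 1. rewrite !Rabs_mult, Rabs_inv, (Rabs_pos_eq x) by lra.
    apply Rmult_le_compat_l. apply Rmult_le_pos. apply Rabs_pos. left; apply Rinv_0_lt_compat; lra.
    replace (gint (1 - d) (P - 1) x) with ((gint (1 - d) (P - 1) x - kint_lim (1 - d)) + kint_lim (1 - d)) by ring.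
    eapply Rle_trans; [apply Rabs_triang | ]. apply Rplus_le_compat_r.
    assert (HKp : 0 <= K / x) by (pose proof (Rabs_pos (gint (1 - d) (P - 1) x - kint_lim (1 - d))); lra).
    apply Rle_trans with (K / x); auto.
    assert (0 <= K). { replace K with (K / x * x) by (field; lra). apply Rmult_le_pos; lra. }
    apply Rle_div_l. lra. nra. }
  { intros x. rewrite A1, A3. fold ph. unfold amp_x, amp_y. fold th.
    rewrite cos_plus, sin_plus, !cos_minus, !sin_minus, cos_PI2, sin_PI2.
    set (c := cos th) in *. set (s := sin th) in *.
    transitivity ((kint_lim d * sin ph + kint_lim (1 - d) * cos ph) * (s * s + c * c) * q x
      - (kint_lim (1 - d) * sin ph - kint_lim d * cos ph) * (s * s + c * c) * p x).
    rewrite Hth. ring. ring. }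
  destruct (bessel_pair_zero_inf _ (K1 + K2) R0 _ _ D) with (r := r) as [E _]; auto.
  { intros x Hx. specialize (L1 x Hx). specialize (L2 x Hx).
    unfold shifted_fst, shifted_snd. fold P. cbv beta.
    set (u1 := sqrt x * f (nu - 1 / 2) x) in *. set (u2 := sqrt x * f (nu + 1 / 2) x) in *.
    replace ((K1 + K2) / x) with (K1 / x + K2 / x) by (unfold Rdiv; ring).
    apply Rplus_le_compat.
    - replace (1 * (gint d P x * u1 + gint (1 - d) (P - 1) x * u2) + -1 * (sqrt x * h (nu + 1 / 2 - d) x))
        with (gint d P x * u1 + gint (1 - d) (P - 1) x * u2 - sqrt x * h (nu + 1 / 2 - d) x) by ring. exact L1.
    - match goal with |- ?a ^ 2 <= _ => match type of L2 with ?b ^ 2 <= _ => replace a with b by ring end end.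
      exact L2. }
  unfold shifted_fst in E. fold P in E. pose proof (sqrt_lt_R0 r Hr) as Hs.
  apply Rmult_eq_reg_l with (sqrt r); [ | lra].
  lra.
Qed.

(** * The interpolation formula and its constant *)

Lemma schlafli_J_phase : phase_asymptotic schlafli_J osc_cos osc_sin.
Proof.
  intros s. destruct (schlafli_asymptotics s) as [K HK]. exists K. intros r Hr. apply HK; auto.
Qed.

Lemma schlafli_Y_phase : phase_asymptotic schlafli_Y osc_sin (fun r => - osc_cos r).
Proof.
  intros s. destruct (schlafli_asymptotics s) as [K HK]. exists K. intros r Hr.
  apply HK; auto.
Qed.

Lemma phase_asymptotic_lin (a b : R) (f g : R -> R -> R) (p q p' q' : R -> R) :
  phase_asymptotic f p q -> phase_asymptotic g p' q' ->
  phase_asymptotic (fun s r => a * f s r + b * g s r)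
    (fun r => a * p r + b * p' r) (fun r => a * q r + b * q' r).
Proof.
  intros Hf Hg s. destruct (Hf s) as [K1 H1]. destruct (Hg s) as [K2 H2].
  exists (Rabs a * K1 + Rabs b * K2). intros r Hr. specialize (H1 r Hr). specialize (H2 r Hr).
  replace ((Rabs a * K1 + Rabs b * K2) / r) with (Rabs a * (K1 / r) + Rabs b * (K2 / r)) by (unfold Rdiv; ring).
  match goal with |- Rabs ?x <= _ => replace x with
    (a * (f s r - (cos (s * (PI / 2)) * p r + sin (s * (PI / 2)) * q r)) +
     b * (g s r - (cos (s * (PI / 2)) * p' r + sin (s * (PI / 2)) * q' r))) by ring end.
  apply Rabs_lin_le; auto.
Qed.

Lemma phase_asymptotic_ext (f : R -> R -> R) (p q p' q' : R -> R) :
  (forall r, p r = p' r) -> (forall r, q r = q' r) ->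
  phase_asymptotic f p q -> phase_asymptotic f p' q'.
Proof.
  intros E1 E2 H s. destruct (H s) as [K HK]. exists K. intros r Hr. rewrite <- E1, <- E2. auto.
Qed.

(** In [- schlafli_Y] only [expint (- s) r], which is at least [expint 0 r], is large near [0]. For
    [r = 1 / (1 + sinh N)] the integrand of the latter is at least [exp (-1) >= 1 / 3] on
    [[0, N]]. *)
Lemma schlafli_Y_unbounded (s A : R) : 0 < s -> exists r, 0 < r /\ A <= - schlafli_Y s r.
Proof.
  intros Hs. pose proof PI_RGT_0 as HPI. pose proof PI_4 as HPI4.
  (* The share [4 * Rabs A] covers [A * PI], the [8] covers two oscillating integrals of size at
     most [PI <= 4], and [/ s] bounds [expint s r]; the factor [3] offsets the lower bound
     [N / 3]. *)
  destruct (nfloor_ex (3 * (4 * Rabs A + 8 + / s))) as [n [_ Hn]].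
  { pose proof (Rabs_pos A). assert (0 < / s) by (apply Rinv_0_lt_compat; auto). lra. }
  set (N := S n). assert (HN : 0 < INR N) by (apply lt_0_INR; unfold N; lia).
  assert (Hsh : 0 <= sinh (INR N)) by (pose proof (sinh_ge (INR N)); lra).
  set (r := / (1 + sinh (INR N))).
  assert (Hr : 0 < r) by (apply Rinv_0_lt_compat; lra).
  exists r. split; auto.
  assert (H0 : INR N / 3 <= expint 0 r).
  { apply Rle_trans with (RInt (moment_fun 0 0 r) 0 (INR N)).
    2:{ apply integral_inf_RInt_le. apply moment_dominated; auto.
        intros u _. unfold moment_fun. simpl. pose proof (exp_pos (- (0 * u) - r * sinh u)). lra. }
    replace (INR N / 3) with (RInt (fun _ => / 3) 0 (INR N)).
    2:{ rewrite RInt_const. change (scal ?a ?b) with (a * b). real_eq. field. }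
    apply RInt_le. lra. apply ex_RInt_cont; intros; apply continuous_const.
    apply ex_RInt_cont; intros; apply moment_continuous.
    intros t Ht. unfold moment_fun. simpl. rewrite Rmult_1_l.
    apply Rle_trans with (exp (- (1))).
    - rewrite exp_Ropp. apply Rinv_le_contravar. apply exp_pos. apply exp_le_3.
    - apply exp_le. assert (sinh t <= sinh (INR N)).
      { apply (le_of_derive_nonneg sinh cosh). lra. intros; apply is_derive_sinh.
        intros x _. pose proof (cosh_ge_1 x). lra. }
      assert (r * sinh t <= r * (1 + sinh (INR N))) by (apply Rmult_le_compat_l; lra).
      unfold r in H0 at 2. rewrite Rinv_l in H0 by lra. lra. }
  pose proof (expint_antitone (- s) 0 r Hr ltac:(lra)) as H1.
  pose proof (expint_le_inv s r Hs Hr) as H2. pose proof (expint_pos s r Hr) as H3.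
  assert (H4 : INR N = INR n + 1) by (unfold N; apply S_INR).
  unfold schlafli_Y.
  pose proof (osc_bound (0 - PI / 2) s r) as O1. pose proof (osc_bound 0 s r) as O2.
  assert (Hm : forall x y, -1 <= x <= 1 -> Rabs y <= PI -> - PI <= x * y <= PI).
  { intros x y Hx Hy. apply Rabs_le_between. rewrite Rabs_mult, <- (Rmult_1_l PI).
    apply Rmult_le_compat; auto using Rabs_pos. apply Rabs_le; lra. }
  pose proof (Hm _ _ (COS_bound (s * (PI / 2))) O1) as M1.
  pose proof (Hm _ _ (SIN_bound (s * (PI / 2))) O2) as M2.
  assert (M3 : - expint s r <= cos (s * PI) * expint s r) by (pose proof (COS_bound (s * PI)); nra).
  pose proof (Rle_abs A). pose proof (Rabs_pos A).
  apply Rmult_le_reg_r with PI; auto.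
  match goal with |- _ <= - (?x / PI) * PI => replace (- (x / PI) * PI) with (- x) by (field; lra) end.
  assert (A * PI <= Rabs A * 4) by nra.
  lra.
Qed.

(** At [nu = 1/2] the formula for [J] involves the orders [0], [1] and [1 - d], all nonnegative, and
    weights bounded by their limits. Everything but the term in [Y] is bounded near [0], and [Y] of
    order [1 - d > 0] is not, so its coefficient vanishes. This yields [kint_lim d * cos (d PI / 2)
    = kint_lim (1 - d) * sin (d PI / 2)] without evaluating either integral. *)
Lemma amp_y_eq_0 (d : R) : 0 < d < 1 -> amp_y d = 0.
Proof.
  intros Hd.
  assert (E : forall r, 0 < r -> gint d (2 * (1 / 2) + (1 - d)) r * schlafli_J (1 / 2 - 1 / 2) r +
     gint (1 - d) (2 * (1 / 2) + (1 - d) - 1) r * schlafli_J (1 / 2 + 1 / 2) r =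
     amp_x d * schlafli_J (1 / 2 + 1 / 2 - d) r + amp_y d * schlafli_Y (1 / 2 + 1 / 2 - d) r).
  { apply (order_combination d (1 / 2) schlafli_J (fun s r => amp_x d * schlafli_J s r + amp_y d * schlafli_Y s r)
      osc_cos osc_sin Hd schlafli_J_cylinder).
    - apply cylinder_lin. apply schlafli_J_cylinder. apply schlafli_Y_cylinder.
    - apply schlafli_J_phase.
    - eapply phase_asymptotic_ext; [ | | apply phase_asymptotic_lin;
        [apply schlafli_J_phase | apply schlafli_Y_phase]]; intros; simpl; ring. }
  destruct (schlafli_J_bounded (1 / 2 - 1 / 2) ltac:(lra)) as [B1 H1].
  destruct (schlafli_J_bounded (1 / 2 + 1 / 2) ltac:(lra)) as [B2 H2].
  destruct (schlafli_J_bounded (1 / 2 + 1 / 2 - d) ltac:(lra)) as [B3 H3].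
  set (C := kint_lim d * B1 + kint_lim (1 - d) * B2 + Rabs (amp_x d) * B3).
  assert (HC : forall r, 0 < r -> Rabs (amp_y d * schlafli_Y (1 / 2 + 1 / 2 - d) r) <= C).
  { intros r Hr. specialize (E r Hr). specialize (H1 r Hr). specialize (H2 r Hr). specialize (H3 r Hr).
    match type of E with ?x + ?y = ?z + ?t => replace t with (x + y + - z) by lra end.
    assert (G : forall eta p y B, 0 < eta < 1 -> 0 <= p -> Rabs y <= B ->
      Rabs (gint eta p r * y) <= kint_lim eta * B).
    { intros eta p y B He Hp Hy. pose proof (kint_upper eta p r Hr He Hp). pose proof (kint_pos eta p r Hr He).
      assert (0 < gint eta p r) by (apply Rmult_lt_0_compat; auto).
      rewrite Rabs_mult, (Rabs_pos_eq (gint eta p r)) by lra.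
      apply Rmult_le_compat; auto using Rabs_pos. lra. }
    unfold C. eapply Rle_trans; [apply Rabs_triang | ]. apply Rplus_le_compat.
    - eapply Rle_trans; [apply Rabs_triang | ]. apply Rplus_le_compat; apply G; auto; lra.
    - rewrite Rabs_Ropp, Rabs_mult. apply Rmult_le_compat_l; auto using Rabs_pos. }
  destruct (Req_dec (amp_y d) 0) as [ | Hne]; auto. exfalso.
  assert (Hp : 0 < Rabs (amp_y d)) by (apply Rabs_pos_lt; auto).
  destruct (schlafli_Y_unbounded (1 / 2 + 1 / 2 - d) ((C + 1) / Rabs (amp_y d)) ltac:(lra)) as [r [Hr HA]].
  specialize (HC r Hr). rewrite Rabs_mult in HC.
  pose proof (Rle_abs (- schlafli_Y (1 / 2 + 1 / 2 - d) r)) as H. rewrite Rabs_Ropp in H.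
  assert (Rabs (amp_y d) * ((C + 1) / Rabs (amp_y d)) <= Rabs (amp_y d) * Rabs (schlafli_Y (1 / 2 + 1 / 2 - d) r))
    by (apply Rmult_le_compat_l; lra).
  replace (Rabs (amp_y d) * ((C + 1) / Rabs (amp_y d))) with (C + 1) in H0 by (field; lra). lra.
Qed.

Lemma amp_x_pos (d : R) : 0 < d < 1 -> 0 < amp_x d.
Proof.
  intros Hd. pose proof PI_RGT_0.
  assert (0 < sin (d * (PI / 2))) by (apply sin_gt_0; nra).
  assert (0 < cos (d * (PI / 2))) by (apply cos_gt_0; nra).
  pose proof (kint_lim_pos d Hd). pose proof (kint_lim_pos (1 - d) ltac:(lra)).
  unfold amp_x. apply Rplus_lt_0_compat; apply Rmult_lt_0_compat; auto.
Qed.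

Lemma amp_x_sqr (d : R) : 0 < d < 1 -> amp_x d ^ 2 = kint_lim d ^ 2 + kint_lim (1 - d) ^ 2.
Proof.
  intros Hd. pose proof (amp_y_eq_0 d Hd) as H.
  transitivity (amp_x d ^ 2 + amp_y d ^ 2). rewrite H; ring.
  unfold amp_x, amp_y. pose proof (sin2_cos2 (d * (PI / 2))) as E. unfold Rsqr in E.
  set (s := sin _) in *. set (c := cos _) in *.
  transitivity ((kint_lim d ^ 2 + kint_lim (1 - d) ^ 2) * (s * s + c * c)). ring. rewrite E. ring.
Qed.

Lemma order_interpolation (d nu : R) (f : R -> R -> R) (p q : R -> R) : 0 < d < 1 ->
  cylinder f -> phase_asymptotic f p q -> forall r, 0 < r ->
  f (nu + 1 / 2 - d) r = gint d (2 * nu + (1 - d)) r / amp_x d * f (nu - 1 / 2) r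
    + gint (1 - d) (2 * nu + (1 - d) - 1) r / amp_x d * f (nu + 1 / 2) r.
Proof.
  intros Hd Hf Pf r Hr. pose proof (amp_x_pos d Hd) as HX. pose proof (amp_y_eq_0 d Hd) as HY.
  (* Since [amp_y d = 0], the target of the interpolation is a multiple of [f] itself; the summand
     [0 * f s r] gives it the shape of [phase_asymptotic_lin]. *)
  assert (E := order_combination d nu f (fun s r => amp_x d * f s r + 0 * f s r) p q Hd Hf
    (cylinder_lin _ _ _ _ Hf Hf) Pf).
  specialize (E ltac:(eapply phase_asymptotic_ext; [ | | apply phase_asymptotic_lin; [apply Pf | apply Pf]];
    intros; simpl; rewrite HY; ring) r Hr).
  cbv beta in E.
  apply Rmult_eq_reg_l with (amp_x d); [ | lra].
  transitivity (amp_x d * f (nu + 1 / 2 - d) r + 0 * f (nu + 1 / 2 - d) r). ring.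
  rewrite <- E. field; lra.
Qed.

(** * The inequality *)

Lemma is_derive_locally_const (f : R -> R) (c r0 r l : R) : r0 < r ->
  (forall x, r0 < x -> f x = c) -> is_derive f r l -> l = 0.
Proof.
  intros Hr Hc D. apply is_derive_unique in D. rewrite <- D.
  apply is_derive_unique. apply (is_derive_ext_loc (fun _ => c)).
  - exists (mkposreal (r - r0) ltac:(lra)). intros y Hy.
    change (Rabs (y - r) < r - r0) in Hy. apply Rabs_lt_between in Hy. symmetry. apply Hc. lra.
  - apply (is_derive_const c).
Qed.

(* For [nu = 0] the pair [x1, x2] is a rotation and [y = shifted_fst] solves
   [y'' + (1 + d (1 - d) / r^2) y = 0]; the energy [y^2 + y'^2 / (1 + d (1 - d) / r^2)]
   increases to its limit [amp_x d ^ 2 * (x1^2 + x2^2)]. *)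
Lemma zero_order_bound (d r0 : R) : 0 < d < 1 -> 0 < r0 ->
  gint d (1 - d) r0 ^ 2 + gint (1 - d) (- d) r0 ^ 2 < amp_x d ^ 2.
Proof.
  intros Hd Hr0.
  set (a0 := gint d (1 - d) r0). set (b0 := gint (1 - d) (- d) r0).
  set (M := a0 ^ 2 + b0 ^ 2). set (L := amp_x d ^ 2).
  set (k := d * (1 - d)). assert (Hk : 0 < k) by (unfold k; nra).
  assert (Ha0 : 0 < a0) by (apply Rmult_lt_0_compat; auto; apply kint_pos; auto).
  assert (HM : 0 < M) by (unfold M; pose proof (pow_lt a0 2 Ha0); pose proof (pow2_ge_0 b0); lra).
  (* The rotation that starts from [(a0, b0)] at [r0]: it makes [y r0] equal to [M], so the energy
     at [r0] is at least [M^2], and a bound [M * L] on the energy gives [M <= L]. *)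
  set (x1 := fun r => a0 * cos (r - r0) - b0 * sin (r - r0)).
  set (x2 := fun r => a0 * sin (r - r0) + b0 * cos (r - r0)).
  assert (Hx : bessel_pair 0 x1 x2).
  { intros r Hr. unfold x1, x2. split; auto_derive; auto; unfold Rminus; field; lra. }
  assert (Hn : forall r, x1 r ^ 2 + x2 r ^ 2 = M).
  { intros r. unfold x1, x2, M. pose proof (sin2_cos2 (r - r0)) as E. unfold Rsqr in E.
    set (s := sin _) in *. set (c := cos _) in *.
    transitivity ((a0 ^ 2 + b0 ^ 2) * (s * s + c * c)). ring. rewrite E. ring. }
  pose proof (shifted_pair d 0 x1 x2 Hd Hx) as HU.
  set (y := shifted_fst d 0 x1 x2) in *. set (w := shifted_snd d 0 x1 x2) in *.
  assert (Ey : y r0 = M).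
  { unfold y, shifted_fst, x1, x2, M. rewrite Rminus_diag, cos_0, sin_0.
    replace (2 * 0 + (1 - d)) with (1 - d) by ring. replace (1 - d - 1) with (- d) by ring.
    fold a0 b0. ring. }
  set (z := fun r => (1 - d) / r * y r - w r).
  set (q := fun r => 1 + k / r ^ 2).
  assert (Hq : forall r, 0 < r -> 1 < q r).
  { intros r Hr. unfold q. assert (0 < k / r ^ 2) by (apply Rdiv_lt_0_compat; auto; apply pow_lt; auto). lra. }
  assert (Dy : forall r, 0 < r -> is_derive y r (z r)).
  { intros r Hr. destruct (HU r Hr) as [D _]. rewrite Rplus_0_l in D. exact D. }
  assert (Dz : forall r, 0 < r -> is_derive z r (- q r * y r)).
  { intros r Hr. pose proof (Dy r Hr) as D1. destruct (HU r Hr) as [_ D2]. rewrite Rplus_0_l in D2.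
    unfold z, q. clearbody y w. auto_derive. repeat split; try (eexists; eassumption). lra.
    apply is_derive_unique in D1, D2.
    eta_reduce. rewrite D1, D2.
    unfold z, k. field; lra. }
  set (H := fun r => y r ^ 2 + z r ^ 2 / q r).
  assert (DH : forall r, 0 < r -> is_derive H r (z r ^ 2 * (2 * k / r ^ 3) / q r ^ 2)).
  { intros r Hr. pose proof (Dy r Hr) as D1. pose proof (Dz r Hr) as D2. pose proof (Hq r Hr) as Q.
    unfold H. clearbody y z. unfold q in *.
    auto_derive. repeat split; try (eexists; eassumption). apply Rgt_not_eq; nra.
    simpl in Q |- *. lra.
    apply is_derive_unique in D1, D2.
    eta_reduce. rewrite D1, D2.
    field. split. lra. simpl in Q. apply Rgt_not_eq.
    replace (r ^ 2 + k) with (r ^ 2 * (1 + k / r ^ 2)) by (field; lra). apply Rmult_lt_0_compat. apply pow_lt; auto. simpl; lra. }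
  assert (DHp : forall r, 0 < r -> 0 <= z r ^ 2 * (2 * k / r ^ 3) / q r ^ 2).
  { intros r Hr. specialize (Hq r Hr). apply Rdiv_le_0_compat. 2: apply pow_lt; lra.
    apply Rmult_le_pos. apply pow2_ge_0. apply Rdiv_le_0_compat. lra. apply pow_lt; auto. }
  assert (HI : forall s t, 0 < s <= t -> H s <= H t).
  { intros s t Hst. apply (le_of_derive_nonneg H (fun r => z r ^ 2 * (2 * k / r ^ 3) / q r ^ 2)).
    lra. intros; apply DH; lra. intros; apply DHp; lra. }
  (* As the energy increases, a bound along large integers suffices. There [y] and [z] approach
     [l1 x1 + l2 x2] and [l2 x1 - l1 x2], whose squares add up to [(l1^2 + l2^2) * M]. *)
  assert (HL : forall r, 0 < r -> H r <= M * L).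
  { set (l1 := kint_lim d). set (l2 := kint_lim (1 - d)).
    destruct (gint_limit d (2 * 0 + (1 - d)) Hd) as [K1 H1].
    destruct (gint_limit (1 - d) (2 * 0 + (1 - d) - 1) ltac:(lra)) as [K2 H2].
    destruct (gint_limit (1 - d) (2 * 0 + (1 - d) + 1) ltac:(lra)) as [K3 H3].
    destruct (gint_limit d (2 * 0 + (1 - d) - 2) Hd) as [K4 H4].
    set (ey := fun n => y (INR (S n)) - (l1 * x1 (INR (S n)) + l2 * x2 (INR (S n)))).
    set (ez := fun n => z (INR (S n)) - (l2 * x1 (INR (S n)) - l1 * x2 (INR (S n)))).
    assert (LY : is_lim_seq ey 0 /\ is_lim_seq ez 0).
    { assert (B1 : forall r, Rabs (x1 r) <= 1 + M /\ Rabs (x2 r) <= 1 + M).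
      { intros r. specialize (Hn r). pose proof (pow2_abs (x1 r)). pose proof (pow2_abs (x2 r)).
        split; [pose proof (pow2_ge_0 (Rabs (x1 r) - 1)); pose proof (pow2_ge_0 (x2 r)) |
          pose proof (pow2_ge_0 (Rabs (x2 r) - 1)); pose proof (pow2_ge_0 (x1 r))];
        pose proof (Rabs_pos (x1 r)); pose proof (Rabs_pos (x2 r)); nra. }
      assert (LG : forall g l K, (forall r, 1 <= r -> Rabs (g r - l) <= K / r) ->
        is_lim_seq (fun n => g (INR (S n)) - l) 0).
      { intros g l K Hg. apply is_lim_seq_abs_0.
        apply (is_lim_seq_le_le (fun _ => 0) _ (fun n => K * inv_seq n)).
        - intros n. split. apply Rabs_pos. apply Hg. rewrite S_INR. pose proof (pos_INR n). lra.
        - apply is_lim_seq_const.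
        - replace (Finite 0) with (Rbar_mult K 0) by (simpl; f_equal; ring).
          apply is_lim_seq_scal_l, is_lim_inv_seq. }
      pose proof (LG _ _ _ H1) as G1. pose proof (LG _ _ _ H2) as G2.
      pose proof (LG _ _ _ H3) as G3. pose proof (LG _ _ _ H4) as G4.
      assert (X1 : forall u, is_lim_seq u 0 -> is_lim_seq (fun n => u n * x1 (INR (S n))) 0).
      { intros u Hu. apply is_lim_seq_mult_bounded with (1 + M); auto. intros; apply B1. }
      assert (X2 : forall u, is_lim_seq u 0 -> is_lim_seq (fun n => u n * x2 (INR (S n))) 0).
      { intros u Hu. apply is_lim_seq_mult_bounded with (1 + M); auto. intros; apply B1. }
      assert (Add : forall u v, is_lim_seq u 0 -> is_lim_seq v 0 -> is_lim_seq (fun n => u n + v n) 0).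
      { intros u v Hu Hv. replace (Finite 0) with (Finite (0 + 0)) by (f_equal; ring). apply is_lim_seq_plus'; auto. }
      assert (Inv : forall u l, is_lim_seq (fun n => u n - l) 0 -> is_lim_seq (fun n => inv_seq n * u n) 0).
      { intros u l Hu. apply (is_lim_seq_ext (fun n => inv_seq n * (u n - l) + l * inv_seq n)).
        intros; ring. apply Add. replace (Finite 0) with (Finite (0 * 0)) by (f_equal; ring).
        apply is_lim_seq_mult'; auto. apply is_lim_inv_seq.
        replace (Finite 0) with (Rbar_mult l 0) by (simpl; f_equal; ring).
        apply is_lim_seq_scal_l, is_lim_inv_seq. }
      assert (Sc : forall c u, is_lim_seq u 0 -> is_lim_seq (fun n => c * u n) 0).
      { intros c u Hu. replace (Finite 0) with (Rbar_mult c 0) by (simpl; f_equal; ring).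
        apply is_lim_seq_scal_l; auto. }
      split.
      { refine (is_lim_seq_ext _ _ _ _ (Add _ _ (X1 _ G1) (X2 _ G2))).
        intros n. unfold ey, y, shifted_fst. fold l1 l2. simpl. ring. }
      refine (is_lim_seq_ext _ _ _ _ (Add _ _ (Sc (1 - d) _ (X1 _ (Inv _ _ G1)))
        (Add _ _ (Sc d _ (X2 _ (Inv _ _ G2))) (Add _ _ (X1 _ G3) (Sc (-1) _ (X2 _ G4)))))).
      intros n. unfold ez, z, y, w, shifted_fst, shifted_snd. fold l1 l2. unfold inv_seq.
      pose proof (INR_S_pos n).
      set (N := INR (S n)) in *.
      generalize (gint d (2 * 0 + (1 - d)) N) (gint (1 - d) (2 * 0 + (1 - d) - 1) N)
        (gint (1 - d) (2 * 0 + (1 - d) + 1) N) (gint d (2 * 0 + (1 - d) - 2) N).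
      intros g1 g2 g3 g4. field; lra. }
    destruct LY as [LY LZ].
    assert (ML : forall r, (l1 * x1 r + l2 * x2 r) ^ 2 + (l2 * x1 r - l1 * x2 r) ^ 2 = M * L).
    { intros r. unfold L. rewrite amp_x_sqr, <- (Hn r) by auto. fold l1 l2. ring. }
    intros r Hr.
    assert (ML0 : 0 <= M * L) by (apply Rmult_le_pos; [lra | apply pow2_ge_0]).
    set (C := 2 * (1 + M * L)).
    assert (Hup : forall n, y (INR (S n)) ^ 2 + z (INR (S n)) ^ 2 <=
      M * L + (C * Rabs (ey n) + Rabs (ey n) * Rabs (ey n)) + (C * Rabs (ez n) + Rabs (ez n) * Rabs (ez n))).
    { intros n. specialize (ML (INR (S n))).
      replace (y (INR (S n))) with ((l1 * x1 (INR (S n)) + l2 * x2 (INR (S n))) + ey n) by (unfold ey; ring).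
      replace (z (INR (S n))) with ((l2 * x1 (INR (S n)) - l1 * x2 (INR (S n))) + ez n) by (unfold ez; ring).
      set (u := l1 * x1 (INR (S n)) + l2 * x2 (INR (S n))) in *.
      set (v := l2 * x1 (INR (S n)) - l1 * x2 (INR (S n))) in *.
      assert (A : forall s e, s ^ 2 <= M * L -> 2 * s * e <= C * Rabs e).
      { intros s e Hs. apply Rle_trans with (Rabs (2 * s * e)). apply Rle_abs.
        rewrite !Rabs_mult, (Rabs_pos_eq 2) by lra. apply Rmult_le_compat_r. apply Rabs_pos.
        unfold C. apply Rmult_le_compat_l. lra. rewrite <- pow2_abs in Hs.
        pose proof (pow2_ge_0 (Rabs s - 1)). pose proof (Rabs_pos s). nra. }
      pose proof (pow2_ge_0 u). pose proof (pow2_ge_0 v).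
      pose proof (A u (ey n) ltac:(lra)). pose proof (A v (ez n) ltac:(lra)).
      pose proof (pow2_abs (ey n)). pose proof (pow2_abs (ez n)).
      replace ((u + ey n) ^ 2 + (v + ez n) ^ 2) with
        (u ^ 2 + v ^ 2 + (2 * u * ey n + ey n ^ 2) + (2 * v * ez n + ez n ^ 2)) by ring.
      simpl in *. lra. }
    assert (HLim : is_lim_seq (fun n => M * L + (C * Rabs (ey n) + Rabs (ey n) * Rabs (ey n))
      + (C * Rabs (ez n) + Rabs (ez n) * Rabs (ez n))) (M * L)).
    { assert (A : forall e, is_lim_seq e 0 -> is_lim_seq (fun n => C * Rabs (e n) + Rabs (e n) * Rabs (e n)) 0).
      { intros e He. apply is_lim_seq_abs in He. simpl in He. rewrite Rabs_R0 in He.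
        replace (Finite 0) with (Finite (C * 0 + 0 * 0)) by (f_equal; ring).
        apply is_lim_seq_plus'. apply (is_lim_seq_scal_l _ C 0); auto. apply is_lim_seq_mult'; auto. }
      replace (Finite (M * L)) with (Finite (M * L + 0 + 0)) by (f_equal; ring).
      apply is_lim_seq_plus'; auto. apply is_lim_seq_plus'; auto. apply is_lim_seq_const. }
    destruct (nfloor_ex r ltac:(lra)) as [N HN].
    apply (is_lim_seq_incr_n _ N) in HLim.
    apply (is_lim_seq_le (fun _ => H r) _ (H r) (M * L)) with (3 := HLim); [ | apply is_lim_seq_const].
    intros n. eapply Rle_trans; [ | apply Hup].
    assert (Hr2 : r <= INR (S (n + N))).
    { rewrite S_INR, plus_INR. pose proof (pos_INR n). lra. }
    apply Rle_trans with (H (INR (S (n + N)))). apply HI; lra.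
    unfold H. specialize (Hq (INR (S (n + N))) ltac:(lra)). apply Rplus_le_compat_l.
    pose proof (pow2_ge_0 (z (INR (S (n + N))))).
    apply Rle_div_l. lra. nra. }
  assert (H0 : M ^ 2 <= H r0).
  { unfold H. rewrite Ey. specialize (Hq r0 Hr0).
    assert (0 <= z r0 ^ 2 / q r0) by (apply Rdiv_le_0_compat; [apply pow2_ge_0 | lra]). lra. }
  assert (HML : M <= L).
  { specialize (HL r0 Hr0). apply Rmult_le_reg_l with M; auto. simpl in H0. lra. }
  (* Equality would freeze the energy beyond [r0], hence force [z = 0] there, then [y = 0] by the
     second-order equation, against the positive energy [M^2]. *)
  destruct (Rle_lt_or_eq_dec _ _ HML) as [ | E]; auto. exfalso.
  assert (HC : forall r, r0 < r -> H r = M ^ 2).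
  { intros r Hr. apply Rle_antisym. specialize (HL r ltac:(lra)). rewrite <- E in HL. simpl; lra.
    eapply Rle_trans; [apply H0 | ]. apply HI; lra. }
  assert (Z0 : forall r, r0 < r -> z r = 0).
  { intros r Hr. pose proof (is_derive_locally_const H _ r0 r _ Hr HC (DH r ltac:(lra))) as Z.
    specialize (Hq r ltac:(lra)).
    assert (HP : 0 < (2 * k / r ^ 3) / q r ^ 2).
    { apply Rdiv_lt_0_compat. apply Rdiv_lt_0_compat. lra. apply pow_lt; lra. apply pow_lt; lra. }
    unfold Rdiv at 1 in Z. rewrite Rmult_assoc in Z. apply Rmult_integral in Z as [Z | Z].
    apply Rsqr_0_uniq. unfold Rsqr. simpl in Z. lra.
    unfold Rdiv at 1 in HP. lra. }
  pose proof (is_derive_locally_const z _ r0 (r0 + 1) _ ltac:(lra) Z0 (Dz (r0 + 1) ltac:(lra))) as Y0.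
  specialize (Hq (r0 + 1) ltac:(lra)).
  assert (Y1 : y (r0 + 1) = 0) by (apply Rmult_integral in Y0 as [ | ]; lra).
  specialize (HC (r0 + 1) ltac:(lra)). unfold H in HC. rewrite Y1, Z0 in HC by lra.
  pose proof (pow_lt M 2 HM). unfold Rdiv in HC. simpl in *. lra.
Qed.

Lemma interpolation_weights (d nu r : R) : 0 < d < 1 -> 0 <= nu -> 0 < r ->
  (gint d (2 * nu + (1 - d)) r / amp_x d) ^ 2 + (gint (1 - d) (2 * nu + (1 - d) - 1) r / amp_x d) ^ 2 < 1.
Proof.
  intros Hd Hnu Hr. pose proof (amp_x_pos d Hd) as HX. pose proof (zero_order_bound d r Hd Hr) as Z.
  assert (HX2 : 0 < amp_x d ^ 2) by (apply pow_lt; auto).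
  assert (G : forall eta p q, 0 < eta < 1 -> p <= q -> gint eta q r ^ 2 <= gint eta p r ^ 2).
  { intros eta p q He Hpq. apply pow_incr. unfold gint. split.
    left; apply Rmult_lt_0_compat; auto; apply kint_pos; auto.
    apply Rmult_le_compat_l. lra. apply kint_antitone; auto. }
  pose proof (G d (1 - d) (2 * nu + (1 - d)) Hd ltac:(lra)).
  pose proof (G (1 - d) (- d) (2 * nu + (1 - d) - 1) ltac:(lra) ltac:(lra)).
  unfold Rdiv. rewrite !Rpow_mult_distr, <- Rmult_plus_distr_r, pow_inv.
  apply Rmult_lt_reg_r with (amp_x d ^ 2); auto. rewrite Rmult_assoc, Rinv_l by lra. lra.
Qed.

(** A common zero at two consecutive orders makes the combination vanish identically at order
    [nu + 1/2 > 0]. There [J] is bounded near [0] and [Y] is not, so [b = 0]; then [a = 0] because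
    [J] is not identically zero. *)
Lemma consecutive_independent (a b nu r : R) : 0 <= nu -> 0 < r ->
  a * schlafli_J (nu - 1 / 2) r + b * schlafli_Y (nu - 1 / 2) r = 0 ->
  a * schlafli_J (nu + 1 / 2) r + b * schlafli_Y (nu + 1 / 2) r = 0 -> a = 0 /\ b = 0.
Proof.
  intros Hnu Hr E1 E2.
  assert (Z : forall x, 0 < x -> a * schlafli_J (nu + 1 / 2) x + b * schlafli_Y (nu + 1 / 2) x = 0).
  { intros x Hx.
    assert (C := cylinder_zero (fun s r => a * schlafli_J s r + b * schlafli_Y s r) (nu - 1 / 2) r
      (cylinder_lin _ _ _ _ schlafli_J_cylinder schlafli_Y_cylinder) Hr E1).
    cbv beta in C. replace (nu - 1 / 2 + 1) with (nu + 1 / 2) in C by field.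
    apply (C E2 x Hx). }
  assert (Hb : b = 0).
  { destruct (Req_dec b 0) as [ | Hb]; auto. exfalso.
    destruct (schlafli_J_bounded (nu + 1 / 2) ltac:(lra)) as [B HB].
    destruct (schlafli_Y_unbounded (nu + 1 / 2) (Rabs (a / b) * B + 1) ltac:(lra)) as [x [Hx HY]].
    specialize (HB x Hx). specialize (Z x Hx).
    assert (E : - schlafli_Y (nu + 1 / 2) x = a / b * schlafli_J (nu + 1 / 2) x).
    { apply Rmult_eq_reg_l with b; auto. field_simplify; auto. lra. }
    rewrite E in HY.
    pose proof (Rle_abs (a / b * schlafli_J (nu + 1 / 2) x)) as H. rewrite Rabs_mult in H.
    assert (Rabs (a / b) * Rabs (schlafli_J (nu + 1 / 2) x) <= Rabs (a / b) * B)
      by (apply Rmult_le_compat_l; auto using Rabs_pos). lra. }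
  split; auto. subst b.
  destruct (besselJ_nonzero (nu + 1 / 2) ltac:(lra)) as [x [Hx HJ]].
  rewrite besselJ_eq_schlafli in HJ by auto. specialize (Z x Hx). rewrite Rmult_0_l, Rplus_0_r in Z.
  apply Rmult_integral in Z as [ | ]; tauto.
Qed.

(** Lagrange's identity for the real parts [p1], [p2] and the imaginary parts [q1], [q2]
    separately. *)
Lemma cauchy_schwarz_strict (al be p1 p2 q1 q2 : R) : al ^ 2 + be ^ 2 < 1 ->
  0 < p1 ^ 2 + q1 ^ 2 + (p2 ^ 2 + q2 ^ 2) ->
  (al * p1 + be * p2) ^ 2 + (al * q1 + be * q2) ^ 2 < p1 ^ 2 + q1 ^ 2 + (p2 ^ 2 + q2 ^ 2).
Proof.
  intros H S. apply Rle_lt_trans with ((al ^ 2 + be ^ 2) * (p1 ^ 2 + q1 ^ 2 + (p2 ^ 2 + q2 ^ 2))).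
  - pose proof (pow2_ge_0 (al * p2 - be * p1)). pose proof (pow2_ge_0 (al * q2 - be * q1)). nra.
  - nra.
Qed.

Lemma Cmod_sqr (z : C) : Cmod z ^ 2 = fst z ^ 2 + snd z ^ 2.
Proof.
  unfold Cmod. rewrite pow2_sqrt; auto.
  pose proof (pow2_ge_0 (fst z)). pose proof (pow2_ge_0 (snd z)). lra.
Qed.

Lemma bessel_comb_sqr (a b : C) (s r : R) : 0 < r ->
  Cmod (bessel_comb a b s r) ^ 2 =
  (fst a * schlafli_J s r + fst b * schlafli_Y s r) ^ 2 +
  (snd a * schlafli_J s r + snd b * schlafli_Y s r) ^ 2.
Proof.
  intros Hr. rewrite Cmod_sqr. unfold bessel_comb. rewrite besselJ_eq_schlafli, besselY_eq_schlafli by auto.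
  simpl. ring.
Qed.

Theorem theorem1p1 (a b : C) (hab : (a, b) <> (RtoC 0, RtoC 0))
  (mu nu r : R) (hmu : - (1 / 2) < mu < 1 / 2) (hnu : 0 <= nu) (hr : 0 < r) :
  Cmod (bessel_comb a b (mu + nu) r) ^ 2
    < Cmod (bessel_comb a b (nu - 1 / 2) r) ^ 2
      + Cmod (bessel_comb a b (nu + 1 / 2) r) ^ 2.
Proof.
  set (d := 1 / 2 - mu). assert (Hd : 0 < d < 1) by (unfold d; lra).
  replace (mu + nu) with (nu + 1 / 2 - d) by (unfold d; ring).
  rewrite !bessel_comb_sqr by auto.
  rewrite (order_interpolation d nu _ _ _ Hd schlafli_J_cylinder schlafli_J_phase r hr).
  rewrite (order_interpolation d nu _ _ _ Hd schlafli_Y_cylinder schlafli_Y_phase r hr).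
  pose proof (interpolation_weights d nu r Hd hnu hr) as HW.
  set (al := gint d (2 * nu + (1 - d)) r / amp_x d) in *.
  set (be := gint (1 - d) (2 * nu + (1 - d) - 1) r / amp_x d) in *.
  set (J1 := schlafli_J (nu - 1 / 2) r). set (J2 := schlafli_J (nu + 1 / 2) r).
  set (Y1 := schlafli_Y (nu - 1 / 2) r). set (Y2 := schlafli_Y (nu + 1 / 2) r).
  replace (fst a * (al * J1 + be * J2) + fst b * (al * Y1 + be * Y2)) with
    (al * (fst a * J1 + fst b * Y1) + be * (fst a * J2 + fst b * Y2)) by ring.
  replace (snd a * (al * J1 + be * J2) + snd b * (al * Y1 + be * Y2)) with
    (al * (snd a * J1 + snd b * Y1) + be * (snd a * J2 + snd b * Y2)) by ring.
  apply cauchy_schwarz_strict; auto.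
  set (u1 := fst a * J1 + fst b * Y1). set (u2 := fst a * J2 + fst b * Y2).
  set (v1 := snd a * J1 + snd b * Y1). set (v2 := snd a * J2 + snd b * Y2).
  pose proof (pow2_ge_0 u1). pose proof (pow2_ge_0 u2).
  pose proof (pow2_ge_0 v1). pose proof (pow2_ge_0 v2).
  (* If the right-hand side were zero, the real and the imaginary parts of [(a, b)] would each give
     a real combination vanishing at both orders, so both parts would be zero. *)
  destruct (Rlt_le_dec 0 (u1 ^ 2 + v1 ^ 2 + (u2 ^ 2 + v2 ^ 2))) as [ | Hle]; auto. exfalso.
  assert (Sq : forall x, x ^ 2 <= 0 -> x = 0).
  { intros x Hx. apply Rsqr_0_uniq. unfold Rsqr. pose proof (pow2_ge_0 x). simpl in *. lra. }
  destruct (consecutive_independent (fst a) (fst b) nu r hnu hr) as [F1 F2].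
  { apply Sq. fold J1 Y1 u1. lra. } { apply Sq. fold J2 Y2 u2. lra. }
  destruct (consecutive_independent (snd a) (snd b) nu r hnu hr) as [G1 G2].
  { apply Sq. fold J1 Y1 v1. lra. } { apply Sq. fold J2 Y2 v2. lra. }
  apply hab. destruct a as [a1 a2], b as [b1 b2]. simpl in *. subst. reflexivity.
Qed.
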